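(* Let $D>0$ and $\sigma>0$. For every $T>0$, $$\int_{\mathbb{R}}\big(E_0^{\mathrm{bb},1;T}\tau_a\big)\,\mu^{\mathrm{Gauss},1}_{\sigma^2}(da)=\begin{cases} T\Big(\dfrac{DT}{DT-4\sigma^2}\Big)^{\frac12}-T+\dfrac{T\sigma}{\sqrt{DT}+2\sigma}, & T>\frac{4\sigma^2}{D};\\[2mm] \infty, & T\le \frac{4\sigma^2}{D}.\end{cases}$$ Equivalently, writing $T=\frac{\sigma^2}{D}\mathcal{T}$ with $\mathcal{T}>0$, $$\int_{\mathbb{R}}\big(E_0^{\mathrm{bb},1;\frac{\sigma^2}{D}\mathcal{T}}\tau_a\big)\,\mu^{\mathrm{Gauss},1}_{\sigma^2}(da)=\begin{cases}\dfrac{\sigma^2}{D}\Big(\mathcal{T}\big(\frac{\mathcal{T}}{\mathcal{T}-4}\big)^{\frac12}-\mathcal{T}+\dfrac{\mathcal{T}}{2+\sqrt{\mathcal{T}}}\Big), & \mathcal{T}>4;\\[2mm] \infty, & \mathcal{T}\le 4.\end{cases}$$ Moreover, $$\inf_{T>0}\int_{\mathbb{R}}\big(E_0^{\mathrm{bb},1;T}\tau_a\big)\,\mu^{\mathrm{Gauss},1}_{\sigma^2}(da)\approx 4.847\,\frac{\sigma^2}{D},$$ with the infimum attained at $T\approx 10.136\,\frac{\sigma^2}{D}$.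
   Context: Fix a diffusion coefficient $D>0$. One-dimensional Brownian motion with diffusion coefficient $D$ is the diffusion with generator $\frac D2\frac{d^2}{dx^2}$ (variance $Dt$ at time $t$). The one-dimensional Brownian bridge with bridge time interval $T$ and diffusion coefficient $D$ is the Brownian motion with diffusion coefficient $D$ started at the origin and conditioned to be at the origin at time $T$; it can be represented as $W(t)-\frac tT W(T)$, $0\le t\le T$, where $W$ is a one-dimensional Brownian motion with diffusion coefficient $D$ started from $0$. Brownian bridge reset search process: let $\{B_n^{\mathrm{bb},1;T}(t),\,0\le t\le T\}$, $n=0,1,2,\dots$, be independent one-dimensional Brownian bridges with bridge time interval $T$ and diffusion coefficient $D$, and set $X^{\mathrm{bb},1;T}(t)=B_n^{\mathrm{bb},1;T}(t-nT)$ for $t\in[nT,(n+1)T)$, $n=0,1,2,\dots$. $E_0^{\mathrm{bb},1;T}$ denotes expectation for this process starting from $0$. For $a\in\mathbb{R}$, $\tau_a=\inf\{t\ge 0: X^{\mathrm{bb},1;T}(t)=a\}$. $\mu^{\mathrm{Gauss},1}_{\sigma^2}$ is the centered Gaussian distribution on $\mathbb{R}$ with variance $\sigma^2$, i.e. with density $\frac{1}{\sqrt{2\pi}\,\sigma}e^{-\frac{a^2}{2\sigma^2}}$. The symbol $\approx$ denotes a decimal numerical approximation; no explicit error tolerance is specified. *)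

(* Defs.v *)
From HB Require Import structures.
From mathcomp Require Export all_boot all_order all_algebra.
From mathcomp Require Export all_classical all_reals all_analysis.
Export Order.TTheory GRing.Theory Num.Theory.
Export numFieldNormedType.Exports.

#[export] Set Implicit Arguments.
#[export] Unset Strict Implicit.
#[export] Unset Printing Implicit Defensive.

Local Open Scope classical_set_scope.
Local Open Scope ring_scope.

(* It is applied to families of sigma-algebras only: each [F i] then contains
   [setT], so the product rule over initial segments gives it over every finite
   set of indices. *)
Definition mutually_independent d (Omega : measurableType d) (R : realType)
    (P : probability Omega R) (F : nat -> set (set Omega)) : Prop :=
  forall (n : nat) (E : nat -> set Omega), (forall i, (i < n)%N -> F i (E i)) ->
    P (\bigcap_(i < n) E i) = (\prod_(i < n) P (E i))%E.

(* One-dimensional Brownian motion with diffusion coefficient [D] (variance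
   [D * t] at time [t]) started at 0.  Only the times [t >= 0] matter. *)
Definition brownian_motion d (Omega : measurableType d) (R : realType)
    (P : probability Omega R) (D : R) (W : R -> {RV P >-> R}) : Prop :=
  [/\ {ae P, forall w, W 0 w = 0},
      forall s t : R, 0 <= s -> s < t -> forall A : set R, measurable A ->
        P ((fun w => W t w - W s w) @^-1` A)
        = normal_prob 0 (Num.sqrt (D * (t - s))) A,
      forall t : nat -> R, 0 <= t 0%N -> (forall i, t i <= t i.+1) ->
        mutually_independent P (fun i =>
          preimage_set_system setT (fun w => W (t i.+1) w - W (t i) w)
            measurable)
    & {ae P, forall w, {within `[0, +oo[, continuous (fun t : R => W t w)}}].

(* Brownian bridge on [0, T]: a process with almost surely continuous paths and
   the law of t |-> W(t) - (t / T) W(T) for a Brownian motion W.  Being a bridge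
   is a property of the law, so W may live on another probability space. *)
Definition brownian_bridge d (Omega : measurableType d) (R : realType)
    (P : probability Omega R) (D T : R) (B : R -> {RV P >-> R}) : Prop :=
  {ae P, forall w, {within `[0, T], continuous (fun t : R => B t w)}} /\
  exists (d' : measure_display) (Omega' : measurableType d')
         (P' : probability Omega' R) (W : R -> {RV P' >-> R}),
    brownian_motion D W /\
    forall (n : nat) (t : nat -> R) (A : nat -> set R),
      (forall i, (i < n)%N -> 0 <= t i <= T) ->
      (forall i, (i < n)%N -> measurable (A i)) ->
      P (\bigcap_(i < n) ((B (t i) : Omega -> R) @^-1` A i))
      = P' (\bigcap_(i < n)
              ((fun w => W (t i) w - t i / T * W T w) @^-1` A i)).

Definition bridge_sigma_algebra d (Omega : measurableType d) (R : realType)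
    (P : probability Omega R) (T : R) (B : R -> {RV P >-> R}) :
    set (set Omega) :=
  <<s \bigcup_(t in `[0, T]) preimage_set_system setT (B t) measurable >>.

Definition independent_bridges d (Omega : measurableType d) (R : realType)
    (P : probability Omega R) (D T : R) (B : nat -> R -> {RV P >-> R}) : Prop :=
  (forall n, brownian_bridge D T (B n)) /\
  mutually_independent P (fun n => bridge_sigma_algebra T (B n)).

(* For t >= 0, [Num.truncn (t / T)] is the n with t in [nT, (n+1)T). *)
Definition reset_process d (Omega : measurableType d) (R : realType)
    (P : probability Omega R) (T : R) (B : nat -> R -> {RV P >-> R})
    (t : R) (w : Omega) : R :=
  let n := Num.truncn (t / T) in B n (t - n%:R * T) w.

(* Equal to +oo on the paths that never reach [a]. *)
Definition hitting_time (Omega : Type) (R : realType) (X : R -> Omega -> R)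
    (a : R) (w : Omega) : \bar R :=
  ereal_inf [set t%:E | t in [set t : R | 0 <= t /\ X t w = a]].

Definition mean_hitting_time d (Omega : measurableType d) (R : realType)
    (P : probability Omega R) (T : R) (B : nat -> R -> {RV P >-> R})
    (a : R) : \bar R :=
  (\int[P]_w hitting_time (reset_process T B) a w)%E.

(* [normal_prob] takes the standard deviation. *)
Definition gauss_mean_search_time d (Omega : measurableType d) (R : realType)
    (P : probability Omega R) (sigma T : R) (B : nat -> R -> {RV P >-> R}) :
    \bar R :=
  (\int[normal_prob 0 sigma]_a mean_hitting_time T B a)%E.

(* Main.v *)
(* Let [p = exp (- 2 a^2 / (D T))] be the probability that a bridge reaches
   [a > 0].  The number of bridges that miss [a] is geometric, so that
   [E tau_a = (1/p) int_0^T P (max_[0,t] B < a) dt].  In the clock [T t / (T - t)]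
   the process [a + T (B t - a) / (T - t)] is a Brownian motion with constant
   drift, and it exceeds [a] exactly when [B] does.  Reflecting its path from the
   first exceedance along a dyadic grid costs an exponential weight (Girsanov),
   and refining the grid yields the law of the maximum over [0, t] for [t < T].
   With [k = 2 a / sqrt (D T)] and phi the standard normal density, the
   substitution [t = (T/2) (1 + y / sqrt (1 + y^2))] and Tonelli give
     [E tau_a = T (exp (k^2/2) - 1) + (T/2) int k phi(k y) / (1 + y^2) dy].
   Averaged over the Gaussian target, the first term is an exponential moment,
   finite iff [T > 4 sigma^2 / D]; in the second one phi turns into the Cauchy
   density of scale [c = sqrt (D T) / (2 sigma)], which leaves
   [int dy / ((1 + y^2) (y^2 + c^2)) = pi / (c (1 + c))].
   With [sqrt calT = w + 1/w] the mean becomes a rational function of [w];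
   polynomial inequalities confine its minimizer to a short rational interval. *)
From HB Require Import structures.
Require Import Defs.
From mathcomp Require Import measurable_realfun ring lra.

Local Open Scope classical_set_scope.
Local Open Scope ring_scope.

(** Two obstacles shape the proof. A bridge is given only by its finite-dimensional laws and the
    almost sure continuity of its paths, and the Brownian motion behind it may live on another
    space; so events are built from closed half-lines at countably many times, and the hitting time
    is replaced by a measurable version off a null set. Moreover, instead of a strong Markov
    property at a continuous passage time, reflection at the first grid exceedance asks only that
    one increment of [drifted] be Gaussian and independent of the grid past. That independence is a
    rotation: for independent centered Gaussians x, y of variances v1, v2, the combinations x + y
    and v2 x - v1 y are uncorrelated, so conditioning on the terminal increment leaves the second
    one fresh. An increment of [drifted] has mean and variance in the constant ratio - a / (D T).
    Hence one exponent serves all grids, and since the path lies above [a] where it is reflected,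
    the weights have a common integrable bound. The clock explodes at T, so survival of a whole
    bridge is reached as a limit of times below T. *)

Section density.
Context d (T : measurableType d) (R : realType).
Import HBNNSimple.

(** The density is given set by set, so the two integrals are compared on simple functions and
    monotone convergence does the rest. In the application [nu] is [normal_prob] and [mu] the
    Lebesgue measure. *)
Lemma ge0_integral_density (mu nu : {measure set T -> \bar R}) (g : T -> R) :
  measurable_fun setT g -> (forall x, 0 <= g x) ->
  (forall A, measurable A -> nu A = \int[mu]_(x in A) (g x)%:E)%E ->
  forall f : T -> \bar R, measurable_fun setT f -> (forall x, 0 <= f x)%E ->
  (\int[nu]_x f x = \int[mu]_x (f x * (g x)%:E))%E.
Proof.
move=> mg g0 nuE f mf f0.
pose h := nnsfun_approx measurableT mf.
have hf x : (EFin \o h n) x @[n --> \oo] --> f x by exact: cvg_nnsfun_approx.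
transitivity (limn (fun n => \int[nu]_x (EFin \o h n) x)%E).
  rewrite -monotone_convergence//.
  - by apply: eq_integral => x _; apply/esym/cvg_lim => //; exact: hf.
  - by move=> n; exact/measurable_EFinP.
  - by move=> n x _; rewrite lee_fin.
  - by move=> x _ a b ab; rewrite lee_fin; exact/lefP/nd_nnsfun_approx.
transitivity (limn (fun n => \int[mu]_x ((h n x)%:E * (g x)%:E))%E); last first.
  rewrite -monotone_convergence//.
  - by apply: eq_integral => x _; apply/cvg_lim => //; apply: cvgeZr => //; exact: hf.
  - move=> n; apply: emeasurable_funM; exact/measurable_EFinP.
  - by move=> n x _; rewrite mule_ge0 ?lee_fin.
  - move=> x _ a b ab; rewrite lee_wpmul2r ?lee_fin//.
    exact/lefP/nd_nnsfun_approx.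
congr (limn _); apply/funext => n.
rewrite integralT_nnsfun sintegralE.
under [RHS]eq_integral do rewrite fimfunE -EFinM mulr_fsuml -fsumEFin//.
rewrite ge0_integral_fsum//; last 2 first.
- move=> r; apply/measurable_EFinP; apply: measurable_funM => //.
  exact: measurable_funM.
- move=> r x _; rewrite lee_fin mulr_ge0//.
  by rewrite -lee_fin nnfun_muleindic_ge0.
apply: eq_fsbigr => r; rewrite inE => -[x _ hx].
rewrite nuE// -ge0_integralZl//=; first last.
- by rewrite -hx lee_fin.
- by move=> y _; rewrite lee_fin.
- exact/measurable_EFinP/measurable_funTS.
rewrite [LHS]integral_mkcond/=; apply: eq_integral => y _.
rewrite patchE indicE; case: ifPn => _ /=; first by rewrite mulr1 -EFinM.
by rewrite mulr0 mul0r.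
Qed.

End density.

Section pushforward_measure.
Context d d' (T1 : measurableType d) (T2 : measurableType d') (R : realType).
Variables (m : {measure set T1 -> \bar R}) (f : T1 -> T2).
Hypothesis mf : measurable_fun setT f.

Definition pushm : {measure set T2 -> \bar R} :=
  measure_function_pushforward__canonical__measure_function_Measure m mf.

End pushforward_measure.

(** * Lebesgue integrals under affine maps *)

Section affine.
Context (R : realType).
Notation mu := (@lebesgue_measure R).

(** Uniqueness of the Lebesgue measure, applied to [|c|] times the push-forward, leaves only
    half-open intervals to compute; a negative [c] swaps their open and closed ends. *)
Lemma lebesgue_measure_affine (c b : R) (A : set R) : c != 0 -> measurable A ->
  (mu ((fun x => c * x + b)%R @^-1` A) = (`|c|^-1)%:E * mu A)%E.
Proof.
move=> c0 mA.
have mphi : measurable_fun setT (fun x : R => c * x + b).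
  by apply: measurable_funD => //; exact: measurable_funM.
have k0 : 0 <= `|c| by [].
have mphi' : measurable_fun [set: measurableTypeR R]
   (fun x : R => (c * x + b : measurableTypeR R)) by exact: mphi.
pose m1 : {measure set (measurableTypeR R) -> \bar R} :=
  mscale (NngNum k0) (pushm mu mphi').
have m1E X : m1 X = (`|c|%:E * mu ((fun x : R => c * x + b)%R @^-1` X))%E by [].
have -> : mu A = m1 A.
  apply: (lebesgue_measure_unique (mu := m1)) => //.
  move=> _ [[x y] _ <-] /=.
  rewrite m1E.
  have [cp|cn] : 0 < c \/ c < 0.
    by move: c0; rewrite neq_lt => /orP[]; [right|left].
  - rewrite (_ : _ @^-1` _ = `](x - b) / c, (y - b) / c]%classic); last first.
      apply/seteqP; split => z /=; rewrite !in_itv/= ltr_pdivrMr// ler_pdivlMr//;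
        by rewrite ltrBlDr lerBrDr [z * c]mulrC.
    rewrite !lebesgue_measure_itv/=.
    rewrite !lte_fin ltr_pM2r ?invr_gt0// ltrD2r.
    case: ifPn => _; last by rewrite mule0.
    by rewrite -!EFinB -EFinM gtr0_norm//; congr (_%:E); field; rewrite gt_eqF.
  - rewrite (_ : _ @^-1` _ = `[(y - b) / c, (x - b) / c[%classic); last first.
      apply/seteqP; split => z /=; rewrite !in_itv/= ltr_ndivlMr// ler_ndivrMr//;
        by rewrite ltrBlDr lerBrDr [z * c]mulrC andbC.
    rewrite !lebesgue_measure_itv/=.
    rewrite !lte_fin ltr_nM2r ?invr_lt0// ltrD2r.
    case: ifPn => _; last by rewrite mule0.
    by rewrite -!EFinB -EFinM ltr0_norm//; congr (_%:E); field; rewrite lt_eqF.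
by rewrite m1E muleA -EFinM mulVf ?mul1e// normr_eq0.
Qed.

Lemma ge0_integral_affine (c b : R) (f : R -> \bar R) : c != 0 ->
  measurable_fun setT f -> (forall x, 0 <= f x)%E ->
  (\int[mu]_x f (c * x + b)%R = (`|c|^-1)%:E * \int[mu]_x f x)%E.
Proof.
move=> c0 mf f0.
have mphi : measurable_fun [set: measurableTypeR R]
    (fun x : R => (c * x + b : measurableTypeR R)).
  by apply: measurable_funD => //; exact: measurable_funM.
have k0 : 0 <= `|c|^-1 by rewrite invr_ge0.
transitivity (\int[pushm mu mphi]_x f x)%E.
  by rewrite ge0_integral_pushforward.
rewrite -[RHS](ge0_integral_mscale mu measurableT (NngNum k0))//.
apply: eq_measure_integral => A mA _.
exact: (lebesgue_measure_affine b c0 mA).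
Qed.

End affine.

(** * Gaussian densities: affine maps, tilting, reflection, rotation *)

Section gauss.
Context (R : realType).
Notation mu := (@lebesgue_measure R).
Implicit Types (m s v x c b l : R).

Lemma normal_pdfV m v x : 0 < v ->
  normal_pdf m (Num.sqrt v) x =
  (Num.sqrt (2 * pi * v))^-1 * expR (- ((x - m) ^+ 2 / (2 * v))).
Proof.
move=> v0; rewrite normal_pdfE; last by rewrite gt_eqF// sqrtr_gt0.
rewrite /normal_peak /normal_fun sqr_sqrtr ?ltW//.
congr (_ * expR _); first by congr (_ ^-1); congr Num.sqrt; ring.
by rewrite mulNr -mulr_natl.
Qed.

Lemma ge0_integral_normal_prob m s (f : R -> \bar R) :
  measurable_fun setT f -> (forall x, 0 <= f x)%E ->
  (\int[normal_prob m s]_x f x = \int[mu]_x (f x * (normal_pdf m s x)%:E))%E.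
Proof.
move=> mf f0; apply: (@ge0_integral_density _ _ _ mu (normal_prob m s)) => //.
  exact: measurable_normal_pdf.
by move=> x; exact: normal_pdf_ge0.
Qed.

Lemma normal_prob_indic m s (A : set R) : measurable A ->
  (normal_prob m s A = \int[mu]_x ((\1_A x)%:E * (normal_pdf m s x)%:E))%E.
Proof.
move=> mA; rewrite -ge0_integral_normal_prob//.
  by rewrite integral_indic// setIT.
exact/measurable_EFinP/measurable_indic.
Qed.

Lemma normal_pdf_affine c b m v x : c != 0 -> 0 < v ->
  `|c| * normal_pdf (c * m + b) (Num.sqrt (c ^+ 2 * v)) (c * x + b) =
  normal_pdf m (Num.sqrt v) x.
Proof.
move=> c0 v0; have c20 : 0 < c ^+ 2 by rewrite exprn_even_gt0.
rewrite !normal_pdfV//; last exact: mulr_gt0.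
rewrite (_ : 2 * pi * (c ^+ 2 * v) = c ^+ 2 * (2 * pi * v)); last by ring.
rewrite sqrtrM ?ltW// sqrtr_sqr invfM -[X in _ * X]mulrA mulVKf ?normr_eq0//.
congr (_ * expR (- _)); field; rewrite ?c0 ?(gt_eqF v0)//=.
Qed.

Lemma normal_prob_affine c b m v (A : set R) : c != 0 -> 0 < v -> measurable A ->
  (normal_prob m (Num.sqrt v) ((fun x => c * x + b)%R @^-1` A) =
   normal_prob (c * m + b)%R (Num.sqrt (c ^+ 2 * v)) A)%E.
Proof.
move=> c0 v0 mA.
have mphi : measurable_fun setT (fun x : R => c * x + b).
  by apply: measurable_funD => //; exact: measurable_funM.
have mA' : measurable ((fun x => c * x + b)%R @^-1` A).
  by rewrite -[X in measurable X]setTI; exact: mphi.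
rewrite (normal_prob_indic m (Num.sqrt v) mA').
rewrite (normal_prob_indic (c * m + b) (Num.sqrt (c ^+ 2 * v)) mA).
pose f y := ((\1_A y)%:E * (normal_pdf (c * m + b) (Num.sqrt (c ^+ 2 * v)) y)%:E)%E.
have mf : measurable_fun setT f.
  apply: emeasurable_funM; apply/measurable_EFinP.
    exact: measurable_indic.
  exact: measurable_normal_pdf.
have f0 x : (0 <= f x)%E by rewrite mule_ge0 ?lee_fin// normal_pdf_ge0.
rewrite -/f.
have := ge0_integral_affine b c0 mf f0 => fE.
have -> : (\int[mu]_x f x = `|c|%:E * \int[mu]_x f (c * x + b)%R)%E.
  by rewrite fE muleA -EFinM divff ?mul1e// normr_eq0.
rewrite -ge0_integralZl//; last first.
  exact: (measurableT_comp mf).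
by apply: eq_integral => x _; rewrite /f -(normal_pdf_affine b m x c0 v0) EFinM [RHS]muleCA.
Qed.

Lemma normal_pdf_tilt l m v x : 0 < v ->
  expR (l * x) * normal_pdf m (Num.sqrt v) x =
  expR (l * m + l ^+ 2 * v / 2) * normal_pdf (m + l * v) (Num.sqrt v) x.
Proof.
move=> v0; rewrite !normal_pdfV// mulrCA [RHS]mulrCA -!expRD.
by congr (_ * expR _); field; rewrite gt_eqF.
Qed.

(** The density at [- x] is [expR (- 2 * m * x / v)] times the density at [x]: the Girsanov weight
    of a single increment. *)
Lemma ge0_integral_normal_reflect m v (f : R -> \bar R) : 0 < v ->
  measurable_fun setT f -> (forall x, 0 <= f x)%E ->
  (\int[normal_prob m (Num.sqrt v)]_x f x =
   \int[normal_prob m (Num.sqrt v)]_x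
     (f (- x)%R * (expR (- 2 * m * x / v))%:E))%E.
Proof.
move=> v0 mf f0.
have mN : measurable_fun setT (fun x => f (- x)%R).
  by apply: (measurableT_comp mf).
have mE : measurable_fun setT (fun x : R => expR (- 2 * m * x / v)).
  by apply: measurableT_comp => //; apply: measurable_funM => //.
rewrite !ge0_integral_normal_prob//; last 2 first.
- by apply: emeasurable_funM => //; exact/measurable_EFinP.
- by move=> x; rewrite mule_ge0// lee_fin expR_ge0.
pose g x := (f x * (normal_pdf m (Num.sqrt v) x)%:E)%E.
have mg : measurable_fun setT g.
  by apply: emeasurable_funM => //; apply/measurable_EFinP; exact: measurable_normal_pdf.
have g0 x : (0 <= g x)%E by rewrite mule_ge0// lee_fin normal_pdf_ge0.
have n10 : -1 != 0 :> R by rewrite oppr_eq0 oner_eq0.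
have := ge0_integral_affine 0 n10 mg g0.
rewrite normrN1 invr1 mul1e -/g => <-.
apply: eq_integral => x _; rewrite /g addr0 mulN1r -muleA; congr (_ * _)%E.
rewrite -EFinM; congr (_%:E); rewrite !normal_pdfV// mulrCA -expRD.
by congr (_ * expR _); field; rewrite gt_eqF.
Qed.

(** Density form of the change of variables [z = x + y], [r = v2 * x - v1 * y], whose Jacobian is
    [v1 + v2]. The exponents separate because [z] and [r] are uncorrelated. *)
Lemma normal_pdf_rotation (v1 v2 r z : R) : 0 < v1 -> 0 < v2 ->
  (v1 + v2)^-1 * (normal_pdf 0 (Num.sqrt v1) ((r + v1 * z) / (v1 + v2)) *
  normal_pdf 0 (Num.sqrt v2) (z - (r + v1 * z) / (v1 + v2))) =
  normal_pdf 0 (Num.sqrt (v1 + v2)) z *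
  normal_pdf 0 (Num.sqrt (v1 * v2 * (v1 + v2))) r.
Proof.
move=> v10 v20.
have v120 : 0 < v1 + v2 by exact: addr_gt0.
have v1v20 : 0 < v1 * v2 by exact: mulr_gt0.
have vv0 : 0 < v1 * v2 * (v1 + v2) by exact: mulr_gt0.
rewrite !normal_pdfV//.
have pi0 : 0 < 2 * pi :> R by rewrite mulr_gt0// pi_gt0.
have E a b c d : a * expR b * (c * expR d) = (a * c) * expR (b + d) :> R.
  by rewrite expRD; ring.
rewrite !E [LHS]mulrA; congr (_ * expR _); last first.
  by field; rewrite !gt_eqF.
rewrite !(sqrtrM _ (ltW pi0)) (sqrtrM _ (ltW v1v20)) (sqrtrM _ (ltW v10)).
rewrite -[X in X^-1 * _]sqr_sqrtr ?(ltW v120)//.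
by field; rewrite !gt_eqF// ?sqrtr_gt0.
Qed.

Lemma normal_rotation (v1 v2 : R) (C F : set R) : 0 < v1 -> 0 < v2 ->
  measurable C -> measurable F ->
  (\int[normal_prob 0 (Num.sqrt v1)]_x \int[normal_prob 0 (Num.sqrt v2)]_y
     (\1_C (x + y) * \1_F (v2 * x - v1 * y))%:E =
   normal_prob 0 (Num.sqrt (v1 + v2)) C *
   normal_prob 0 (Num.sqrt (v1 * v2 * (v1 + v2))) F)%E.
Proof.
move=> v10 v20 mC mF.
have v120 : 0 < v1 + v2 by exact: addr_gt0.
pose n1 := normal_pdf (0 : R) (Num.sqrt v1).
pose n2 := normal_pdf (0 : R) (Num.sqrt v2).
have mn1 : measurable_fun setT n1 by exact: measurable_normal_pdf.
have mn2 : measurable_fun setT n2 by exact: measurable_normal_pdf.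
have mlin : measurable_fun setT (fun p : R * R => (v1 + v2) * p.1 + (- v1) * p.2).
  by apply: measurable_funD; apply: measurable_funM.
pose h (p : R * R) : R :=
  \1_C p.2 * \1_F ((v1 + v2) * p.1 + (- v1) * p.2) * (n2 (p.2 - p.1) * n1 p.1).
have mh : measurable_fun setT (fun p => (h p)%:E).
  apply/measurable_EFinP.
  apply: measurable_funM; apply: measurable_funM.
  - by apply: measurableT_comp => //; exact: measurable_indic.
  - have mI : measurable_fun setT (\1_F : R -> R) by exact: measurable_indic.
    exact: (measurableT_comp mI mlin).
  - by apply: (measurableT_comp mn2); exact: measurable_funB.
  - exact: (measurableT_comp mn1).
have h0 p : 0 <= h p by rewrite !mulr_ge0// normal_pdf_ge0.
have hE0 p : (0 <= (h p)%:E)%E by rewrite lee_fin.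
have mhx x : measurable_fun setT (fun z => (h (x, z))%:E).
  by have := measurableT_comp mh (pair1_measurable x); exact.
have mhz z : measurable_fun setT (fun x => (h (x, z))%:E).
  by have := measurableT_comp mh (pair2_measurable z); exact.
pose q (p : R * R) : R := \1_C (p.1 + p.2) * \1_F (v2 * p.1 - v1 * p.2).
have mq : measurable_fun setT (fun p => (q p)%:E).
  apply/measurable_EFinP; apply: measurable_funM.
  - have mI : measurable_fun setT (\1_C : R -> R) by exact: measurable_indic.
    by apply: (measurableT_comp mI); exact: measurable_funD.
  - have mI : measurable_fun setT (\1_F : R -> R) by exact: measurable_indic.
    apply: (measurableT_comp mI).
    by apply: measurable_funB; apply: measurable_funM.
have q0 p : 0 <= q p by rewrite mulr_ge0.
have qE0 p : (0 <= (q p)%:E)%E by rewrite lee_fin.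
have mqx x : measurable_fun setT (fun z => (q (x, z))%:E).
  by have := measurableT_comp mq (pair1_measurable x); exact.
(* The shear [z = x + y] in the inner integral lets Tonelli make [z] the outer variable. *)
transitivity (\int[mu]_x \int[mu]_z (h (x, z))%:E)%E.
  have mI : measurable_fun setT (fun x => \int[normal_prob 0 (Num.sqrt v2)]_y (q (x, y))%:E)%E :=
    measurable_fun_fubini_tonelli_F (m2 := normal_prob 0 (Num.sqrt v2)) (fun p => (q p)%:E) mq qE0.
  rewrite (ge0_integral_normal_prob 0 (Num.sqrt v1) mI); last first.
    by move=> x; apply: integral_ge0.
  - apply: eq_integral => x _.
    have -> := ge0_integral_normal_prob 0 (Num.sqrt v2) (mqx x) (fun z => qE0 (x, z)).
    have := ge0_integral_affine x (oner_neq0 R) (mhx x) (fun z => hE0 (x, z)).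
    rewrite normr1 invr1 mul1e => <-.
    rewrite -ge0_integralZr//=; last 3 first.
    + apply: emeasurable_funM; first exact: mqx.
      by apply/measurable_EFinP; exact: measurable_normal_pdf.
    + by move=> z _; rewrite mule_ge0// lee_fin normal_pdf_ge0.
    + by rewrite lee_fin normal_pdf_ge0.
    apply: eq_integral => y _; rewrite -!EFinM /q /h /=; congr (_%:E).
    rewrite -/n1 -/n2 -mulrA mul1r addrK [y + x]addrC.
    by rewrite (_ : v2 * x - v1 * y = (v1 + v2) * x + - v1 * (x + y))//; ring.
transitivity (\int[mu]_z \int[mu]_x (h (x, z))%:E)%E.
  exact: (fubini_tonelli (m1 := mu) (m2 := mu) (fun p => (h p)%:E) mh hE0).
rewrite (normal_prob_indic _ _ mC) (normal_prob_indic _ _ mF).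
set IF := (X in (_ * X)%E).
have IF0 : (0 <= IF)%E.
  by apply: integral_ge0 => x _; rewrite mule_ge0// lee_fin// normal_pdf_ge0.
rewrite -ge0_integralZr//=; last 2 first.
- apply: emeasurable_funM; apply/measurable_EFinP.
    exact: measurable_indic.
  exact: measurable_normal_pdf.
- by move=> x _; rewrite mule_ge0// lee_fin// normal_pdf_ge0.
apply: eq_integral => z _.
(* For fixed [z], pass from [x] to [r], that is [x = (r + v1 * z) / (v1 + v2)]. *)
have cn0 : (v1 + v2)^-1 != 0 by rewrite invr_eq0 gt_eqF.
have := ge0_integral_affine (v1 * z / (v1 + v2)) cn0 (mhz z) (fun x => hE0 (x, z)).
rewrite gtr0_norm ?invr_gt0// invrK => hE.
have -> : (\int[mu]_x (h (x, z))%:E = (v1 + v2)^-1%:E * \int[mu]_x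
    (h ((v1 + v2)^-1 * x + v1 * z / (v1 + v2), z)%R)%:E)%E.
  by rewrite hE muleA -EFinM mulVf ?mul1e// gt_eqF.
rewrite -!ge0_integralZl//=; last 5 first.
- apply: emeasurable_funM; apply/measurable_EFinP.
    exact: measurable_indic.
  exact: measurable_normal_pdf.
- by move=> x _; rewrite mule_ge0// lee_fin// normal_pdf_ge0.
- by rewrite mule_ge0// lee_fin// normal_pdf_ge0.
- have ma : measurable_fun setT (fun x : R => (v1 + v2)^-1 * x + v1 * z / (v1 + v2)).
    by apply: measurable_funD => //; exact: measurable_funM.
  exact: (measurableT_comp (mhz z) ma).
- by rewrite lee_fin invr_ge0 ltW.
apply: eq_integral => r _; rewrite -!EFinM; congr (_%:E).
rewrite /h/=.
rewrite (_ : (v1 + v2) * ((v1 + v2)^-1 * r + v1 * z / (v1 + v2)) + - v1 * z = r); last first.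
  by field; rewrite gt_eqF.
rewrite (_ : (v1 + v2)^-1 * r + v1 * z / (v1 + v2) = (r + v1 * z) / (v1 + v2)); last by ring.
rewrite [RHS]mulrACA -(normal_pdf_rotation r z v10 v20) /n1 /n2; ring.
Qed.

End gauss.

(** * Independence criteria *)

Section independence.
Context d (T : measurableType d) (R : realType) (P : probability T R).

(** As functions of [A] both sides are finite measures, so agreement on a generating pi-system
    suffices. *)
Lemma indep_g_sigma_algebra (G : set (set T)) (E : set T) :
  measurable E -> G `<=` measurable -> setI_closed G -> G setT ->
  (forall A, G A -> P (A `&` E) = P A * P E)%E ->
  forall A, <<s G >> A -> (P (A `&` E) = P A * P E)%E.
Proof.
move=> mE mG GI GT GE A GA.
have PE0 : 0 <= fine (P E) by rewrite fine_ge0.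
have PEE : P E = (fine (P E))%:E by rewrite fineK// fin_num_measure.
pose m1 : {measure set T -> \bar R} := mrestr P mE.
pose m2 : {measure set T -> \bar R} := mscale (NngNum PE0) P.
have m2E B : m2 B = (P B * P E)%E by rewrite muleC PEE.
rewrite -m2E; change (m1 A = m2 A).
apply: (@g_sigma_algebra_measure_unique _ _ _ G mG (fun=> setT)) => //.
- by rewrite bigcup_const.
- by move=> B GB; rewrite m2E -GE.
- by move=> _; rewrite /m1 /mrestr/= (le_lt_trans (probability_le1 _ _)) ?ltry//; exact: measurableI.
Qed.

(** The event [G] is carried along by restricting [P] to it: under the restriction [(X, Y)] has
    [P G] times a product Gaussian law, and the rotation acts on that law alone. *)
Lemma gauss_rotation_indep (X Y : T -> R) (G : set T) (v1 v2 : R) :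
  measurable_fun setT X -> measurable_fun setT Y -> measurable G ->
  0 < v1 -> 0 < v2 ->
  (forall A B, measurable A -> measurable B ->
    P (G `&` (X @^-1` A `&` Y @^-1` B)) =
    P G * (normal_prob 0 (Num.sqrt v1) A * normal_prob 0 (Num.sqrt v2) B))%E ->
  forall C F, measurable C -> measurable F ->
    (P (G `&` ((fun w => X w + Y w)%R @^-1` C `&`
      (fun w => v2 * X w - v1 * Y w)%R @^-1` F)) =
    P G * (normal_prob 0 (Num.sqrt (v1 + v2)) C *
           normal_prob 0 (Num.sqrt (v1 * v2 * (v1 + v2))) F))%E.
Proof.
move=> mX mY mG v10 v20 GXY C F mC mF.
have PG0 : 0 <= fine (P G) by rewrite fine_ge0.
have PGE : P G = (fine (P G))%:E by rewrite fineK// fin_num_measure.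
pose n1 := normal_prob (0 : R) (Num.sqrt v1).
pose n2 := normal_prob (0 : R) (Num.sqrt v2).
pose RR : measurableType _ := (measurableTypeR R * measurableTypeR R)%type.
have mXY : measurable_fun setT (fun w => (X w, Y w) : RR) by exact: measurable_fun_pair.
pose m1 : {measure set RR -> \bar R} := pushm (mrestr P mG) mXY.
pose m2 : {measure set RR -> \bar R} := mscale (NngNum PG0) (n1 \x n2)%E.
have m1E B : m1 B = P ((fun w => (X w, Y w)) @^-1` B `&` G) by [].
have m2E B : m2 B = (P G * (n1 \x n2) B)%E by rewrite PGE.
have m12 B : measurable B -> m1 B = m2 B.
  apply: (measure_unique [set B1 `*` B2 | B1 in measurable & B2 in measurable] (fun=> setT)).
  - exact: measurable_prod_measurableType.
  - move=> _ _ [A1 mA1 [B1 mB1 <-]] [A2 mA2 [B2 mB2 <-]].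
    rewrite -setXI; exists (A1 `&` A2); first exact: measurableI.
    by exists (B1 `&` B2); first exact: measurableI.
  - by move=> _; exists setT => //; exists setT => //; rewrite setXTT.
  - by rewrite bigcup_const.
  - move=> _ [A1 mA1 [B1 mB1 <-]]; rewrite m1E m2E product_measure1E// -GXY// setIC.
    by congr (P (_ `&` _)).
  - move=> _; rewrite m1E (le_lt_trans (probability_le1 _ _)) ?ltry//.
    by rewrite preimage_setT setTI.
pose S : set RR :=
  (fun p => p.1 + p.2)%R @^-1` C `&` (fun p => v2 * p.1 - v1 * p.2)%R @^-1` F.
have mS : measurable S.
  apply: measurableI; rewrite -[X in measurable X]setTI.
    by apply: measurable_funD.
  by apply: measurable_funB => //; apply: measurable_funM.
have := m12 _ mS; rewrite m1E m2E setIC => ->; congr (_ * _)%E.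
rewrite -(normal_rotation v10 v20 mC mF).
have -> : ((n1 \x n2) S = \int[(n1 \x n2)]_p (\1_S p)%:E)%E.
  by rewrite (integral_indic _ measurableT mS) setIT.
have mI : measurable_fun setT (fun p => (\1_S p)%:E : \bar R).
  exact/measurable_EFinP/measurable_indic.
have fI (p : RR) : (0 <= (\1_S p)%:E :> \bar R)%E by rewrite lee_fin.
rewrite (fubini_tonelli1 _ mI fI).
apply: eq_integral => x _; apply: eq_integral => y _; congr (_%:E).
by rewrite /S indicI.
Qed.

End independence.

(** * Independence from the past of the bridge *)

Section bridge_markov.
Context d (O : measurableType d) (R : realType) (P : probability O R).
Variables (D T : R) (W : R -> {RV P >-> R}).
Hypotheses (D0 : 0 < D) (bmW : brownian_motion D W).

(** Subtracting [W 0], which vanishes only almost surely, makes every path start at 0 and expresses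
    the process through increments alone. *)
Definition bridge_of (u : R) (w : O) : R :=
  W u w - W 0 w - u / T * (W T w - W 0 w).

Variables (k : nat) (s : nat -> R) (t : R).
Hypotheses (s0 : s 0%N = 0) (smono : forall i, (i < k)%N -> s i <= s i.+1)
  (skt : s k < t) (tT : t < T).

(* A pi-system for the increments up to time [s k] together with the increment
   [W T - W (s k)], which determine the bridge up to time [s k]. *)
Definition past_system : set (set O) :=
  [set X | exists E : nat -> set R, (forall i, measurable (E i)) /\
     exists C, measurable C /\
     X = (\bigcap_(i < k) (fun w => W (s i.+1) w - W (s i) w) @^-1` E i) `&`
         (fun w => (W t w - W (s k) w) + (W T w - W t w)) @^-1` C].

Let v1 := D * (t - s k).
Let v2 := D * (T - t).

Let mincr (a b : R) : measurable_fun setT (fun w => W a w - W b w).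
Proof. exact: measurable_funB. Qed.

Let mpre (a b : R) (E : set R) : measurable E ->
  measurable ((fun w => W a w - W b w) @^-1` E).
Proof. by move=> mE; rewrite -[X in measurable X]setTI; exact: mincr. Qed.

Let mpast (E : nat -> set R) : (forall i, measurable (E i)) ->
  measurable (\bigcap_(i < k) (fun w => W (s i.+1) w - W (s i) w) @^-1` E i).
Proof. by move=> mE; apply: bigcap_measurableType => i _; exact: mpre. Qed.

Let skge0 i : (i <= k)%N -> 0 <= s i.
Proof.
elim: i => [_|i IH ik]; first by rewrite s0.
by rewrite (le_trans (IH (ltnW ik)))// smono.
Qed.

Let past_joint (E : nat -> set R) (A B : set R) : (forall i, measurable (E i)) ->
  measurable A -> measurable B ->
  let G := \bigcap_(i < k) (fun w => W (s i.+1) w - W (s i) w) @^-1` E i in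
  (P (G `&` ((fun w => W t w - W (s k) w)%R @^-1` A `&`
             (fun w => W T w - W t w)%R @^-1` B)) =
  P G * (normal_prob 0 (Num.sqrt v1) A * normal_prob 0 (Num.sqrt v2) B))%E.
Proof.
move=> mE mA mB G.
case: bmW => _ lawW indW _.
(* Independence of increments is stated for infinite nondecreasing sequences of times: the grid up
   to [s k] is continued by [t] and then by [T] forever. *)
pose tau i := if (i <= k)%N then s i else if i == k.+1 then t else T.
have tau0 : 0 <= tau 0%N by rewrite /tau leq0n s0.
have taumono i : tau i <= tau i.+1.
  rewrite /tau; case: (ltngtP i k) => [ik|ki|->].
  - by rewrite smono.
  - rewrite eqSS (gtn_eqF ki).
    by case: ifPn => // _; exact: ltW.
  - by rewrite eqxx ltW.
pose Ev i : set O := (fun w => W (tau i.+1) w - W (tau i) w) @^-1`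
   (if (i < k)%N then E i else if i == k then A else B).
have EvP n : P (\bigcap_(i < n) Ev i) = (\prod_(i < n) P (Ev i))%E.
  apply: (indW tau tau0 taumono) => i _ /=.
  exists (if (i < k)%N then E i else if i == k then A else B); last by rewrite setTI.
  by case: ifP => // _; case: ifP.
have Evk : Ev k = (fun w => W t w - W (s k) w) @^-1` A.
  by rewrite /Ev /tau ltnn !eqxx leqnn.
have EvSk : Ev k.+1 = (fun w => W T w - W t w) @^-1` B.
  have e1 : (k.+1 < k)%N = false by rewrite ltnNge leqnSn.
  have e2 : (k.+1 == k) = false by rewrite gtn_eqF.
  by rewrite /Ev /tau e1 e2 eqSS e2 ltnn eqxx.
have EvG : \bigcap_(i < k) Ev i = G.
  apply: eq_bigcapr => i /= ik; rewrite /Ev /tau ik.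
  by rewrite (ltnW ik).
have -> : G `&` ((fun w => W t w - W (s k) w) @^-1` A `&`
             (fun w => W T w - W t w) @^-1` B) = \bigcap_(i < k.+2) Ev i.
  by rewrite -Evk -EvSk -EvG !bigcap_mkord !big_ord_recr/= setIA.
rewrite EvP !big_ord_recr/= -EvP EvG Evk EvSk -muleA; congr (_ * (_ * _))%E.
- by rewrite lawW//; exact: skge0.
- by rewrite lawW// (le_trans (skge0 (leqnn k)))// ltW.
Qed.

Let v10 : 0 < v1. Proof. by rewrite mulr_gt0// subr_gt0. Qed.
Let v20 : 0 < v2. Proof. by rewrite mulr_gt0// subr_gt0. Qed.

Let past_sub : past_system `<=` measurable.
Proof.
move=> _ [E [mE [C [mC ->]]]]; apply: measurableI; first exact: mpast.
rewrite -[X in measurable X]setTI.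
suff : measurable_fun setT (fun w => W t w - W (s k) w + (W T w - W t w)) by exact.
by apply: measurable_funD; exact: mincr.
Qed.

Let past_setI : setI_closed past_system.
Proof.
move=> _ _ [E [mE [C [mC ->]]]] [E' [mE' [C' [mC' ->]]]].
exists (fun i => E i `&` E' i); split; first by move=> i; exact: measurableI.
exists (C `&` C'); split; first exact: measurableI.
rewrite preimage_setI setIACA; congr (_ `&` _); rewrite -bigcapI//.
Qed.

Let past_setT : past_system setT.
Proof.
exists (fun=> setT); split => //; exists setT; split => //.
by rewrite preimage_setT setIT bigcapT.
Qed.

(** The combination is independent of the increments before [s k] and, by the rotation, of
    [W T - W (s k)] as well. These generate the past of the bridge, which looks ahead to time
    [T]. *)
Lemma past_indep (A : set O) (F : set R) : <<s past_system >> A -> measurable F ->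
  (P (A `&` (fun w => v2 * (W t w - W (s k) w) - v1 * (W T w - W t w))%R @^-1` F) =
   P A * normal_prob 0 (Num.sqrt (v1 * v2 * (v1 + v2))) F)%E.
Proof.
move=> sA mF; set E := (X in _ `&` X).
have mE : measurable E.
  rewrite -[X in measurable X]setTI.
  suff : measurable_fun setT (fun w => v2 * (W t w - W (s k) w) - v1 * (W T w - W t w)) by exact.
  by apply: measurable_funB; apply: measurable_funM => //; exact: mincr.
have rot Es C (mEs : forall i, measurable (Es i)) (mC : measurable C) F' (mF' : measurable F') :=
  @gauss_rotation_indep _ _ _ P (fun w => W t w - W (s k) w)
   (fun w => W T w - W t w) _ v1 v2 (mincr _ _) (mincr _ _)
   (mpast mEs) v10 v20 (fun A B mA mB => past_joint mEs mA mB) C F' mC mF'.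
have PE : P E = normal_prob 0 (Num.sqrt (v1 * v2 * (v1 + v2))) F.
  have := rot (fun=> setT) setT (fun=> measurableT) measurableT F mF.
  have -> : \bigcap_(i < k) (fun w => W (s i.+1) w - W (s i) w) @^-1` setT = setT :> set O.
    by apply/seteqP; split.
  rewrite preimage_setT !setTI -/E => ->.
  by rewrite !probability_setT !mul1e.
rewrite -PE; apply: (indep_g_sigma_algebra mE past_sub past_setI past_setT) => //.
move=> _ [Es [mEs [C [mC ->]]]]; rewrite -setIA rot// PE.
have := rot Es C mEs mC setT measurableT.
by rewrite preimage_setT setIT probability_setT mule1 muleA => ->.
Qed.

Lemma measurable_past_bridge i : (i <= k)%N ->
  measurable_fun (setT : set (g_sigma_algebraType past_system)) (bridge_of (s i)).
Proof.
have mD j : (j < k)%N -> measurable_fun (setT : set (g_sigma_algebraType past_system))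
    (fun w => W (s j.+1) w - W (s j) w).
  move=> jk _ B mB; rewrite setTI; apply: sub_sigma_algebra.
  exists (fun i => if i == j then B else setT); split; first by move=> l; case: ifP.
  exists setT; split => //; rewrite preimage_setT setIT.
  apply/seteqP; split=> [w /= wB l _/=|w /(_ j jk)/=]; last by rewrite eqxx.
  by case: ifPn => // /eqP ->.
have mV : measurable_fun (setT : set (g_sigma_algebraType past_system))
    (fun w => (W t w - W (s k) w) + (W T w - W t w)).
  move=> _ B mB; rewrite setTI; apply: sub_sigma_algebra.
  exists (fun=> setT); split => //; exists B; split => //.
  by apply/seteqP; split => [w ? //|w []//].
have mS j : (j <= k)%N -> measurable_fun (setT : set (g_sigma_algebraType past_system))
    (fun w => W (s j) w - W 0 w).
  elim: j => [_|j IH jk].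
    rewrite s0 (_ : (fun _ => _) = cst (0 : R))//.
    by apply/funext => w; rewrite subrr.
  have := measurable_funD (mD _ jk) (IH (ltnW jk)); congr (measurable_fun _ _).
  by apply/funext => w /=; rewrite addrA subrK.
move=> ik.
rewrite (_ : bridge_of (s i) = (fun w => (W (s i) w - W 0 w) -
   s i / T * ((W t w - W (s k) w) + (W T w - W t w) + (W (s k) w - W 0 w)))); last first.
  by apply/funext => w; rewrite /bridge_of; congr (_ - _ * _); ring.
apply: measurable_funB; first exact: mS.
by apply: measurable_funM => //; apply: measurable_funD => //; exact: mS.
Qed.

End bridge_markov.

(** * Integrating out a fresh increment *)

Section freezing.
Context d d1 d2 (O : measurableType d) (S1 : measurableType d1)
  (S2 : measurableType d2) (R : realType) (P : probability O R)
  (n : probability S2 R) (Y : O -> S1) (Z : O -> S2).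
Hypotheses (mY : measurable_fun setT Y) (mZ : measurable_fun setT Z).
Hypothesis YZ : forall A B, measurable A -> measurable B ->
  (P (Y @^-1` A `&` Z @^-1` B) = P (Y @^-1` A) * n B)%E.

(** The joint law is a product, so Tonelli applies. In the application [Y] is the identity map into
    the space equipped with the past sigma-algebra, which is why [nu] need not be named. *)
Lemma integral_independent : exists nu : probability S1 R,
  forall H : S1 * S2 -> \bar R,
  measurable_fun setT H -> (forall p, 0 <= H p)%E ->
  (\int[P]_w H (Y w, Z w) = \int[nu]_y \int[n]_z H (y, z))%E.
Proof.
pose Yp : {mfun O >-> S1} := HB.pack Y (isMeasurableFun.Build _ _ _ _ _ mY).
pose nu : probability S1 R := distribution P Yp.
have mYZ : measurable_fun setT (fun w => (Y w, Z w)) by exact: measurable_fun_pair.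
exists nu => H mH H0.
transitivity (\int[pushm P mYZ]_p H p)%E.
  by rewrite ge0_integral_pushforward.
rewrite -(fubini_tonelli1 (m1 := nu) (m2 := n) H mH H0).
apply: eq_measure_integral => A mA _; apply/esym.
by apply: product_measure_unique.
Qed.

End freezing.

(** * One-step reflection of the drifted process *)

Section reflection.
Context d (O : measurableType d) (R : realType) (P : probability O R).
Variables (D T a : R) (W : R -> {RV P >-> R}).
Hypotheses (D0 : 0 < D) (bmW : brownian_motion D W).

Local Notation BB := (bridge_of T W).

(* The time-changed bridge minus the image of the level [a]: in the clock
   [D * T * u / (T - u)] it is a Brownian motion with constant drift, and it
   exceeds [a] exactly when the bridge does. *)
Definition drifted (u : R) (w : O) : R := a + T * (BB u w - a) / (T - u).

(** The increment of u / (T - u) from [s] to [t]. Multiplied by [D * T] it is the variance of the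
    increment of [drifted], multiplied by [- a] its mean. *)
Definition clock (s t : R) : R := T * (t - s) / ((T - t) * (T - s)).

Lemma measurable_bridge_of u : measurable_fun setT (BB u).
Proof.
apply: measurable_funB; first exact: measurable_funB.
by apply: measurable_funM => //; exact: measurable_funB.
Qed.

Lemma measurable_drifted u : measurable_fun setT (drifted u).
Proof.
apply: measurable_funD => //; apply: measurable_funM => //.
by apply: measurable_funM => //; apply: measurable_funB => //; exact: measurable_bridge_of.
Qed.

Lemma drifted_gt (u : R) w : 0 < T -> u < T -> (a < drifted u w) = (a < BB u w).
Proof.
move=> T0 uT; rewrite /drifted ltrDl pmulr_lgt0 ?invr_gt0 ?subr_gt0//.
by rewrite pmulr_rgt0// subr_gt0.
Qed.

Variables (k : nat) (s : nat -> R) (t : R).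
Hypotheses (s0 : s 0%N = 0) (smono : forall i, (i < k)%N -> s i <= s i.+1)
  (skt : s k < t) (tT : t < T).

Let sk0 : 0 <= s k.
Proof.
have : (k <= k)%N by []; elim: {1 3}k => [_|i IH ik]; first by rewrite s0.
by rewrite (le_trans (IH (ltnW ik)))// smono.
Qed.

Let T0 : 0 < T. Proof. exact: le_lt_trans sk0 (lt_trans skt tT). Qed.

Local Notation past := (past_system T W k s t).
Local Notation kap := (clock (s k) t).

Lemma clock_gt0 : 0 < kap.
Proof.
by rewrite divr_gt0// mulr_gt0// subr_gt0// (lt_trans skt).
Qed.

Lemma drifted_indep (A : set O) (F : set R) : <<s past >> A -> measurable F ->
  (P (A `&` (fun w => drifted t w - drifted (s k) w)%R @^-1` F) =
   P A * normal_prob (- a * kap) (Num.sqrt (D * T * kap)) F)%E.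
Proof.
move=> sA mF.
have sT := lt_trans skt tT.
have TtN : T - t != 0 by rewrite gt_eqF// subr_gt0.
have TsN : T - s k != 0 by rewrite gt_eqF// subr_gt0.
have DN : D != 0 by rewrite gt_eqF.
have TN : T != 0 by rewrite gt_eqF.
(* The slope that turns the combination of [past_indep] into the random part of the increment of
   [drifted]; the terms - T a / (T - u) contribute the drift [- a * kap]. *)
pose c := T / ((T - s k) * (T - t) * D).
have c0 : c != 0.
  by rewrite /c !(mulf_neq0, invr_neq0)// lt0r_neq0.
pose v := D * (t - s k) * (D * (T - t)) * (D * (t - s k) + D * (T - t)).
have v0 : 0 < v.
  by rewrite /v; do 3?[apply: mulr_gt0 | apply: addr_gt0]; rewrite ?subr_gt0 ?mulr_gt0 ?subr_gt0.
have mF' : measurable ((fun x => c * x + (- a * kap)) @^-1` F).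
  rewrite -[X in measurable X]setTI.
  suff : measurable_fun setT (fun x => c * x + (- a * kap)) by exact.
  by apply: measurable_funD => //; exact: measurable_funM.
have := past_indep D0 bmW s0 smono skt tT sA mF'.
rewrite (normal_prob_affine _ _ c0 v0 mF) mulr0 add0r.
have -> : c ^+ 2 * v = D * T * kap.
  by rewrite /c /v /clock; field; rewrite DN TsN TtN.
move=> <-; congr (P (_ `&` _)); apply/seteqP; split => w /=;
  rewrite (_ : c * _ + _ = drifted t w - drifted (s k) w)//;
  rewrite /c /drifted /bridge_of /clock; by field; rewrite ?DN ?TsN ?TtN ?TN.
Qed.

Lemma measurable_past_drifted i : (i <= k)%N ->
  measurable_fun (setT : set (g_sigma_algebraType past)) (drifted (s i)).
Proof.
move=> ik; apply: measurable_funD => //; apply: measurable_funM => //.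
apply: measurable_funM => //; apply: measurable_funB => //.
exact: measurable_past_bridge.
Qed.

(** Flipping the sign of the increment replaces the endpoint by [2 * drifted (s k) w - drifted t w].
    The factor [kap] cancels in the ratio of mean and variance, so the exponent [2 * a / (D * T)]
    does not depend on the step. *)
Lemma reflection_step (A : set O) : <<s past >> A ->
  (P (A `&` [set w | drifted t w <= a]%R) =
   \int[P]_w (\1_A w * \1_[set w | 2 * drifted (s k) w - drifted t w <= a] w *
     expR (2 * a / (D * T) * (drifted t w - drifted (s k) w)))%:E)%E.
Proof.
move=> sA; set lam := 2 * a / (D * T).
(* [O] with the past as its sigma-algebra: [A] and [drifted (s k)] are measurable there and can be
   frozen while the increment is integrated. *)
pose S1 := g_sigma_algebraType past.
pose Z w : R := drifted t w - drifted (s k) w.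
pose m := - a * kap; pose v := D * T * kap.
have v0 : 0 < v by rewrite mulr_gt0 ?clock_gt0// mulr_gt0.
have mZ : measurable_fun setT Z by apply: measurable_funB; exact: measurable_drifted.
have past_sub : past `<=` measurable.
  move=> _ [E [mE [C [mC ->]]]]; apply: measurableI.
    apply: bigcap_measurableType => i _; rewrite -[X in measurable X]setTI.
    suff : measurable_fun setT (fun w => W (s i.+1) w - W (s i) w) by exact.
    exact: measurable_funB.
  rewrite -[X in measurable X]setTI.
  suff : measurable_fun setT (fun w => W t w - W (s k) w + (W T w - W t w)) by exact.
  by apply: measurable_funD; exact: measurable_funB.
have spast_sub B : <<s past >> B -> measurable B.
  by apply: smallest_sub => //; exact: sigma_algebra_measurable.
have mid : measurable_fun setT (id : O -> S1).
  by move=> _ B mB; rewrite setTI; exact: spast_sub.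
have indep (B : set S1) (F : set R) : measurable B -> measurable F ->
    (P ((id : O -> S1) @^-1` B `&` Z @^-1` F) =
     P ((id : O -> S1) @^-1` B) * normal_prob m (Num.sqrt v) F)%E.
  by move=> mB mF; exact: drifted_indep.
pose X : S1 -> R := drifted (s k).
have mX : measurable_fun setT X by exact: measurable_past_drifted.
have mI1 : measurable_fun setT (fun p : S1 * R => \1_A p.1 : R).
  have mIA : measurable_fun setT (\1_A : S1 -> R) by exact: (@measurable_indic _ S1 R setT A sA).
  exact: (measurableT_comp mIA).
have mIa (f : S1 * R -> R) : measurable_fun setT f ->
    measurable_fun setT (fun p => \1_[set x | x <= a] (f p) : R).
  move=> mf.
  have mI : measurable_fun setT (\1_[set x | x <= a] : R -> R).
    by apply: measurable_indic; rewrite -set_itvNyc.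
  exact: (measurableT_comp mI mf).
have mX1 : measurable_fun setT (fun p : S1 * R => X p.1).
  exact: (measurableT_comp mX).
pose H1 (p : S1 * R) : \bar R := (\1_A p.1 * \1_[set x | x <= a] (X p.1 + p.2))%:E.
pose H2 (p : S1 * R) :=
  (\1_A p.1 * \1_[set x | x <= a] (X p.1 + - p.2) * expR (lam * p.2))%:E.
have mH1 : measurable_fun setT H1.
  apply/measurable_EFinP; apply: measurable_funM => //; apply: mIa.
  exact: measurable_funD.
have mH2 : measurable_fun setT H2.
  apply/measurable_EFinP; apply: measurable_funM; first apply: measurable_funM => //.
    apply: mIa; apply: measurable_funD => //.
    exact: measurableT_comp.
  apply: measurableT_comp => //; exact: measurable_funM.
have H10 p : (0 <= H1 p)%E by rewrite lee_fin mulr_ge0.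
have H20 p : (0 <= H2 p)%E by rewrite lee_fin !mulr_ge0// expR_ge0.
transitivity (\int[P]_w H1 (w, Z w))%E.
  rewrite -[X in P X]setIT -integral_indic//; last first.
    apply: measurableI; first exact: spast_sub.
    have := measurable_drifted t => /(_ measurableT `]-oo, a]%classic (measurable_itv _)); rewrite setTI.
    by rewrite set_itvNyc; exact.
  apply: eq_integral => w _; rewrite indicI/=; congr (_ * _)%:E.
  by rewrite /X /Z subrKC.
transitivity (\int[P]_w H2 (w, Z w))%E; last first.
  apply: eq_integral => w _; congr (_ * _ * _)%:E.
  have hE : X w + - Z w = 2 * drifted (s k) w - drifted t w by rewrite /X /Z; ring.
  by rewrite !indicE; congr (nat_of_bool _)%:R; apply/idP/idP; rewrite !inE /= hE.
have [nu nuE] := integral_independent (n := normal_prob m (Num.sqrt v)) mid mZ indep.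
rewrite (nuE H1 mH1 H10) (nuE H2 mH2 H20); apply: eq_integral => w _.
have mH1w : measurable_fun setT (fun z => H1 (w, z)).
  by have := measurableT_comp mH1 (pair1_measurable w); exact.
rewrite (ge0_integral_normal_reflect m v0 mH1w)//.
apply: eq_integral => z _; rewrite /H1 /H2 /= -EFinM; congr (_ * expR _)%:E.
rewrite /m /v /lam; field.
by rewrite !lt0r_neq0//; exact: clock_gt0.
Qed.

End reflection.

(** * Continuous paths on dyadic grids *)

Section paths.
Context (R : realType).
Implicit Types (f : R -> R) (A : set R).

Lemma within_continuous_dist A f x e : {within A, continuous f} -> A x -> 0 < e ->
  exists2 r : R, 0 < r & forall y, A y -> `|y - x| < r -> `|f y - f x| < e.
Proof.
move=> /subspace_continuousP cf Ax e0.
have /cvgrPdist_lt/(_ e e0) := cf x Ax.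
rewrite near_withinE => -[r /= r0 rP]; exists r => // y Ay yx.
by rewrite distrC; apply: rP => //=; rewrite distrC.
Qed.

Definition dyadic (t : R) (m i : nat) : R := t * i%:R / (2 ^ m)%:R.

Lemma dyadic0 t m : dyadic t m 0 = 0.
Proof. by rewrite /dyadic mulr0 mul0r. Qed.

Lemma dyadic_last t m : dyadic t m (2 ^ m) = t.
Proof. by rewrite /dyadic mulfK// pnatr_eq0 expn_eq0. Qed.

Lemma dyadicS t m i : dyadic t m.+1 (2 * i) = dyadic t m i.
Proof.
rewrite /dyadic expnS !natrM; field.
by rewrite pnatr_eq0 expn_eq0.
Qed.

Lemma dyadic_lt t m i j : 0 < t -> (dyadic t m i < dyadic t m j) = (i < j)%N.
Proof.
move=> t0; rewrite /dyadic ltr_pM2r; last by rewrite invr_gt0 ltr0n expn_gt0.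
by rewrite ltr_pM2l// ltr_nat.
Qed.

Lemma dyadic_le t m i j : 0 < t -> (dyadic t m i <= dyadic t m j) = (i <= j)%N.
Proof. by move=> t0; rewrite leNgt dyadic_lt// -leqNgt. Qed.

Lemma dyadic_itv t m i : 0 < t -> (i <= 2 ^ m)%N -> dyadic t m i \in `[0, t].
Proof.
move=> t0 im; rewrite in_itv/= -[X in X <= _](dyadic0 t m).
by rewrite -[X in _ && (_ <= X)](dyadic_last t m) !dyadic_le// im.
Qed.

Lemma dyadic_near t u e : 0 < t -> u \in `[0, t] -> 0 < e ->
  \forall m \near \oo, exists2 i, (i <= 2 ^ m)%N & `|dyadic t m i - u| < e.
Proof.
move=> t0; rewrite in_itv/= => /andP[u0 ut] e0.
have : (fun m => t * (2^-1) ^+ m) @ \oo --> t * (0 : R).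
  apply: cvgM; first exact: cvg_cst.
  by apply: cvg_expr; rewrite ger0_norm ?invr_ge0// invf_lt1// ltr1n.
rewrite mulr0 => /cvgrPdist_lt/(_ e e0); apply: filterS => m.
rewrite sub0r normrN ger0_norm; last by rewrite mulr_ge0 ?exprn_ge0 ?invr_ge0 ?ltW.
rewrite exprVn -natrX => me.
have pm : 0 < (2 ^ m)%:R :> R by rewrite ltr0n expn_gt0.
have x0 : 0 <= u * (2 ^ m)%:R / t by rewrite !mulr_ge0// invr_ge0 ltW.
have /andP[h1 h2] := truncn_itv x0.
exists (Num.truncn (u * (2 ^ m)%:R / t)).
  rewrite -(ler_nat R) (le_trans h1)// ler_pdivrMr// mulrC ler_pM2l//.
set i := Num.truncn _ in h1 h2 *.
have h3 : dyadic t m i <= u.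
  rewrite /dyadic ler_pdivrMr//.
  by move: h1; rewrite ler_pdivlMr// mulrC.
have h4 : u < dyadic t m i + t / (2 ^ m)%:R.
  rewrite /dyadic -mulrDl ltr_pdivlMr//.
  move: h2; rewrite ltr_pdivrMr// -natr1 mulrDl mul1r.
  by rewrite [t * _]mulrC.
rewrite ler0_norm ?subr_le0// opprB; lra.
Qed.

Lemma dyadic_exceed t f c u e : 0 < t -> {within `[0, t], continuous f} ->
  u \in `[0, t] -> c < f u -> 0 < e ->
  \forall m \near \oo, exists2 i, (i <= 2 ^ m)%N &
    c < f (dyadic t m i) /\ `|dyadic t m i - u| < e.
Proof.
move=> t0 cf ut cu e0.
have fe0 : 0 < f u - c by rewrite subr_gt0.
have [r r0 rP] := within_continuous_dist cf ut fe0.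
have re0 : 0 < Num.min r e by rewrite lt_min r0.
have := dyadic_near t0 ut re0; apply: filterS => m [i im].
rewrite lt_min => /andP[ir ie]; exists i => //; split => //.
have := rP _ (dyadic_itv t0 im) ir; rewrite ltr_norml => /andP[+ _]; lra.
Qed.

(** The infimum [si] of the exceedance times satisfies [f si <= a] by continuity. A fine grid has an
    exceeding point shortly after [si] and none before it, so the first one overshoots [a] by less
    than [e]. *)
Lemma dyadic_first_exceed t f a e : 0 < t -> {within `[0, t], continuous f} ->
  f 0 <= a -> a < f t -> 0 < e ->
  \forall m \near \oo, exists2 k, (k <= 2 ^ m)%N &
   [/\ a < f (dyadic t m k), f (dyadic t m k) < a + e &
    forall i, (i < k)%N -> f (dyadic t m i) <= a].
Proof.
move=> t0 cf f0 ft e0.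
pose S := [set u | u \in `[0, t] /\ a < f u].
have tin : t \in `[0, t] by rewrite in_itv/= ltW//= lexx.
have Shas : has_inf S.
  split; first by exists t.
  by exists 0 => u [/=]; rewrite in_itv/= => /andP[].
pose si := inf S.
have siS u : S u -> si <= u by apply: ge_inf; case: Shas.
have si0 : 0 <= si.
  apply: lb_le_inf; first by case: Shas.
  by move=> u [/=]; rewrite in_itv/= => /andP[].
have sit : si \in `[0, t] by rewrite in_itv/= si0 siS.
(* Otherwise [si] is positive and, by continuity, [f] still exceeds [a] at the earlier time [v]. *)
have fsi : f si <= a.
  rewrite leNgt; apply/negP => asi.
  have sip : 0 < si.
    by rewrite lt_neqAle si0 andbT; apply: contraTneq asi => <-; rewrite -leNgt.
  have fa0 : 0 < f si - a by rewrite subr_gt0.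
  have [r r0 rP] := within_continuous_dist cf sit fa0.
  pose v := Num.max 0 (si - r / 2).
  have v0 : 0 <= v by rewrite le_max lexx.
  have vsi : v < si by rewrite gt_max sip/=; lra.
  have vt : v \in `[0, t].
    by move: sit; rewrite !in_itv/= v0 => /andP[_]; exact/le_trans/ltW.
  have vr : `|v - si| < r.
    rewrite ltr0_norm ?subr_lt0// opprB.
    have : si - r / 2 <= v by rewrite le_max lexx orbT.
    lra.
  have := rP v vt vr; rewrite ltr_norml => /andP[h _].
  have /siS : S v by split => //; lra.
  by rewrite leNgt vsi.
have [r r0 rP] := within_continuous_dist cf sit e0.
have [u0 [u0t au0] u0si] : exists2 u, S u & u < si + r / 2.
  have r20 : 0 < r / 2 by lra.
  by have [u Su us] := inf_adherent r20 Shas; exists u.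
have siu0 := siS _ (conj u0t au0).
have r20 : 0 < r / 2 by lra.
have := dyadic_exceed t0 cf u0t au0 r20.
apply: filterS => m [i im [ai iu0]].
have exi : exists i, a < f (dyadic t m i) by exists i.
pose k := ex_minn exi.
have [ak kmin] : a < f (dyadic t m k) /\ forall j, a < f (dyadic t m j) -> (k <= j)%N.
  by rewrite /k; case: ex_minnP.
have ki := kmin _ ai.
have km := leq_trans ki im.
exists k => //; split => //; last first.
  by move=> j jk; rewrite leNgt; apply/negP => /kmin; rewrite leqNgt jk.
have kt := dyadic_itv t0 km.
have sk := siS _ (conj kt ak).
have skr : `|dyadic t m k - si| < r.
  rewrite ger0_norm ?subr_ge0//.
  have : dyadic t m k <= dyadic t m i by rewrite dyadic_le.
  move: iu0; rewrite ltr_norml => /andP[_]; lra.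
have := rP _ kt skr; rewrite ltr_norml => /andP[_]; lra.
Qed.

End paths.

(** * Reflection at the first grid exceedance *)

Section grid.
Context d (O : measurableType d) (R : realType) (P : probability O R).
Variables (D T a t : R) (W : R -> {RV P >-> R}).
Hypotheses (D0 : 0 < D) (bmW : brownian_motion D W) (a0 : 0 < a)
  (t0 : 0 < t) (tT : t < T).

Local Notation X := (drifted T a W).
Let lam := 2 * a / (D * T).
Let T0 : 0 < T. Proof. exact: lt_trans t0 tT. Qed.
Let lam0 : 0 < lam. Proof. by rewrite divr_gt0 ?mulr_gt0. Qed.

Let F m k := [set w : O | a < X (dyadic t m k) w].
Let first m := seqDU (F m).

Let mF m k : measurable (F m k).
Proof.
have := measurable_drifted T a W (dyadic t m k).
move=> /(_ measurableT `]a, +oo[%classic (measurable_itv _)).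
by rewrite setTI set_itvoy; exact.
Qed.

Let mono m i : dyadic t m i <= dyadic t m i.+1.
Proof. by rewrite dyadic_le. Qed.

Let lt_last m k : (k < 2 ^ m)%N -> dyadic t m k < t.
Proof. by move=> km; rewrite -[X in _ < X](dyadic_last t m) dyadic_lt. Qed.

Let first_past m k : (k < 2 ^ m)%N ->
  <<s past_system T W k (dyadic t m) t >> (first m k).
Proof.
move=> km; pose S1 := g_sigma_algebraType (past_system T W k (dyadic t m) t).
have mFk i : (i <= k)%N -> measurable (F m i : set S1).
  move=> ik; have : measurable_fun (setT : set S1) (X (dyadic t m i)).
    by apply: measurable_past_drifted => //; exact: dyadic0.
  move=> /(_ measurableT `]a, +oo[%classic (measurable_itv _)).
  by rewrite setTI set_itvoy; exact.
suff : measurable (first m k : set S1) by exact.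
apply: measurableD; first exact: mFk.
by apply: bigsetU_measurable => i _; apply: mFk; exact: ltnW.
Qed.

(* [k] is the first grid index at which the drifted process exceeds [a]; the
   other event says that reflecting the step from there to [t] ends below [a]. *)
Definition overshoot_weight m (w : O) : R :=
  \sum_(k < 2 ^ m) \1_(first m k) w *
    \1_[set w | 2 * X (dyadic t m k) w - X t w <= a] w *
    expR (lam * (X t w - X (dyadic t m k) w)).

Let mweight m k : measurable_fun setT (fun w => \1_(first m k) w *
    \1_[set w | 2 * X (dyadic t m k) w - X t w <= a] w *
    expR (lam * (X t w - X (dyadic t m k) w)) : R).
Proof.
have mX u : measurable_fun setT (X u) by exact: measurable_drifted.
apply: measurable_funM; first apply: measurable_funM.
- by apply: measurable_indic; exact: seqDU_measurable.
- apply: measurable_indic.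
  have mZ : measurable_fun setT (fun w => 2 * X (dyadic t m k) w - X t w).
    by apply: measurable_funB => //; exact: measurable_funM.
  by have := mZ measurableT `]-oo, a]%classic (measurable_itv _); rewrite setTI set_itvNyc.
- by apply: measurableT_comp => //; apply: measurable_funM => //; exact: measurable_funB.
Qed.

Lemma measurable_overshoot_weight m : measurable_fun setT (overshoot_weight m).
Proof. by apply: measurable_sum => k; exact: mweight. Qed.

(** Paths that exceed [a] on the grid either end above [a] or end at most at [a]. The latter are
    partitioned by the first exceeding index, an event of the past of that index, and each piece is
    reflected. *)
Lemma grid_exceed_prob m :
  (P (\bigcup_(k < (2 ^ m).+1) F m k) =
   P [set w | a < X t w]%R + \int[P]_w (overshoot_weight m w)%:E)%E.
Proof.
rewrite bigcup_mkord; set U := \big[_/_]_(_ < _) _.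
have mfirst k : measurable (first m k) by exact: seqDU_measurable.
pose Q := [set w | X t w <= a].
have mX u : measurable_fun setT (X u) by exact: measurable_drifted.
have mQ : measurable Q.
  by have := mX t measurableT `]-oo, a]%classic (measurable_itv _); rewrite setTI set_itvNyc.
have mU : measurable U by exact: bigsetU_measurable.
have -> : [set w | a < X t w] = U `\` Q.
  apply/seteqP; split => w /=.
    move=> aw; split; last by apply/negP; rewrite -ltNge.
    by rewrite /U big_ord_recr/=; right; rewrite /F/= dyadic_last.
  by move=> [_ /negP]; rewrite -ltNge.
rewrite (measureDI P mU mQ); congr (_ + _)%E.
have -> : U `&` Q = \big[setU/set0]_(k < 2 ^ m) (first m k `&` Q).
  rewrite -big_distrl/= -bigsetU_seqDU /U big_ord_recr/= setIUl.
  (* The last index drops out: that grid point is [t] itself, where [Q] forbids an exceedance. *)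
  rewrite [X in _ `|` X](_ : _ = set0) ?setU0//.
  apply/seteqP; split => w //= [/=]; rewrite /F/= dyadic_last => h1.
  by rewrite /Q/= leNgt h1.
rewrite (measure_semi_additive_ord_I P (F := fun k => first m k `&` Q)); last 3 first.
- by move=> k _; exact: measurableI.
- apply: trivIset_setIr; apply: sub_trivIset (trivIset_seqDU _); exact: subsetT.
- by apply: bigsetU_measurable => k _; exact: measurableI.
under [RHS]eq_integral do rewrite -sumEFin.
rewrite ge0_integral_sum; [|by []| |]; last 2 first.
- by move=> k; apply/measurable_EFinP; exact: mweight.
- by move=> k w _; rewrite lee_fin !mulr_ge0// expR_ge0.
apply: eq_bigr => k _.
exact: (reflection_step a D0 bmW (dyadic0 t m) (fun i _ => mono m i)
  (lt_last (ltn_ord k)) tT (first_past (ltn_ord k))).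
Qed.

Lemma first_exceed m k w : first m k w -> a < X (dyadic t m k) w.
Proof. by case. Qed.

Lemma overshoot_weight_first m k w : (k < 2 ^ m)%N -> first m k w ->
  overshoot_weight m w =
  \1_[set w | 2 * X (dyadic t m k) w - X t w <= a] w *
    expR (lam * (X t w - X (dyadic t m k) w)).
Proof.
move=> km wk; rewrite /overshoot_weight (bigD1 (Ordinal km))//=.
rewrite indicE mem_set// mul1r big1 ?addr0// => i ik.
rewrite indicE memNset ?mul0r// => wi.
have /trivIsetP/(_ i k I I) := trivIset_seqDU (F m).
move=> /(_ ik)/seteqP[/(_ w) + _]; apply; exact: conj wi wk.
Qed.

Lemma overshoot_weight_none m w : (forall k, (k < 2 ^ m)%N -> ~ first m k w) ->
  overshoot_weight m w = 0.
Proof.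
move=> wk; rewrite /overshoot_weight big1// => i _.
by rewrite indicE memNset ?mul0r//; exact: wk.
Qed.

Lemma overshoot_weight_ge0 m w : 0 <= overshoot_weight m w.
Proof.
by apply: sumr_ge0 => k _; rewrite !mulr_ge0// expR_ge0.
Qed.

(** Only the first index contributes, and the path is above [a] there. The bound does not involve
    [m], as dominated convergence requires. *)
Lemma overshoot_weight_le m w : overshoot_weight m w <= expR (lam * (X t w - a)).
Proof.
have [[k [km wk]]|none] := pselect (exists k, (k < 2 ^ m)%N /\ first m k w); last first.
  rewrite overshoot_weight_none ?expR_ge0// => k km wk; apply: none; by exists k.
rewrite (overshoot_weight_first km wk).
rewrite -[leRHS]mul1r; apply: ler_pM => //.
by rewrite ler_expR ler_pM2l// lerB// ltW// first_exceed.
Qed.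

(** If [X t w <= a], the reflected endpoint exceeds [a] and every weight is zero. If [X t w > a],
    the overshoot at the first index tends to zero, so the reflected endpoint is eventually below
    [a] and the exponent converges. *)
Lemma cvg_overshoot_weight w : {within `[0, t], continuous (fun u => X u w)} ->
  X 0 w <= a ->
  overshoot_weight m w @[m --> \oo] -->
    \1_[set w | a < X t w] w * expR (lam * (X t w - a)).
Proof.
move=> cX X0; have [Xta|aXt] := leP (X t w) a.
  rewrite indicE memNset/=; last by rewrite ltNge Xta.
  rewrite mul0r (_ : (fun m => _) = cst 0); first exact: cvg_cst.
  apply/funext => m /=.
  have [[k [km wk]]|none] := pselect (exists k, (k < 2 ^ m)%N /\ first m k w); last first.
    by rewrite overshoot_weight_none// => k km wk; apply: none; exists k.
  rewrite (overshoot_weight_first km wk) indicE memNset ?mul0r//=.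
  have := first_exceed wk; move=> h1 h2; lra.
rewrite indicE mem_set// mul1r.
apply/cvgrPdist_lt => e e0.
have cexp : {for X t w - a, continuous (fun x => expR (lam * x))}.
  apply: (@continuous_comp _ _ _ (fun x => lam * x) expR); last exact: continuous_expR.
  by apply: cvgM; [exact: cvg_cst|exact: cvg_id].
have /cvgrPdist_lt/(_ e e0) := cexp; rewrite -nbhs_nearE => -[r /= r0 rP].
(* [r] serves the continuity of the exponential. Half the gap forces the reflected endpoint below
   [a] and keeps the first index away from the last one. *)
pose e' := Num.min r ((X t w - a) / 2).
have e'0 : 0 < e' by rewrite lt_min r0 divr_gt0// subr_gt0.
have := dyadic_first_exceed t0 cX X0 aXt e'0; apply: filterS => m [k km [ak ka kfirst]].
have kae : X (dyadic t m k) w < a + r /\ X (dyadic t m k) w < a + (X t w - a) / 2.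
  by split; apply: (lt_le_trans ka); rewrite lerD2l /e' ge_min lexx ?orbT.
case: kae => kar kat.
have km' : (k < 2 ^ m)%N.
  rewrite ltn_neqAle km andbT; apply/eqP => kE; move: kat; rewrite kE dyadic_last => h.
  lra.
have wk : first m k w.
  split => //; rewrite -bigcup_mkord => -[i /= ik]; rewrite /F/= => h.
  by have := kfirst i ik; rewrite leNgt h.
rewrite (overshoot_weight_first km' wk) indicE mem_set/= ?mul1r; last by lra.
apply: rP => /=; rewrite -(_ : X (dyadic t m k) w - a = X t w - a - (X t w - X (dyadic t m k) w)); last by ring.
rewrite ger0_norm; lra.
Qed.

End grid.

(* The probability that the bridge exceeds [a] before time [t]: the first term is
   the probability that [drifted] exceeds [a] at [t], the second one comes from
   the reflected paths. *)
Definition crossing (R : realType) (D T a t : R) : \bar R :=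
  let kap := clock T 0 t in
  (normal_prob (- a * kap) (Num.sqrt (D * T * kap)) `]a, +oo[ +
   (expR (- (2 * a ^+ 2 / (D * T))))%:E *
   normal_prob (a * kap) (Num.sqrt (D * T * kap)) `]a, +oo[)%E.

Lemma integral_normal_expR (R : realType) (m v l : R) (A : set R) : 0 < v ->
  measurable A ->
  (\int[normal_prob m (Num.sqrt v)]_x (\1_A x * expR (l * x))%:E =
   (expR (l * m + l ^+ 2 * v / 2))%:E *
   normal_prob (m + l * v) (Num.sqrt v) A)%E.
Proof.
move=> v0 mA.
have mI : measurable_fun setT (\1_A : R -> R) by exact: measurable_indic.
have mE : measurable_fun setT (fun x : R => (\1_A x * expR (l * x))%:E).
  apply/measurable_EFinP; apply: measurable_funM => //.
  by apply: measurableT_comp => //; exact: measurable_funM.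
rewrite (ge0_integral_normal_prob m (Num.sqrt v) mE); last first.
  by move=> x; rewrite lee_fin mulr_ge0// expR_ge0.
rewrite (normal_prob_indic (m + l * v) (Num.sqrt v) mA) -ge0_integralZl//; first last.
- by move=> x _; rewrite mule_ge0// lee_fin// normal_pdf_ge0.
- by apply: emeasurable_funM; apply/measurable_EFinP => //; exact: measurable_normal_pdf.
apply: eq_integral => x _; rewrite -!EFinM; congr (_%:E).
by rewrite -[LHS]mulrA normal_pdf_tilt// mulrCA.
Qed.

(** * Refining the grid *)

Section limit.
Context d (O : measurableType d) (R : realType) (P : probability O R).
Variables (D T a t : R) (W : R -> {RV P >-> R}).
Hypotheses (D0 : 0 < D) (bmW : brownian_motion D W) (a0 : 0 < a)
  (t0 : 0 < t) (tT : t < T).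

Local Notation X := (drifted T a W).
Let lam := 2 * a / (D * T).
Let T0 : 0 < T. Proof. exact: lt_trans t0 tT. Qed.
Let kap := clock T 0 t.
Let v := D * T * kap.
Let v0 : 0 < v.
Proof.
apply: mulr_gt0; first exact: mulr_gt0.
by rewrite /kap /clock !subr0 divr_gt0// mulr_gt0// subr_gt0.
Qed.

Lemma bridge_of0 w : bridge_of T W 0 w = 0.
Proof. by rewrite /bridge_of subrr mul0r mul0r subr0. Qed.

Lemma drifted0 w : X 0 w = 0.
Proof.
by rewrite /drifted bridge_of0; field; rewrite ?subr0 gt_eqF.
Qed.

(** The one-step law with an empty past: [drifted] vanishes at time 0, so its value at [t] is an
    increment. *)
Lemma drifted_law (F : set R) : measurable F ->
  P (X t @^-1` F) = normal_prob (- a * kap) (Num.sqrt v) F.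
Proof.
move=> mF.
have pT : <<s past_system T W 0 (fun=> 0) t >> setT.
  by have := @measurableT _ (g_sigma_algebraType (past_system T W 0 (fun=> 0) t)).
have := @drifted_indep _ _ _ P D T a W D0 bmW 0 (fun=> 0) t erefl (fun _ _ => lexx 0) t0 tT setT F pT mF.
rewrite setTI probability_setT mul1e => <-; congr (P _).
by apply/seteqP; split => w /=; rewrite drifted0 subr0.
Qed.

Lemma integral_drifted (f : R -> \bar R) : measurable_fun setT f ->
  (forall x, 0 <= f x)%E ->
  (\int[P]_w f (X t w) = \int[normal_prob (- a * kap) (Num.sqrt v)]_x f x)%E.
Proof.
move=> mf f0.
have mX : measurable_fun setT (X t : O -> measurableTypeR R).
  exact: measurable_drifted.
transitivity (\int[pushm P mX]_x f x)%E.
  by rewrite ge0_integral_pushforward.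
by apply: eq_measure_integral => A mA _; exact: drifted_law.
Qed.

Lemma drifted_continuous w : {within `[0, +oo[, continuous (fun u => W u w)} ->
  {within `[0, t], continuous (fun u => X u w)}.
Proof.
move=> cW.
have : {within `[0, t], continuous (fun u => W u w)}.
  by apply: continuous_subspaceW cW => x /=; rewrite !in_itv/= => /andP[->].
move=> /subspace_continuousP cWt; apply/subspace_continuousP => x xt.
have cid : y @[y --> within `[0, t] (nbhs x)] --> x.
  exact: cvg_within.
have cst0 (c : R) : (cst c : R -> R) @ within `[0, t] (nbhs x) --> c by exact: cvg_cst.
have nz : T - x != 0.
  have : x < T by move: xt; rewrite /= in_itv/= => /andP[_ /le_lt_trans]; apply.
  by move=> xT; rewrite subr_eq0 gt_eqF.
exact: (cvgD (cst0 a) (cvgM (cvgM (cst0 T) (cvgB (cvgB (cvgB (cWt x xt) (cst0 (W 0 w)))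
  (cvgM (cvgM cid (cst0 T^-1)) (cst0 (W T w - W 0 w)))) (cst0 a)))
  (cvgV nz (cvgB (cst0 T) cid)))).
Qed.

Lemma cvg_grid_exceed :
  P (\bigcup_(k < (2 ^ m).+1) [set w | a < bridge_of T W (dyadic t m k) w]%R)
    @[m --> \oo] --> crossing D T a t.
Proof.
have -> : (fun m => P (\bigcup_(k < (2 ^ m).+1) [set w | a < bridge_of T W (dyadic t m k) w]%R)) =
  (fun m => P [set w | a < X t w]%R + \int[P]_w (overshoot_weight D T a t W m w)%:E)%E.
  apply/funext => m; rewrite -(grid_exceed_prob a D0 bmW t0 tT).
  congr (P _); apply: eq_bigcupr => k /= km; apply/seteqP; split => w /=;
    rewrite drifted_gt// (le_lt_trans _ tT)// -[leRHS](dyadic_last t m);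
    by rewrite dyadic_le// -ltnS.
have mX u : measurable_fun setT (X u) by exact: measurable_drifted.
pose f w : R := \1_[set w | a < X t w] w * expR (lam * (X t w - a)).
have mI : measurable [set w | a < X t w].
  have := mX t measurableT `]a, +oo[%classic (measurable_itv _).
  by rewrite setTI set_itvoy; exact.
have mf : measurable_fun setT f.
  apply: measurable_funM; first exact: measurable_indic.
  apply: measurableT_comp => //; apply: measurable_funM => //.
  exact: measurable_funB.
have expE x : expR (lam * (x - a)) = expR (- (lam * a)) * expR (lam * x).
  by rewrite -expRD; congr expR; ring.
(* Tilting by [lam] moves the mean from [- a * kap] to [a * kap]. Its normalizing exponent is zero,
   since [lam * v / 2 = a * kap], and only exp(- lam a) remains. *)
have integE (A : set R) : measurable A ->
    (\int[P]_w (\1_A (X t w) * expR (lam * (X t w - a)))%:E =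
    (expR (- (2 * a ^+ 2 / (D * T))))%:E *
     normal_prob (a * kap) (Num.sqrt v) A)%E.
  move=> mA; pose h x := (\1_A x * expR (lam * (x - a)))%:E.
  have mh0 : measurable_fun setT (fun x : R => (\1_A x * expR (lam * x))%:E).
    apply/measurable_EFinP; apply: measurable_funM; first exact: measurable_indic.
    by apply: measurableT_comp => //; exact: measurable_funM.
  have hE x : h x = ((expR (- (lam * a)))%:E * (\1_A x * expR (lam * x))%:E)%E.
    by rewrite /h expE -EFinM mulrCA.
  have mh : measurable_fun setT h.
    by rewrite (_ : h = (fun x => (expR (- (lam * a)))%:E * (\1_A x * expR (lam * x))%:E)%E);
      [exact: measurable_funeM|apply/funext].
  have h0 x : (0 <= h x)%E by rewrite lee_fin mulr_ge0// expR_ge0.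
  transitivity (\int[normal_prob (- a * kap) (Num.sqrt v)]_x h x)%E.
    exact: (integral_drifted mh h0).
  under eq_integral do rewrite hE.
  rewrite ge0_integralZl//.
  rewrite integral_normal_expR// muleA -EFinM -expRD.
  congr ((expR _)%:E * normal_prob _ _ _)%E; rewrite /lam /v; field;
    by rewrite !gt_eqF.
have [_ _ _ contW] := bmW.
have lawX := drifted_law (measurable_itv `]a, +oo[).
have -> : P [set w | a < X t w] = normal_prob (- a * kap) (Num.sqrt v) `]a, +oo[.
  by rewrite -lawX set_itvoy.
have mg : measurable_fun setT (fun w => (expR (lam * (X t w - a)))%:E).
  apply/measurable_EFinP; apply: measurableT_comp => //.
  by apply: measurable_funM => //; exact: measurable_funB.
(* The dominating function has a finite mean by the same tilt, taken over the whole line. *)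
have integrable_g : P.-integrable setT (fun w => (expR (lam * (X t w - a)))%:E).
  apply/integrableP; split => //.
  under eq_integral do rewrite gee0_abs ?lee_fin ?expR_ge0//.
  rewrite (eq_integral (fun w => (\1_setT (X t w) * expR (lam * (X t w - a)))%:E)).
    by rewrite integE// probability_setT mule1 ltry.
  by move=> w _; rewrite indicE in_setT mul1r.
have mov m : measurable_fun setT (fun w => (overshoot_weight D T a t W m w)%:E).
  by apply/measurable_EFinP; exact: measurable_overshoot_weight.
have ovf : {ae P, forall w, setT w -> (overshoot_weight D T a t W m w)%:E @[m --> \oo] --> (EFin \o f) w}.
  apply: filterS contW => w cw _.
  apply: cvg_EFin; first exact: nearW.
  by apply: (cvg_overshoot_weight t0); [exact: drifted_continuous|rewrite drifted0 ltW].
have ovg : {ae P, forall w m, setT w ->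
    (`|(overshoot_weight D T a t W m w)%:E| <= (expR (lam * (X t w - a)))%:E)%E}.
  apply: aeW => w m _; rewrite gee0_abs lee_fin ?overshoot_weight_ge0//.
  exact: (overshoot_weight_le W D0 a0 t0 tT).
have mEf : measurable_fun setT (EFin \o f) by exact/measurable_EFinP.
have [_ _] := dominated_convergence measurableT mov mEf ovf integrable_g ovg.
have -> : (\int[P]_w (EFin \o f) w = (expR (- (2 * a ^+ 2 / (D * T))))%:E *
     normal_prob (a * kap) (Num.sqrt v) `]a, +oo[)%E.
  rewrite -integE; last exact: measurable_itv.
  by apply: eq_integral => w _ /=; rewrite /f set_itvoy.
move=> cv; apply: cvgeD; last exact: cv.
- by rewrite fin_num_adde_defr// fin_num_measure.
- exact: cvg_cst.
Qed.

End limit.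

(** * The standard normal tail *)

Section tail.
Context (R : realType).
Notation mu := (@lebesgue_measure R).
Implicit Types (x y z : R).

Definition gphi x : R := (Num.sqrt (2 * pi))^-1 * expR (- (x ^+ 2 / 2)).

Lemma gphiE x : gphi x = normal_pdf 0 1 x.
Proof.
have := @normal_pdfV R 0 1 x ltr01; rewrite sqrtr1 => ->.
by rewrite /gphi !mulr1 subr0.
Qed.

Lemma gphi_ge0 x : 0 <= gphi x.
Proof. by rewrite gphiE normal_pdf_ge0. Qed.

Lemma continuous_gphi : continuous gphi.
Proof.
rewrite (_ : gphi = normal_pdf 0 1); last by apply/funext => x; rewrite gphiE.
by apply: continuous_normal_pdf; exact: oner_neq0.
Qed.

Lemma measurable_gphi : measurable_fun setT gphi.
Proof. exact: continuous_measurable_fun continuous_gphi. Qed.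

Definition gtail z : R := fine (normal_prob 0 1 `]z, +oo[).

Lemma gtailE z : (gtail z)%:E = normal_prob 0 1 `]z, +oo[.
Proof. by rewrite /gtail fineK// fin_num_measure. Qed.

Let cdfF x : R := (\int[mu]_(y in `]-oo, x]) gphi y)%R.

Let integrable_gphi : mu.-integrable setT (EFin \o gphi).
Proof.
rewrite (_ : gphi = normal_pdf 0 1); last by apply/funext => x; rewrite gphiE.
exact: integrable_normal_pdf.
Qed.

Let gtail_cdf z : gtail z = 1 - cdfF z.
Proof.
apply/EFin_inj; rewrite gtailE EFinB /cdfF /Rintegral fineK; last first.
  apply: integrable_fin_num => //.
  by apply: integrableS integrable_gphi.
under eq_integral do rewrite gphiE.
by rewrite -setCitvl probability_setC.
Qed.

Lemma is_derive_gtail z : is_derive z 1 gtail (- gphi z).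
Proof.
have [dF F'] : derivable cdfF z 1 /\ derive1 cdfF z = gphi z.
  apply: (@continuous_FTC1 R gphi -oo%O z (z + 1)); first by rewrite ltrDl.
  - by apply: integrableS integrable_gphi.
  - by rewrite ltNyr.
  - exact: continuous_gphi.
have -> : gtail = (fun z => 1 - cdfF z) by apply/funext => x; exact: gtail_cdf.
apply: DeriveDef; first exact: derivableB.
by rewrite deriveB// derive_cst sub0r -derive1E F'.
Qed.

Lemma continuous_gtail : continuous gtail.
Proof.
move=> z; apply: differentiable_continuous; apply/derivable1_diffP.
by have [] := is_derive_gtail z.
Qed.

Lemma cvg_gtail_pinfty : gtail x @[x --> +oo] --> (0 : R).
Proof.
have mid : measurable_fun setT (idfun : measurableTypeR R -> R) by exact: measurable_id.
pose X : {mfun measurableTypeR R >-> R} :=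
  HB.pack (idfun : measurableTypeR R -> R) (isMeasurableFun.Build _ _ _ _ _ mid).
have /fine_cvgP[_] := cvg_ccdfy0 (P := normal_prob 0 1) X.
exact.
Qed.

Lemma gtailN z : gtail (- z) = 1 - gtail z.
Proof.
apply/EFin_inj; rewrite EFinB !gtailE.
rewrite -probability_setC// setCitvr.
have n10 : -1 != 0 :> R by rewrite oppr_eq0 oner_eq0.
have := normal_prob_affine 0 0 n10 ltr01 (measurable_itv `]- z, +oo[).
rewrite sqrtr1 mulr0 addr0 mulr1 sqrrN expr1n sqrtr1 => <-.
rewrite (_ : _ @^-1` _ = `]-oo, z[%classic); last first.
  by apply/seteqP; split => x /=; rewrite !in_itv/= andbT addr0 mulN1r ltrN2.
rewrite /normal_prob integral_itv_bndo_bndc//.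
by apply/measurable_EFinP/measurable_funTS; exact: measurable_normal_pdf.
Qed.

Lemma normal_prob_tail (m v c : R) : 0 < v ->
  normal_prob m (Num.sqrt v) `]c, +oo[ = (gtail ((c - m) / Num.sqrt v))%:E.
Proof.
move=> v0; rewrite gtailE.
have s0 : 0 < Num.sqrt v by rewrite sqrtr_gt0.
have sN : (Num.sqrt v)^-1 != 0 by rewrite invr_neq0// gt_eqF.
have := normal_prob_affine (- (m / Num.sqrt v)) m sN v0
   (measurable_itv `]((c - m) / Num.sqrt v), +oo[).
have vE : (Num.sqrt v)^-1 ^+ 2 * v = 1.
  by rewrite exprVn (sqr_sqrtr (ltW v0)) mulVf// gt_eqF.
rewrite vE sqrtr1.
rewrite (_ : (Num.sqrt v)^-1 * m + - (m / Num.sqrt v) = 0); last by ring.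
move=> <-; congr normal_prob; apply/seteqP; split => x /=;
  by rewrite !in_itv/= !andbT -mulNr [_^-1 * x]mulrC -mulrDl ltr_pM2r ?invr_gt0// ltrD2r.
Qed.

End tail.

(** * A parametrization of the time interval *)

Section parametrization.
Context (R : realType).
Notation mu := (@lebesgue_measure R).
Implicit Types (y z t T a D k : R).

Definition hyp y : R := Num.sqrt (1 + y ^+ 2).

Lemma sqr_hyp y : hyp y ^+ 2 = 1 + y ^+ 2.
Proof. by rewrite sqr_sqrtr// addr_ge0// sqr_ge0. Qed.

Lemma hyp_gt0 y : 0 < hyp y.
Proof. by rewrite sqrtr_gt0 ltr_pwDl// sqr_ge0. Qed.

Lemma norm_lt_hyp y : `|y| < hyp y.
Proof.
by rewrite -sqrtr_sqr ltr_sqrt ?ltr_pwDl ?ltrDr// sqr_ge0.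
Qed.

(* Chosen so that the clock t / (T - t) becomes the square (hyp y + y)^2. *)
Definition tpar T y : R := T / 2 * (1 + y / hyp y).

Lemma tpar_itv T y : 0 < T -> 0 < tpar T y < T.
Proof.
move=> T0; have := norm_lt_hyp y; rewrite ltr_norml => /andP[h1 h2].
have h0 := hyp_gt0 y.
have y1 : -1 < y / hyp y by rewrite ltr_pdivlMr// mulN1r.
have y2 : y / hyp y < 1 by rewrite ltr_pdivrMr// mul1r.
apply/andP; split; first by rewrite mulr_gt0 ?divr_gt0//; lra.
rewrite /tpar -[ltRHS]mulr1 [ltRHS](_ : _ = T / 2 * 2); last by field.
by rewrite ltr_pM2l ?divr_gt0//; lra.
Qed.

Lemma clock_tpar T y : 0 < T -> clock T 0 (tpar T y) = (hyp y + y) ^+ 2.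
Proof.
move=> T0; have := norm_lt_hyp y; rewrite ltr_norml => /andP[h1 h2].
have h0 := hyp_gt0 y.
have e : 1 = (hyp y - y) * (hyp y + y) by rewrite -subr_sqr sqr_hyp addrK.
have hm : hyp y - y != 0 by rewrite subr_eq0 gt_eqF.
have hp : hyp y + y != 0 by rewrite gt_eqF//; lra.
have hN : hyp y != 0 by rewrite gt_eqF.
have TN : T != 0 by rewrite gt_eqF.
have e' : (hyp y - y)^-1 = hyp y + y.
  by apply: (mulfI hm); rewrite -e divff.
rewrite expr2 -{2}e' /clock /tpar; field.
rewrite hm hN TN /= (_ : _ - _ = T * (hyp y - y)); last by ring.
by rewrite mulf_neq0.
Qed.

(** With [kap = (hyp y + y) ^+ 2] and [(hyp y + y)^-1 = hyp y - y], standardizing [a + a * kap] and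
    [a - a * kap] leaves half the sum and half the difference of [hyp y - y] and [hyp y + y], times
    [k]. *)
Lemma crossing_tpar D T a y : 0 < D -> 0 < T -> let k := 2 * a / Num.sqrt (D * T) in
  crossing D T a (tpar T y) =
  (gtail (k * hyp y) + expR (- (k ^+ 2 / 2)) * gtail (- (k * y)))%:E.
Proof.
move=> D0 T0 k; rewrite /crossing clock_tpar//.
have DT0 : 0 < D * T by exact: mulr_gt0.
have := norm_lt_hyp y; rewrite ltr_norml => /andP[h1 h2].
have hp0 : 0 < hyp y + y by lra.
have v0 : 0 < D * T * (hyp y + y) ^+ 2 by rewrite mulr_gt0// exprn_gt0.
have q0 : 0 < Num.sqrt (D * T) by rewrite sqrtr_gt0.
have qN : Num.sqrt (D * T) != 0 by rewrite gt_eqF.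
have hpN : hyp y + y != 0 by rewrite gt_eqF.
rewrite !normal_prob_tail// sqrtrM ?ltW// sqrtr_sqr gtr0_norm// -EFinM -EFinD.
have k2 : 2 * a ^+ 2 / (D * T) = k ^+ 2 / 2.
  rewrite /k -{1}(sqr_sqrtr (ltW DT0)); field; exact: qN.
rewrite k2; congr (gtail _ + _ * gtail _)%:E.
- rewrite /k; apply: (canLR (mulfK _)); first by rewrite mulf_neq0.
  have -> : 2 * a / Num.sqrt (D * T) * hyp y * (Num.sqrt (D * T) * (hyp y + y)) =
    a * (2 * hyp y ^+ 2 + 2 * hyp y * y) by field.
  have -> : a - - a * (hyp y + y) ^+ 2 = a * (1 + hyp y ^+ 2 + 2 * hyp y * y + y ^+ 2) by ring.
  by rewrite sqr_hyp; ring.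
- rewrite /k; apply: (canLR (mulfK _)); first by rewrite mulf_neq0.
  have -> : - (2 * a / Num.sqrt (D * T) * y) * (Num.sqrt (D * T) * (hyp y + y)) =
    - (a * (2 * y ^+ 2 + 2 * hyp y * y)) by field.
  have -> : a - a * (hyp y + y) ^+ 2 = a * (1 - hyp y ^+ 2 - 2 * hyp y * y - y ^+ 2) by ring.
  by rewrite sqr_hyp; ring.
Qed.

Lemma tpar_surj T t : 0 < t < T -> exists y, t = tpar T y.
Proof.
move=> /andP[t0 tT]; pose r := Num.sqrt (t * (T - t)).
have p0 : 0 < t * (T - t) by rewrite mulr_gt0// subr_gt0.
have r0 : 0 < r by rewrite sqrtr_gt0.
have rN : r != 0 by rewrite gt_eqF.
have TN : T != 0 by rewrite gt_eqF// (lt_trans t0).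
have tN : t != 0 by rewrite gt_eqF.
have TtN : T - t != 0 by rewrite subr_eq0 gt_eqF.
(* The solution of [y / hyp y = 2 * t / T - 1]. *)
exists ((2 * t - T) / (2 * r)); rewrite /tpar /hyp.
have -> : 1 + ((2 * t - T) / (2 * r)) ^+ 2 = (T / (2 * r)) ^+ 2.
  have r2 : r ^+ 2 = t * (T - t) by rewrite sqr_sqrtr// ltW.
  rewrite !exprMn !exprVn !exprMn r2; field.
  by rewrite ?tN ?TtN.
rewrite sqrtr_sqr ger0_norm; last first.
  by rewrite divr_ge0// ?mulr_ge0 ?ltW// (lt_trans t0).
by field; rewrite rN TN.
Qed.

Let mono_core y z : 0 <= y -> y < z -> y / hyp y < z / hyp z.
Proof.
move=> y0 yz; have z0 : 0 < z by exact: le_lt_trans yz.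
rewrite ltr_pdivrMr ?hyp_gt0// mulrAC ltr_pdivlMr ?hyp_gt0//.
rewrite -ltr_sqr ?nnegrE ?mulr_ge0 ?(ltW (hyp_gt0 _)) ?(ltW z0)//.
rewrite !exprMn !sqr_hyp !mulrDr !mulr1 [z ^+ 2 * y ^+ 2]mulrC ltrD2r.
by rewrite ltr_sqr ?nnegrE ?(ltW z0).
Qed.

Lemma tpar_lt T y z : 0 < T -> y < z -> tpar T y < tpar T z.
Proof.
move=> T0 yz; rewrite ltr_pM2l ?divr_gt0// ltrD2l.
have [y0|y0] := leP 0 y; first exact: mono_core.
have [z0|z0] := leP 0 z.
  apply: (@lt_le_trans _ _ 0); last by rewrite divr_ge0// ltW// hyp_gt0.
  by rewrite pmulr_llt0// invr_gt0 hyp_gt0.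
have hN x : hyp (- x) = hyp x by rewrite /hyp sqrrN.
have : - z / hyp (- z) < - y / hyp (- y).
  by apply: mono_core; [rewrite oppr_ge0 ltW|rewrite ltrN2].
by rewrite !hN !mulNr ltrN2.
Qed.

Lemma tpar_le T y z : 0 < T -> (tpar T y <= tpar T z) = (y <= z).
Proof.
move=> T0; have [yz|zy] := leP y z; last by rewrite leNgt tpar_lt.
by move: yz; rewrite le_eqVlt => /orP[/eqP->|/(tpar_lt T0)/ltW]; rewrite ?lexx.
Qed.

Lemma continuous_hyp : continuous hyp.
Proof.
move=> y; apply: (@continuous_comp _ _ _ (fun y => 1 + y ^+ 2) Num.sqrt); last exact: sqrt_continuous.
by apply: cvgD; [exact: cvg_cst|exact: exprn_continuous].
Qed.

Lemma continuous_tpar T : continuous (tpar T).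
Proof.
move=> y; apply: cvgM; first exact: cvg_cst.
apply: cvgD; first exact: cvg_cst.
apply: cvgM; first exact: cvg_id.
by apply: cvgV; [rewrite gt_eqF// hyp_gt0|exact: continuous_hyp].
Qed.

End parametrization.

Definition alive (R : realType) (D T a t : R) : R := 1 - fine (crossing D T a t).

(** * Integrating the survival probability over one period *)

Section survival.
Context (R : realType).
Notation mu := (@lebesgue_measure R).
Local Notation hyp := (@hyp R).
Local Notation gphi := (@gphi R).
Local Notation gtail := (@gtail R).
Variables (D T a : R).
Hypotheses (D0 : 0 < D) (T0 : 0 < T) (a0 : 0 < a).
Implicit Types (y z t : R).

(* [expR (- (level ^+ 2 / 2))] is the probability that a bridge reaches [a]. *)
Definition level : R := 2 * a / Num.sqrt (D * T).
Local Notation k := level.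
Local Notation p := (expR (- (k ^+ 2 / 2))).

Lemma level_gt0 : 0 < k.
Proof. by rewrite divr_gt0 ?mulr_gt0// sqrtr_gt0 mulr_gt0. Qed.

(** In the variable [z] of [tpar], the density of the crossing time on the event that the bridge
    crosses: [alive] at [tpar T y] is [1 - p] plus the integral of [density] beyond [y]. *)
Definition density z : R := p * k * gphi (k * z) * (1 - z / hyp z).

Lemma density_ge0 z : 0 <= density z.
Proof.
apply: mulr_ge0.
  apply: mulr_ge0; last exact: gphi_ge0.
  by rewrite mulr_ge0 ?expR_ge0// ltW// level_gt0.
rewrite subr_ge0.
rewrite ler_pdivrMr ?hyp_gt0// mul1r.
by have := norm_lt_hyp z; rewrite ltr_norml => /andP[_ /ltW].
Qed.

Lemma continuous_density : continuous density.
Proof.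
move=> z; apply: cvgM.
  apply: cvgM; first exact: cvg_cst.
  have ck : {for z, continuous (fun z => k * z)}.
    by apply: cvgM; [exact: cvg_cst|exact: cvg_id].
  exact: (continuous_comp ck (@continuous_gphi R _)).
apply: cvgB; first exact: cvg_cst.
apply: cvgM; first exact: cvg_id.
by apply: cvgV; [rewrite gt_eqF// hyp_gt0|exact: continuous_hyp].
Qed.

Lemma gphi_hyp z : gphi (k * hyp z) = p * gphi (k * z).
Proof.
rewrite /gphi mulrCA -expRD; congr (_ * expR _).
by rewrite !exprMn sqr_hyp; ring.
Qed.

Let primitive z : R := gtail (k * hyp z) - p * gtail (k * z).

Lemma is_derive_hyp z : is_derive z 1 hyp (z / hyp z).
Proof.
have h0 : 0 < 1 + z ^+ 2 by rewrite ltr_pwDl// sqr_ge0.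
have d1 := is_derive1_sqrt h0.
have d2 : is_derive z 1 (fun z => 1 + z ^+ 2) (z *+ 2).
  by apply: is_derive_eq; rewrite add0r mul1r /GRing.scale/= !mulr1 mulr2n.
have := is_derive1_comp (f := Num.sqrt) (g := fun z => 1 + z ^+ 2) d1 d2.
move/is_derive_eq; apply; rewrite -/(hyp z) -mulr_natl; field.
by rewrite gt_eqF// hyp_gt0.
Qed.

Lemma is_derive_primitive z : is_derive z 1 primitive (density z).
Proof.
have d1 : is_derive z 1 (fun z => gtail (k * hyp z)) (- gphi (k * hyp z) * (k * (z / hyp z))).
  apply: (is_derive1_comp (f := gtail) (g := fun z => k * hyp z)).
    exact: is_derive_gtail.
  by have dh := is_derive_hyp z; apply: is_derive_eq; rewrite /GRing.scale/=; ring.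
have d2 : is_derive z 1 (fun z => gtail (k * z)) (- gphi (k * z) * k).
  apply: (is_derive1_comp (f := gtail) (g := fun z => k * z)).
    exact: is_derive_gtail.
  by apply: is_derive_eq; rewrite /GRing.scale/=; ring.
have d3 : is_derive z 1 primitive (- gphi (k * hyp z) * (k * (z / hyp z)) - p * (- gphi (k * z) * k)).
  by apply: is_derive_eq; rewrite /GRing.scale/=; ring.
move: d3 => /is_derive_eq; apply; rewrite gphi_hyp /density; ring.
Qed.

Lemma integral_density y : (\int[mu]_(z in `[y, +oo[) (density z)%:E =
  (p * gtail (k * y) - gtail (k * hyp y))%:E)%E.
Proof.
have lim0 c (f : R -> R) : f x @[x --> +oo] --> +oo -> c * gtail (f x) @[x --> +oo] --> (0 : R).
  move=> fy; rewrite -[X in _ --> X](mulr0 c); apply: cvgM; first exact: cvg_cst.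
  exact: (cvg_comp f gtail fy (@cvg_gtail_pinfty R)).
have ky : k * x @[x --> +oo] --> +oo.
  by apply: gt0_cvgMry; [exact: level_gt0|exact: cvg_id].
have hy : k * hyp x @[x --> +oo] --> +oo.
  apply: ger_cvgy ky; near=> x; rewrite ler_pM2l ?level_gt0//.
  by apply: ltW; apply: le_lt_trans (norm_lt_hyp x); exact: ler_norm.
have Pl : primitive x @[x --> +oo] --> (0 : R).
  rewrite -[X in _ --> X]subr0; apply: cvgB; last exact: lim0.
  by have := lim0 1 _ hy; under eq_fun do rewrite mul1r.
have contP x : {for x, continuous primitive}.
  apply: differentiable_continuous; apply/derivable1_diffP.
  by have [] := is_derive_primitive x.
rewrite (ge0_continuous_FTC2y (F := primitive) (l := 0)).
- by rewrite -EFinB sub0r opprB.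
- by move=> x _; exact: density_ge0.
- exact/continuous_subspaceT/continuous_density.
- exact: Pl.
- by move=> x _; have [] := is_derive_primitive x.
- exact: cvg_at_right_filter (contP y).
- by move=> x _; rewrite derive1E; apply: derive_val; exact: is_derive_primitive.
Unshelve. all: by end_near. Qed.

Lemma alive_tpar y : alive D T a (tpar T y) =
  (1 - p) + (p * gtail (k * y) - gtail (k * hyp y)).
Proof.
by rewrite /alive (crossing_tpar a y D0 T0) /= -/k gtailN; ring.
Qed.

(** The factors [1 - z / hyp z] of the density and [1 + z / hyp z] of the time multiply to
    [(1 + z ^+ 2)^-1]: this is where the Cauchy kernel arises. *)
Lemma density_tpar z : density z * tpar T z =
  p * (T / 2) * (k * gphi (k * z) / (1 + z ^+ 2)).
Proof.
have hN : hyp z != 0 by rewrite gt_eqF// hyp_gt0.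
have h2N : 1 + z ^+ 2 != 0 by rewrite -sqr_hyp expf_neq0.
have e : (1 - z / hyp z) * (1 + z / hyp z) = (1 + z ^+ 2)^-1.
  rewrite -sqr_hyp (_ : (1 - z / hyp z) * (1 + z / hyp z) = (hyp z ^+ 2 - z ^+ 2) / hyp z ^+ 2).
    by rewrite sqr_hyp addrK mul1r.
  by field.
by rewrite /density /tpar -e; ring.
Qed.

Lemma expR_level_le1 : p <= 1.
Proof. by rewrite -[leRHS]expR0 ler_expR oppr_le0 divr_ge0// sqr_ge0. Qed.

(** A layer-cake argument: Tonelli on the region [0 < t <= tpar T z] turns the integrated tail of
    [density] into its first moment. Paths that never cross contribute the full length [T]. *)
Lemma integral_alive : (\int[mu]_(t in `]0%R, T[) (alive D T a t)%:E =
  (T * (1 - p))%:E + \int[mu]_z (density z * tpar T z)%:E)%E.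
Proof.
pose S : set (R * R) := [set u | 0 < u.1 /\ u.1 <= tpar T u.2].
pose H (u : R * R) : \bar R := (\1_S u * density u.2)%:E.
have mdens : measurable_fun setT density.
  exact: continuous_measurable_fun continuous_density.
have mtpar : measurable_fun setT (tpar T).
  exact: continuous_measurable_fun (@continuous_tpar R T).
have mS : measurable S.
  have m1 : measurable_fun setT (fun u : R * R => 0 < u.1) by exact: measurable_fun_ltr.
  have m2 : measurable_fun setT (fun u : R * R => u.1 <= tpar T u.2).
    by apply: measurable_fun_ler => //; exact: (measurableT_comp mtpar).
  have := measurable_and m1 m2 => /(_ measurableT [set true] I).
  rewrite setTI (_ : _ @^-1` _ = S)//.
  by apply/seteqP; split => u /= => [/andP|h]; last apply/andP.
have mH : measurable_fun setT H.
  apply/measurable_EFinP; apply: measurable_funM; first exact: measurable_indic.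
  exact: (measurableT_comp mdens).
have H0 u : (0 <= H u)%E by rewrite lee_fin mulr_ge0// density_ge0.
have aliveE t : t \in `]0, T[ -> (alive D T a t)%:E = ((1 - p)%:E + \int[mu]_z H (t, z))%E.
  rewrite in_itv/= => tT; have [y ty] := tpar_surj tT.
  rewrite ty alive_tpar EFinD -integral_density integral_mkcond; congr (_ + _)%E.
  apply: eq_integral => z _; rewrite patchE /H /= indicE.
  have [tp _] := andP (tpar_itv y T0).
  have -> : ((tpar T y, z) \in S) = (z \in `[y, +oo[%classic).
    apply/idP/idP; rewrite !inE /S /= in_itv/= andbT tpar_le//; first by case.
  by case: ifPn => _; rewrite ?mul1r ?mul0r.
have mF := measurable_fun_fubini_tonelli_F (m2 := mu) H mH H0.
transitivity (\int[mu]_(t in `]0%R, T[) ((1 - p)%:E + \int[mu]_z H (t, z)))%E.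
  by apply: eq_integral => t; rewrite inE/= => tT; exact: aliveE.
rewrite ge0_integralD//; last 3 first.
- by move=> t _; rewrite lee_fin subr_ge0 expR_level_le1.
- by move=> t _; exact: integral_ge0.
- exact: measurable_funTS.
rewrite integral_cst//= lebesgue_measure_itv/= lte_fin T0 oppr0 addr0 -EFinM mulrC.
congr (_ + _)%E.
rewrite integral_mkcond.
transitivity (\int[mu]_t \int[mu]_z H (t, z))%E.
  apply: eq_integral => t _; rewrite patchE; case: ifPn => //.
  rewrite notin_setE/= in_itv/= => tT; apply/esym/integral0_eq => z _.
  rewrite /H indicE memNset ?mul0r// => -[/= t0 tz]; apply: tT.
  by rewrite t0 (le_lt_trans tz)//; have /andP[] := tpar_itv z T0.
rewrite (fubini_tonelli (m1 := mu) (m2 := mu) H mH H0).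
apply: eq_integral => z _; rewrite /fubini_G /H /=.
transitivity (\int[mu]_t ((density z)%:E * (\1_(`]0%R, tpar T z]%classic) t)%:E))%E.
  apply: eq_integral => t _; rewrite -EFinM mulrC; congr (_ * _)%:E.
  rewrite !indicE; congr (nat_of_bool _)%:R; apply/idP/idP; rewrite !inE /S /= in_itv/=.
    by case=> -> ->.
  by move/andP.
have mI : measurable_fun setT (fun t : R => (\1_(`]0%R, tpar T z]%classic) t)%:E : \bar R).
  exact/measurable_EFinP/measurable_indic.
have d0 : (0 <= (density z)%:E)%E by rewrite lee_fin density_ge0.
rewrite ge0_integralZl//.
have L : mu `]0, tpar T z] = (tpar T z)%:E.
  rewrite lebesgue_measure_itv/= lte_fin.
  by have /andP[-> _] := tpar_itv z T0; rewrite oppr0 addr0.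
by rewrite [RHS]EFinM -L integral_indic// setIT.
Qed.

End survival.

Lemma ae_eq_measure d (O : measurableType d) (R : realType)
    (mu : {measure set O -> \bar R}) (A B : set O) :
  measurable A -> measurable B -> {ae mu, forall w, A w <-> B w} -> mu A = mu B.
Proof.
move=> mA mB [N [mN N0 subN]].
have le_AB (X Y : set O) : measurable X -> measurable Y ->
    (forall w, ~ N w -> X w -> Y w) -> (mu X <= mu Y)%E.
  move=> mX mY XY; rewrite -[leRHS]adde0 -N0.
  apply: (le_trans _ (measureU2 mu mY mN)).
  apply: le_measure; rewrite ?inE//; first exact: measurableU.
  by move=> w Xw; have [Nw|Nw] := pselect (N w); [right|left; exact: XY].
have AB w : ~ N w -> (A w <-> B w).
  by move=> Nw; apply: contrapT => h; apply: Nw; exact: subN.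
by apply/eqP; rewrite eq_le; apply/andP; split; apply: le_AB => // w /AB [].
Qed.

(** * From grids to the maximum of a bridge *)

Section bridge_maximum.
Context d (O : measurableType d) (R : realType) (P : probability O R).
Variables (D T a : R) (B : R -> {RV P >-> R}).
Hypotheses (D0 : 0 < D) (T0 : 0 < T) (a0 : 0 < a).
Hypothesis bbB : brownian_bridge D T B.
Implicit Types (t c : R).

Definition regular_path (w : O) : Prop :=
  {within `[0, T], continuous (fun t => B t w)} /\ B 0 w = 0.

Let mB t c : measurable (B t @^-1` `]-oo, c]).
Proof. by rewrite -[X in measurable X]setTI; exact: measurable_funP. Qed.

Lemma ae_regular_path : {ae P, forall w, regular_path w}.
Proof.
have [contB [dd [Om [P' [W [[W0 _ _ _] fdd]]]]]] := bbB.
have PB0 : P (B 0 @^-1` [set 0]) = 1%E.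
  have := fdd 1%N (fun=> 0) (fun=> [set 0]).
  rewrite !bigcap_mkord !big_ord_recl !big_ord0 !setIT => ->//; last first.
    by move=> i _; rewrite lexx ltW.
  have -> : (fun w => W 0 w - 0 / T * W T w) @^-1` [set 0] = W 0 @^-1` [set 0].
    by apply/seteqP; split => w /=; rewrite !mul0r subr0.
  have mW : measurable (W 0 @^-1` [set 0]).
    by rewrite -[X in measurable X]setTI; exact: measurable_funP.
  rewrite -(probability_setT P'); apply: ae_eq_measure => //.
  by apply: filterS W0 => w.
have : {ae P, forall w, B 0 w = 0}.
  have mB0 : measurable (B 0 @^-1` [set 0]).
    by rewrite -[X in measurable X]setTI; exact: measurable_funP.
  exists (~` (B 0 @^-1` [set 0])); split => //; first exact: measurableC.
  by rewrite probability_setC// PB0 subee.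
by apply: filterS2 contB.
Qed.

(** A grid event involves finitely many times, so the law of [B] transfers it to the space of [W],
    where [bridge_of] agrees almost surely with the process in the definition of a bridge. *)
Lemma cvg_grid_below t c : 0 < c -> 0 < t -> t < T ->
  P (\bigcap_(k < (2 ^ m).+1) (B (dyadic t m k) @^-1` `]-oo, c]))
    @[m --> \oo] --> (alive D T c t)%:E.
Proof.
move=> c0 t0 tT.
have [contB [dd [Om [P' [W [bmW fdd]]]]]] := bbB.
have [W0 _ _ _] := bmW.
have mBB u : measurable [set w | c < bridge_of T W u w].
  have := measurable_bridge_of T W u => /(_ measurableT `]c, +oo[%classic (measurable_itv _)).
  by rewrite setTI set_itvoy; exact.
have mU m : measurable (\bigcup_(k < (2 ^ m).+1) [set w | c < bridge_of T W (dyadic t m k) w]).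
  by rewrite bigcup_mkord; apply: bigsetU_measurable => k _.
have -> : (fun m => P (\bigcap_(k < (2 ^ m).+1) (B (dyadic t m k) @^-1` `]-oo, c]))) =
  (fun m => 1 - P' (\bigcup_(k < (2 ^ m).+1) [set w | c < bridge_of T W (dyadic t m k) w]%R))%E.
  apply/funext => m.
  rewrite (fdd (2 ^ m).+1 (dyadic t m) (fun=> `]-oo, c]%classic)); last 2 first.
  - move=> i im; have := dyadic_itv t0 (im : (i <= 2 ^ m)%N); rewrite in_itv/= => /andP[-> /le_trans]; apply.
    exact: ltW.
  - by [].
  rewrite -probability_setC//; apply: ae_eq_measure.
  - rewrite bigcap_mkord; apply: bigsetI_measurable => i _.
    rewrite -[X in measurable X]setTI.
    suff : measurable_fun setT (fun w => W (dyadic t m i) w - dyadic t m i / T * W T w).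
      by apply.
    by apply: measurable_funB => //; exact: measurable_funM.
  - exact: measurableC.
  - apply: filterS W0 => w w0; rewrite setC_bigcup; split => h k /= km.
      have := h k km; rewrite /= in_itv/= => hk; apply/negP; rewrite -leNgt.
      by rewrite /bridge_of w0 !subr0.
    have /negP := h k km; rewrite /= -leNgt in_itv/=.
    by rewrite /bridge_of w0 !subr0.
have fc : crossing D T c t \is a fin_num by rewrite /crossing fin_numD fin_numM// !fin_num_measure.
rewrite /alive EFinB fineK//; apply: cvgeB.
- by rewrite fin_num_adde_defr.
- exact: cvg_cst.
- exact: (cvg_grid_exceed D0 bmW c0 t0 tT).
Qed.

Definition below t c : set O :=
  \bigcap_m \bigcap_(k < (2 ^ m).+1) (B (dyadic t m k) @^-1` `]-oo, c]).

Lemma prob_below t c : 0 < c -> 0 < t -> t < T -> P (below t c) = (alive D T c t)%:E.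
Proof.
move=> c0 t0 tT; apply: (cvg_unique _ _ (cvg_grid_below c0 t0 tT)) => //.
apply: nonincreasing_cvg_mu.
- by rewrite -ge0_fin_numE// fin_num_measure// bigcap_mkord; apply: bigsetI_measurable => i _.
- by move=> m; rewrite bigcap_mkord; apply: bigsetI_measurable => i _.
- by apply: bigcap_measurableType => m _; rewrite bigcap_mkord; apply: bigsetI_measurable => i _.
(* Each dyadic grid is contained in the next one, so the events decrease. *)
- apply/nonincreasing_seqP => m; apply/subsetPset => w h k /= km.
  by rewrite -dyadicS; apply: h; rewrite /= expnS ltnS leq_mul2l.
Qed.

End bridge_maximum.

(** * The events that a bridge stays below the target *)

Section survival_events.
Context d (O : measurableType d) (R : realType) (P : probability O R).
Variables (D T a : R) (B : R -> {RV P >-> R}).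
Hypotheses (D0 : 0 < D) (T0 : 0 < T) (a0 : 0 < a).
Hypothesis bbB : brownian_bridge D T B.
Implicit Types (t c : R).

Let mB t c : measurable (B t @^-1` `]-oo, c]).
Proof. by rewrite -[X in measurable X]setTI; exact: measurable_funP. Qed.

(** Starting from [j.+2] keeps the level positive at [j = 0]; the law of the maximum is available
    for positive levels only. *)
Definition sublevel (j : nat) : R := a - a / j.+2%:R.

Lemma sublevel_itv j : 0 < sublevel j < a.
Proof.
have j0 : 0 < j.+2%:R :> R by rewrite ltr0n.
rewrite /sublevel subr_gt0 ltr_pdivrMr// ltr_pMr// ltr1n/=.
by rewrite gtrBl divr_gt0.
Qed.

Lemma sublevel_mono i j : (i <= j)%N -> sublevel i <= sublevel j.
Proof.
move=> ij; rewrite lerD2l lerN2 ler_pM2l// lef_pV2 ?posrE ?ltr0n//.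
by rewrite ler_nat !ltnS.
Qed.

Lemma cvg_sublevel : sublevel j @[j --> \oo] --> a.
Proof.
rewrite -[X in _ --> X]subr0; apply: cvgB; first exact: cvg_cst.
rewrite -[X in _ --> X](mulr0 a); apply: cvgM; first exact: cvg_cst.
have := @cvg_harmonic R; rewrite -cvg_shiftS; exact.
Qed.

(** Strict bounds do not pass from a grid to an interval, closed ones do. By compactness a
    continuous path stays strictly below [a] exactly when it stays below some [sublevel j]. *)
Definition stays_below t : set O := \bigcup_j below B t (sublevel j).

Lemma measurable_below t c : measurable (below B t c).
Proof.
by apply: bigcap_measurableType => m _; rewrite bigcap_mkord; apply: bigsetI_measurable => i _.
Qed.

Lemma measurable_stays_below t : measurable (stays_below t).
Proof. by apply: bigcup_measurable => j _; exact: measurable_below. Qed.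

(** The survival formula is continuous in the level, so replacing the closed bound by a strict one
    does not change the probability. *)
Lemma prob_stays_below t : 0 < t < T -> P (stays_below t) = (alive D T a t)%:E.
Proof.
move=> tT; have /andP[t0 tltT] := tT.
have h1 : P (below B t (sublevel j)) @[j --> \oo] --> P (stays_below t).
  apply: nondecreasing_cvg_mu.
  - by move=> j; exact: measurable_below.
  - exact: measurable_stays_below.
  - move=> i j ij; apply/subsetPset => w h m _ k km.
    have := h m I k km; rewrite /= !in_itv/= => /le_trans; apply; exact: sublevel_mono.
apply: (cvg_unique _ h1) => //.
have -> : (fun j => P (below B t (sublevel j))) = (fun j => (alive D T (sublevel j) t)%:E).
  by apply/funext => j; rewrite (prob_below D0 bbB)//; have /andP[] := sublevel_itv j.
suff H : alive D T (sublevel j) t @[j --> \oo] --> alive D T a t.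
  by apply: cvg_EFin; [exact: nearW|exact: H].
have [y ->] := tpar_surj tT.
have -> : (fun j => alive D T (sublevel j) (tpar T y)) =
   (fun c => (1 - expR (- (level D T c ^+ 2 / 2))) +
     (expR (- (level D T c ^+ 2 / 2)) * gtail (level D T c * y) -
      gtail (level D T c * hyp y))) \o sublevel.
  by apply/funext => j /=; rewrite alive_tpar.
rewrite alive_tpar//.
apply: (cvg_comp sublevel _ cvg_sublevel).
have cl : level D T c @[c --> a] --> level D T a.
  by apply: cvgM; [apply: cvgM; [exact: cvg_cst|exact: cvg_id]|exact: cvg_cst].
have ce : expR (- (level D T c ^+ 2 / 2)) @[c --> a] --> expR (- (level D T a ^+ 2 / 2)).
  apply: (cvg_comp _ expR); last exact: continuous_expR.
  apply: cvgN; apply: cvgM; last exact: cvg_cst.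
  by apply: (cvg_comp _ (fun x => x ^+ 2) cl); exact: exprn_continuous.
have cg x : gtail (level D T c * x) @[c --> a] --> gtail (level D T a * x).
  apply: (cvg_comp _ (@gtail R)); last exact: continuous_gtail.
  by apply: cvgM => //; exact: cvg_cst.
apply: cvgD; first by apply: cvgB => //; exact: cvg_cst.
by apply: cvgB => //; apply: cvgM.
Qed.

Lemma stays_belowP t w : 0 <= t <= T -> regular_path T B w ->
  stays_below t w <-> (forall u, 0 <= u <= t -> B u w < a).
Proof.
move=> /andP[t0 tT] [cB B0].
have cBt : {within `[0, t], continuous (fun t => B t w)}.
  apply: continuous_subspaceW cB => x /=; rewrite !in_itv/= => /andP[-> h] /=.
  exact: le_trans tT.
split=> [[j _ h] u ut|h].
  have /andP[s0 sa] := sublevel_itv j.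
  apply: (le_lt_trans _ sa).
  move: t0; rewrite le_eqVlt => /orP[/eqP t0|t0].
    by have -> : u = 0; [lra|rewrite B0 ltW].
  rewrite leNgt; apply/negP => su.
  have uin : u \in `[0, t] by rewrite in_itv.
  have [m _ /(_ m (leqnn m))[i im [si _]]] := dyadic_exceed t0 cBt uin su ltr01.
  have := h m I i im; rewrite /= in_itv/= leNgt.
  by rewrite si.
have [s sin smax] := EVT_max t0 cBt.
have Bsa : B s w < a by apply: h; move: sin; rewrite in_itv.
have [j _ /(_ j (leqnn j)) jP] := cvgr_gt a cvg_sublevel _ Bsa.
exists j => // m _ k km /=; rewrite in_itv/=; apply/ltW/(le_lt_trans _ jP).
apply: smax.
move: t0; rewrite le_eqVlt => /orP[/eqP <-|t0]; last exact: dyadic_itv.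
by rewrite /dyadic !mul0r in_itv/= lexx.
Qed.

(** The times [tpar T j%:R] increase to [T], before which the law of the maximum is explicit. *)
Definition survives : set O := \bigcap_j stays_below (tpar T j%:R).

Lemma measurable_survives : measurable survives.
Proof. by apply: bigcap_measurableType => j _; exact: measurable_stays_below. Qed.

Lemma cvg_tpar_hyp (x : R) : 0 < x -> T - tpar T x <= T / (2 * x ^+ 2).
Proof.
move=> x0; have h0 := hyp_gt0 x.
have hN : hyp x != 0 by rewrite gt_eqF.
have xN : x != 0 by rewrite gt_eqF.
have xh : x < hyp x by have := norm_lt_hyp x; rewrite ltr_norml => /andP[].
have -> : T - tpar T x = T / 2 * ((hyp x - x) / hyp x) by rewrite /tpar; field.
have -> : T / (2 * x ^+ 2) = T / 2 * (x ^+ 2)^-1 by field.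
rewrite ler_pM2l ?divr_gt0// ler_pdivrMr// mulrC ler_pdivlMr ?exprn_gt0//.
have e : (hyp x - x) * (hyp x + x) = 1 by rewrite -subr_sqr sqr_hyp addrK.
have hx : 0 < hyp x - x by rewrite subr_gt0.
have hx1 : (hyp x - x) * x <= 1 by rewrite -e ler_pM2l//; lra.
rewrite expr2 mulrA; nra.
Qed.

Lemma tpar_exhausts (u : R) : u < T -> exists j : nat, u <= tpar T j%:R.
Proof.
move=> uT; have uT0 : 0 < T - u by rewrite subr_gt0.
pose j := (Num.truncn (T / (T - u))).+1.
have jP : T / (T - u) < j%:R.
  by have /truncn_itv/andP[_] : 0 <= T / (T - u) by rewrite divr_ge0// ltW.
exists j; have j1 : 1 <= j%:R :> R by rewrite ler1n.
have j0 : 0 < j%:R :> R by lra.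
have := cvg_tpar_hyp j0 => h.
suff : T / (2 * j%:R ^+ 2) <= T - u by lra.
rewrite ler_pdivrMr ?mulr_gt0 ?exprn_gt0//.
move: jP; rewrite ltr_pdivrMr// => jP.
have : (T - u) * j%:R <= (T - u) * (2 * j%:R ^+ 2).
  by rewrite ler_pM2l// expr2; nra.
by move: jP; rewrite mulrC; lra.
Qed.

Lemma survivesP w : regular_path T B w ->
  survives w <-> (forall u, 0 <= u < T -> B u w < a).
Proof.
move=> wreg.
have tle j : 0 <= tpar T j%:R <= T.
  by have /andP[/ltW-> /ltW->] := tpar_itv (j%:R : R) T0.
split=> [h u /andP[u0 uT]|h j _].
  have [j uj] := tpar_exhausts uT.
  by have /(stays_belowP (tle j) wreg) := h j I; apply; rewrite u0.
apply/(stays_belowP (tle j) wreg) => u /andP[u0 uj]; apply: h.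
by rewrite u0 (le_lt_trans uj)//; have /andP[] := tpar_itv (j%:R : R) T0.
Qed.

(** Both tail terms of [alive_tpar] vanish as the parameter grows, which leaves [1 - p]. *)
Lemma prob_survives :
  P survives = (1 - expR (- (level D T a ^+ 2 / 2)))%:E.
Proof.
pose F n := \bigcap_(j < n.+1) stays_below (tpar T j%:R).
have mF n : measurable (F n).
  by apply: bigcap_measurableType => j _; exact: measurable_stays_below.
have tle j : 0 <= tpar T j%:R <= T.
  by have /andP[/ltW-> /ltW->] := tpar_itv (j%:R : R) T0.
have FE n : P (F n) = (alive D T a (tpar T n%:R))%:E.
  rewrite -prob_stays_below ?tpar_itv//; apply: ae_eq_measure => //.
    exact: measurable_stays_below.
  apply: filterS (ae_regular_path T0 bbB) => w wreg; split=> [h|h j /= jn]; first exact: (h n (leqnn _)).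
  apply/(stays_belowP (tle j) wreg) => u /andP[u0 uj].
  have /(stays_belowP (tle n) wreg) := h; apply; rewrite u0 (le_trans uj)//.
  by rewrite tpar_le// ler_nat -ltnS.
have cF : P (F n) @[n --> \oo] --> P survives.
  rewrite (_ : survives = \bigcap_n F n).
    apply: nonincreasing_cvg_mu => //.
    - by rewrite -ge0_fin_numE// fin_num_measure.
    - by apply: bigcap_measurableType.
    - move=> m n mn; apply/subsetPset => w h j /= jm; apply: h => /=.
      by rewrite (leq_trans jm).
  apply/seteqP; split => w h j _; first by move=> i _; exact: h.
  exact: (h j I j (leqnn _)).
apply: (cvg_unique _ cF) => //.
have -> : (fun n => P (F n)) = (fun n => (alive D T a (tpar T n%:R))%:E).
  by apply/funext => n; exact: FE.
suff H : alive D T a (tpar T n%:R) @[n --> \oo] --> 1 - expR (- (level D T a ^+ 2 / 2)).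
  by apply: cvg_EFin; [exact: nearW|exact: H].
have k0 : 0 < level D T a by exact: level_gt0.
have ny : (n%:R : R) @[n --> \oo] --> +oo by exact: cvgr_idn.
have ky : level D T a * n%:R @[n --> \oo] --> +oo.
  apply/cvgryPge => A; have /cvgryPge/(_ (A / level D T a)) := ny.
  by apply: filterS => n; rewrite ler_pdivrMr// mulrC.
have hy : level D T a * hyp (n%:R : R) @[n --> \oo] --> +oo.
  apply: ger_cvgy ky; apply: nearW => n; rewrite ler_pM2l//.
  by apply: ltW; exact: (le_lt_trans (ler_norm _) (norm_lt_hyp _)).
have -> : (fun n => alive D T a (tpar T n%:R)) = (fun n => (1 - expR (- (level D T a ^+ 2 / 2))) +
     (expR (- (level D T a ^+ 2 / 2)) * gtail (level D T a * n%:R) -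
      gtail (level D T a * hyp n%:R))).
  by apply/funext => n; rewrite alive_tpar.
rewrite -[X in _ --> X]addr0; apply: cvgD; first exact: cvg_cst.
rewrite -[X in _ --> X]subr0; apply: cvgB; last exact: (cvg_comp _ (@gtail R) hy (@cvg_gtail_pinfty R)).
rewrite -[X in _ --> X](mulr0 (expR (- (level D T a ^+ 2 / 2)))).
apply: cvgM; first exact: cvg_cst.
exact: (cvg_comp _ (@gtail R) ky (@cvg_gtail_pinfty R)).
Qed.

(** Independence of the bridges is stated for these sigma-algebras, so the event must be generated
    by [B] at times in [[0, T]]; its dyadic construction shows this. *)
Lemma bridge_sigma_stays_below t : 0 <= t <= T ->
  bridge_sigma_algebra T B (stays_below t).
Proof.
move=> /andP[t0 tT].
pose G := \bigcup_(t in `[0, T]) preimage_set_system setT (B t) measurable.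
suff : measurable (stays_below t : set (g_sigma_algebraType G)) by exact.
apply: bigcup_measurable => j _; apply: bigcap_measurableType => m _.
rewrite bigcap_mkord; apply: bigsetI_measurable => k _.
apply: sub_sigma_algebra; exists (dyadic t m k).
  rewrite /= in_itv/=; have [t00|tn0] := eqVneq t 0.
    by rewrite t00 /dyadic !mul0r lexx ltW.
  have tp : 0 < t by rewrite lt_neqAle eq_sym tn0.
  have : dyadic t m k \in `[0, t] by apply: dyadic_itv => //; rewrite -ltnS.
  by rewrite in_itv/= => /andP[-> h]/=; exact: le_trans tT.
by exists (`]-oo, sublevel j]%classic) => //; rewrite setTI.
Qed.

Lemma bridge_sigma_survives : bridge_sigma_algebra T B survives.
Proof.
pose G := \bigcup_(t in `[0, T]) preimage_set_system setT (B t) measurable.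
suff : measurable (survives : set (g_sigma_algebraType G)) by exact.
apply: bigcap_measurableType => j _; apply: bridge_sigma_stays_below.
by have /andP[/ltW-> /ltW->] := tpar_itv (j%:R : R) T0.
Qed.

End survival_events.

(** * The hitting time of the reset process *)

Section hitting.
Context d (O : measurableType d) (R : realType) (P : probability O R).
Variables (T a : R) (B : nat -> R -> {RV P >-> R}).
Hypotheses (T0 : 0 < T) (a0 : 0 < a).
Local Notation X := (reset_process T B).

Definition not_hit_by (s : R) : set O :=
  let n := Num.truncn (s / T) in
  (\bigcap_(j < n) survives T a (B j)) `&` stays_below a (B n) (s - n%:R * T).

Lemma truncn_period (n : nat) (r : R) : 0 <= r < T -> Num.truncn ((n%:R * T + r) / T) = n.
Proof.
move=> /andP[r0 rT]; apply: truncn_def.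
by rewrite ler_pdivlMr// ltr_pdivrMr// lerDl r0 -natr1 mulrDl mul1r ltrD2l.
Qed.

Lemma reset_processE (n : nat) (r : R) w : 0 <= r < T -> X (n%:R * T + r) w = B n r w.
Proof. by move=> r0; rewrite /reset_process truncn_period// addrAC subrr add0r. Qed.

Lemma period_split (s : R) : 0 <= s ->
  let n := Num.truncn (s / T) in 0 <= s - n%:R * T < T.
Proof.
move=> s0 /=; set n := Num.truncn _; have /truncn_itv : 0 <= s / T by rewrite divr_ge0// ltW.
by rewrite -/n ler_pdivlMr// ltr_pdivrMr// -natr1 mulrDl mul1r subr_ge0 ltrBlDl.
Qed.

Lemma hitting_time_le (t : R) w : 0 <= t -> X t w = a ->
  (hitting_time X a w <= t%:E)%E.
Proof. by move=> t0 Xt; apply: ereal_inf_lbound; exists t. Qed.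

Lemma hitting_time_ge0 w : (0 <= hitting_time X a w)%E.
Proof. by apply: le_ereal_inf_tmp => _ [t [t0 _] <-]; rewrite lee_fin. Qed.

Lemma bridge_attains (n : nat) (u : R) w : regular_path T (B n) w -> 0 <= u < T ->
  a <= B n u w -> exists2 c, 0 <= c <= u & B n c w = a.
Proof.
move=> [cB B0] /andP[u0 uT] au.
have cBu : {within `[0, u], continuous (fun t => B n t w)}.
  apply: continuous_subspaceW cB => x /=; rewrite !in_itv/= => /andP[-> h] /=.
  exact: le_trans (ltW uT).
have [|c cu Bc] := IVT u0 cBu (v := a).
  by rewrite B0 ge_min ltW//= le_max au orbT.
by exists c => //; move: cu; rewrite in_itv.
Qed.

(** A value at least [a] forces an earlier visit to [a] by the intermediate value theorem.
    Conversely, [not_hit_by] excludes visits up to [s], and continuity excludes them for some time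
    beyond [s], so the infimum is strictly larger. *)
Lemma hitting_timeP w (s : R) : (forall n, regular_path T (B n) w) -> 0 <= s ->
  (s%:E < hitting_time X a w)%E <-> not_hit_by s w.
Proof.
move=> reg s0; pose n := Num.truncn (s / T).
have := period_split s0; rewrite -/n => rT; have /andP[r0 rltT] := rT.
set r := s - n%:R * T in rT r0 rltT *.
have sE : s = n%:R * T + r by rewrite /r addrC subrK.
have rleT : 0 <= r <= T by rewrite r0 ltW.
split=> [hs|[hS hL]].
- split.
  + move=> j /= jn; apply/(survivesP T0 a0 (reg j)) => u uT.
    rewrite ltNge; apply/negP => /(bridge_attains (reg j) uT) [c /andP[c0 cu] Bc].
    have cT : 0 <= c < T by rewrite c0 (le_lt_trans cu)//; case/andP: uT.
    have t0 : 0 <= j%:R * T + c by rewrite addr_ge0// mulr_ge0// ltW.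
    have := hitting_time_le t0 (etrans (reset_processE j w cT) Bc).
    rewrite leNgt => /negP; apply; apply: le_lt_trans hs; rewrite lee_fin sE.
    have : j%:R * T + T <= n%:R * T.
      by rewrite -[X in _ + X]mul1r -mulrDl natr1 ler_pM2r// ler_nat.
    case/andP: cT => _; lra.
  + apply/(stays_belowP a0 rleT (reg n)) => u /andP[u0 ur].
    have uT : 0 <= u < T by rewrite u0 (le_lt_trans ur).
    rewrite ltNge; apply/negP => /(bridge_attains (reg n) uT) [c /andP[c0 cu] Bc].
    have cT : 0 <= c < T by rewrite c0 (le_lt_trans cu)//; case/andP: uT.
    have t0 : 0 <= n%:R * T + c by rewrite addr_ge0// mulr_ge0// ltW.
    have := hitting_time_le t0 (etrans (reset_processE n w cT) Bc).
    rewrite leNgt => /negP; apply; apply: le_lt_trans hs; rewrite lee_fin sE.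
    by rewrite lerD2l (le_trans cu).
- move: hL; rewrite -/n -/r => /(stays_belowP a0 rleT (reg n)) hL.
  have [cB _] := reg n.
  have Br : 0 < a - B n r w by rewrite subr_gt0; apply: hL; rewrite r0 lexx.
  have rin : r \in `[0, T] by rewrite in_itv.
  have [e e0 eP] := within_continuous_dist cB rin Br.
  (* [e] is the margin given by continuity; [T - r] keeps the window inside the current bridge. *)
  pose m := Num.min e (T - r).
  have m0 : 0 < m by rewrite lt_min e0 subr_gt0.
  apply: (@lt_le_trans _ _ (s + m)%:E); first by rewrite lte_fin ltrDl.
  apply: le_ereal_inf_tmp => _ [t [/= t0 Xt] <-]; rewrite lee_fin.
  have := period_split t0; set j := Num.truncn _ => cT.
  set c := t - j%:R * T in cT.
  have tE : t = j%:R * T + c by rewrite /c addrC subrK.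
  move: Xt; rewrite {1}tE reset_processE// => Bc.
  case/andP: (cT) => c0 cltT.
  have [jn|nj|jn] := ltngtP j n.
  + have /(survivesP T0 a0 (reg j))/(_ c cT) := hS j jn.
    by rewrite Bc ltxx.
  + have : n%:R * T + T <= j%:R * T.
      by rewrite -[X in _ + X]mul1r -mulrDl natr1 ler_pM2r// ler_nat.
    have : m <= T - r by rewrite ge_min lexx orbT.
    rewrite tE sE; lra.
  + rewrite tE sE jn -addrA lerD2l leNgt; apply/negP => crm.
    rewrite jn in Bc.
    have [cr|rc] := leP c r.
      by have := hL c; rewrite c0 cr Bc ltxx => /(_ isT).
    have cin : c \in `[0, T] by rewrite in_itv/= c0 ltW.
    have : `|c - r| < e.
      rewrite gtr0_norm ?subr_gt0//.
      have : m <= e by rewrite ge_min lexx.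
      lra.
    move=> /(eP _ cin); rewrite Bc ltr_norml => /andP[_]; by rewrite ltxx.
Qed.

End hitting.

(** * Integrals of functions not known to be measurable *)

Section integral_nonmeasurable.
Context d (O : measurableType d) (R : realType) (mu : {measure set O -> \bar R}).
Import HBNNSimple.

Let ge0_le_integral_ae (f g : O -> \bar R) (N : set O) : measurable N ->
  mu N = 0%E -> (forall x, 0 <= f x)%E -> (forall x, 0 <= g x)%E ->
  (forall x, ~ N x -> f x = g x) -> (\int[mu]_x f x <= \int[mu]_x g x)%E.
Proof.
move=> mN N0 f0 g0 fg; rewrite (ge0_integralTE _ f0) (ge0_integralTE _ g0).
apply: ge_ereal_sup => _ [h /= hf <-]; apply: ereal_sup_ubound.
have mNC := measurableC mN.
(* Setting [h] to zero on [N] keeps it below [g] everywhere and leaves its integral unchanged. *)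
exists (proj_nnsfun h mNC) => /=.
  move=> x; rewrite /proj_nnsfun/= /mindic indicE.
  have [xN|xN] := pselect (N x).
    by rewrite memNset ?mulr0//= => /(_ xN).
  by rewrite mem_set// mulr1 -fg.
rewrite -!integralT_nnsfun; apply/esym/ae_eq_integral => //.
- exact/measurable_EFinP.
- exact/measurable_EFinP.
- exists N; split => // x /= hx; apply: contrapT => xN; apply: hx => _.
  by rewrite /proj_nnsfun/= /mindic indicE mem_set// mulr1.
Qed.

(* [f] and [g] need not be measurable: their integrals are then suprema over
   the simple functions below them. *)
Lemma ge0_integral_ae_eq (f g : O -> \bar R) (N : set O) : measurable N ->
  mu N = 0%E -> (forall x, 0 <= f x)%E -> (forall x, 0 <= g x)%E ->
  (forall x, ~ N x -> f x = g x) -> (\int[mu]_x f x = \int[mu]_x g x)%E.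
Proof.
move=> mN N0 f0 g0 fg; apply/eqP; rewrite eq_le.
by rewrite !(ge0_le_integral_ae mN)// => x xN; rewrite fg.
Qed.

End integral_nonmeasurable.

(** * The mean hitting time as a geometric series over the periods *)

Section mean_hitting_time.
Context d (O : measurableType d) (R : realType) (P : probability O R).
Variables (D T a : R) (B : nat -> R -> {RV P >-> R}).
Hypotheses (D0 : 0 < D) (T0 : 0 < T) (a0 : 0 < a).
Hypothesis indB : independent_bridges D T B.
Notation mu := (@lebesgue_measure R).

Local Notation p := (expR (- (level D T a ^+ 2 / 2))).
Local Notation S n := (survives T a (B n)).
Local Notation L n r := (stays_below a (B n) r).

Let bbB n : brownian_bridge D T (B n). Proof. by case: indB. Qed.

Let mS n : measurable (S n). Proof. exact: measurable_survives. Qed.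
Let mL n r : measurable (L n r). Proof. exact: measurable_stays_below. Qed.

Lemma prob_survives_periods n (r : R) : 0 < r < T ->
  P ((\bigcap_(j < n) S j) `&` L n r) = ((1 - p) ^+ n * alive D T a r)%:E.
Proof.
move=> rT; have [_ ind] := indB.
pose E j := if (j < n)%N then S j else L n r.
have EG j : (j < n.+1)%N -> bridge_sigma_algebra T (B j) (E j).
  rewrite /E; case: (ltnP j n) => [jn _|nj jn].
    exact: bridge_sigma_survives.
  have -> : j = n by apply/eqP; rewrite eqn_leq nj andbT -ltnS.
  by apply: bridge_sigma_stays_below => //; case/andP: rT => /ltW-> /ltW->.
have -> : (\bigcap_(j < n) S j) `&` L n r = \bigcap_(i < n.+1) E i.
  apply/seteqP; split=> [w [h1 h2] j /= jn|w h].
    by rewrite /E; case: ltnP => // jn'; exact: h1.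
  split=> [j /= jn|].
    by have := h j (leqW jn); rewrite /E jn.
  by have := h n (leqnn _); rewrite /E ltnn.
rewrite (ind n.+1 E EG) big_ord_recr/= {2}/E ltnn.
rewrite (eq_bigr (fun i : 'I_n => (1 - p)%:E)); last first.
  by move=> i _; rewrite /E ltn_ord (prob_survives D0 T0 a0 (bbB i)).
rewrite (prob_stays_below D0 T0 a0 (bbB n) rT) EFinM; congr (_ * _)%E.
by rewrite big_const_ord iter_mule mule1 EFin_expe.
Qed.

Let q0 : 0 <= 1 - p. Proof. by rewrite subr_ge0 expR_level_le1. Qed.
Let q1 : 1 - p < 1. Proof. by rewrite gtrBl expR_gt0. Qed.

Let survives_all : set O := \bigcap_j S j.

Let prob_survives_all : P survives_all = 0%E.
Proof.
have [_ ind] := indB.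
have mall : measurable survives_all by exact: bigcap_measurableType.
have le_q n : fine (P survives_all) <= (1 - p) ^+ n.
  rewrite -lee_fin fineK ?fin_num_measure// (@le_trans _ _ (P (\bigcap_(j < n) S j)))//.
    apply: le_measure; rewrite ?inE//; first exact: bigcap_measurableType.
    by move=> w h j _; exact: h.
  rewrite (ind n (fun j => S j)); last by move=> j _; exact: bridge_sigma_survives.
  rewrite (eq_bigr (fun i : 'I_n => (1 - p)%:E)); last first.
    by move=> i _; rewrite (prob_survives D0 T0 a0 (bbB i)).
  by rewrite big_const_ord iter_mule mule1 EFin_expe.
have cq : (1 - p) ^+ n @[n --> \oo] --> (0 : R).
  by apply: cvg_expr; rewrite ger0_norm.
rewrite -[LHS]fineK ?fin_num_measure//; congr (_%:E).
apply/eqP; rewrite eq_le fine_ge0// andbT.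
apply: (@ler_cvg_to _ _ _ _ (cst (fine (P survives_all))) _ _ _ (cvg_cst _) cq).
by apply: nearW.
Qed.

Let measurable_not_hit_by s : measurable (not_hit_by T a B s).
Proof. by apply: measurableI => //; exact: bigcap_measurableType. Qed.

Local Notation hit := (hitting_time (reset_process T B) a).

Lemma mean_hitting_time_alive : (mean_hitting_time T B a =
  (p^-1)%:E * \int[mu]_(t in `]0%R, T[) (alive D T a t)%:E)%E.
Proof.
have [N0 [mN0 PN0 subN0]] : {ae P, forall w, forall n, regular_path T (B n) w}.
  by apply: ae_foralln => n; exact: ae_regular_path T0 (bbB n).
(* Off [N] all bridges are regular and one of them reaches [a], so the hitting time is finite. *)
pose N := N0 `|` survives_all.
have mN : measurable N by apply: measurableU => //; exact: bigcap_measurableType.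
have PN : P N = 0%E.
  by rewrite /N null_set_setU//; exact: bigcap_measurableType.
have regN w : ~ N w -> forall n, regular_path T (B n) w.
  move=> Nw; apply: contrapT => h; apply: Nw; left; exact: subN0.
have hitE w : ~ N w -> (fine (hit w))%:E = hit w.
  move=> Nw; rewrite fineK// ge0_fin_numE ?hitting_time_ge0//.
  have /existsNP[j /not_implyP[_ Sj]] : ~ survives_all w by move=> h; apply: Nw; right.
  have s0 : 0 <= j.+1%:R * T by rewrite mulr_ge0// ltW.
  rewrite (@le_lt_trans _ _ (j.+1%:R * T)%:E) ?ltry// leNgt; apply/negP.
  move=> /(hitting_timeP T0 a0 (regN w Nw) s0)[h _]; apply: Sj; apply: h => /=.
  have -> : j.+1%:R * T / T = j.+1%:R by rewrite mulfK// gt_eqF.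
  by rewrite natrK.
(* A real-valued version of the hitting time; it is measurable because its upper level sets are the
   events [not_hit_by] off [N]. *)
pose tau w : R := if w \in N then 0 else fine (hit w).
have tau0 w : 0 <= tau w.
  by rewrite /tau; case: ifP => // _; rewrite fine_ge0// hitting_time_ge0.
have tauP s : 0 <= s -> tau @^-1` `]s, +oo[ = ~` N `&` not_hit_by T a B s.
  move=> s0; apply/seteqP; split => w /=; rewrite in_itv/= andbT /tau.
    case: ifPn; first by rewrite ltNge s0.
    rewrite notin_setE => Nw; rewrite -lte_fin hitE// => h; split => //.
    exact/(hitting_timeP T0 a0 (regN w Nw) s0).
  move=> [Nw h]; rewrite memNset// -lte_fin hitE//.
  exact/(hitting_timeP T0 a0 (regN w Nw) s0).
have mtau : measurable_fun setT tau.
  apply: (measurability _ (RGenOInfty.measurableE R)) => //.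
  move=> _ [_ [s ->] <-]; rewrite setTI.
  have [s0|s0] := leP 0 s.
    by rewrite tauP//; apply: measurableI => //; exact: measurableC.
  rewrite (_ : _ @^-1` _ = setT)//; apply/seteqP; split => // w _ /=.
  by rewrite in_itv/= andbT (lt_le_trans s0).
pose X : {RV P >-> R} := HB.pack tau (isMeasurableFun.Build _ _ _ _ _ mtau).
have ccdfE n r : 0 < r < T -> ccdf X (n%:R * T + r) = ((1 - p) ^+ n * alive D T a r)%:E.
  move=> rT; have /andP[r0 rltT] := rT.
  rewrite -prob_survives_periods// /ccdf /distribution /pushforward/= tauP; last first.
    by rewrite addr_ge0 ?mulr_ge0// ltW.
  have -> : not_hit_by T a B (n%:R * T + r) = (\bigcap_(j < n) S j) `&` L n r.
    by rewrite /not_hit_by truncn_period ?(ltW r0)// addrAC subrr add0r.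
  apply: ae_eq_measure.
  - by apply: measurableI; [exact: measurableC|apply: measurableI => //; exact: bigcap_measurableType].
  - by apply: measurableI => //; exact: bigcap_measurableType.
  - exists N; split => // w /= h; apply: contrapT => Nw; apply: h.
    by split=> [[]|].
pose I := (\int[mu]_(t in `]0%R, T[) ccdf X t)%E.
have IE : (\int[mu]_(t in `]0%R, T[) (alive D T a t)%:E)%E = I.
  apply: eq_integral => t; rewrite inE/= in_itv/= => tT.
  by have := ccdfE 0%N t tT; rewrite mul0r add0r expr0 mul1r => ->.
have mc : measurable_fun setT (ccdf X) by exact: ccdf_measurable.
(* Finiteness of [I] allows it to be factored out of the series. *)
have Ifin : I \is a fin_num.
  rewrite ge0_fin_numE; last exact: integral_ge0.
  apply: (@le_lt_trans _ _ (\int[mu]_(t in `]0%R, T[) cst 1%E t)%E).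
    apply: ge0_le_integral => //.
    - exact: measurable_funTS.
    - by move=> t _; exact: probability_le1.
  by rewrite integral_cst//= lebesgue_measure_itv/= lte_fin T0 mul1e oppr0 addr0 ltry.
pose itv n : set R := `[n%:R * T, n%:R * T + T[%classic.
have period n : (\int[mu]_(s in itv n) ccdf X s = ((1 - p) ^+ n)%:E * I)%E.
  have mitvn : measurable (itv n) by exact: measurable_itv.
  rewrite [LHS]integral_mkcond.
  have mf : measurable_fun setT (ccdf X \_ (itv n)).
    by apply/(measurable_restrictT _ mitvn); exact: measurable_funTS.
  have f0 s : (0 <= (ccdf X \_ (itv n)) s)%E by rewrite patchE; case: ifP.
  have := ge0_integral_affine (n%:R * T) (oner_neq0 R) mf f0.
  rewrite normr1 invr1 mul1e => <-.
  have mc' : measurable_fun setT (fun t => ccdf X (n%:R * T + t)).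
    by apply: (measurableT_comp mc); exact: measurable_funD.
  transitivity (\int[mu]_(t in `[0%R, T[) ccdf X (n%:R * T + t)%R)%E.
    rewrite [RHS]integral_mkcond; apply: eq_integral => t _; rewrite !patchE mul1r [t + _]addrC.
    have -> : (n%:R * T + t \in itv n) = (t \in `[0, T[%classic).
      by apply/idP/idP; rewrite !inE /itv /= !in_itv/=; lra.
    by [].
  (* The left endpoint is dropped, since the formula for the survival function is known at interior
     times only. *)
  rewrite -integral_itv_obnd_cbnd; last exact: measurable_funTS.
  rewrite -ge0_integralZl//; last 2 first.
  - exact: measurable_funTS.
  - by rewrite lee_fin exprn_ge0.
  apply: eq_integral => t; rewrite inE/= in_itv/= => tT.
  by rewrite ccdfE// EFinM; have := ccdfE 0%N t tT; rewrite mul0r add0r expr0 mul1r => ->.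
transitivity (\int[P]_w (tau w)%:E)%E.
  apply: (ge0_integral_ae_eq mN PN).
  - by move=> w; exact: hitting_time_ge0.
  - by move=> w; rewrite lee_fin.
  - by move=> w Nw; rewrite /tau memNset// hitE.
have := ge0_expectation_ccdf (X := X) tau0.
rewrite expectation_def /= => ->.
have -> : `[0%R, +oo[%classic = \bigcup_n itv n.
  apply/seteqP; split => s /=; rewrite in_itv/= andbT.
    move=> s0; exists (Num.truncn (s / T)) => //=.
    have := period_split T0 s0; rewrite /itv/= in_itv/=; lra.
  by move=> [n _]; rewrite /itv/= in_itv/= => /andP[+ _]; apply: le_trans; rewrite mulr_ge0// ltW.
have mitv n : measurable (itv n) by exact: measurable_itv.
rewrite ge0_integral_bigcup//; last 2 first.
- exact: measurable_funTS.
- apply: ltn_trivIset => n2 n1 n12; apply/seteqP; split => // s [].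
  rewrite /itv/= !in_itv/= => /andP[h1 h2] /andP[h3 h4].
  have : n1%:R * T + T <= n2%:R * T.
    by rewrite -[X in _ + X]mul1r -mulrDl natr1 ler_pM2r// ler_nat.
  lra.
rewrite (eq_eseriesr (fun n _ => period n)) IE -(fineK Ifin).
under eq_eseriesr do rewrite muleC.
rewrite nneseriesZl; last by move=> n _; rewrite lee_fin exprn_ge0.
rewrite muleC; congr (_ * _)%E.
apply/cvg_lim => //.
have cg : series (geometric 1 (1 - p)) n @[n --> \oo] --> (p^-1 : R).
  have := @cvg_geometric_series R 1 (1 - p).
  by rewrite ger0_norm// (_ : 1 - (1 - p) = p) ?mul1r; [exact|ring].
have -> : (fun n => \sum_(0 <= k < n) ((1 - p) ^+ k)%:E)%E = EFin \o series (geometric 1 (1 - p)).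
  apply/funext => n /=; rewrite sumEFin; congr (_%:E).
  by apply: eq_bigr => k _; rewrite /geometric/= mul1r.
by apply: cvg_EFin; [exact: nearW|exact: cg].
Qed.

End mean_hitting_time.

(** * Negative targets by symmetry *)

Section negation.
Context d (O : measurableType d) (R : realType) (P : probability O R).

Let measurable_opp_rv (X : {RV P >-> R}) :
  measurable_fun setT (fun w => - X w).
Proof. exact: measurable_funN. Qed.

Definition opp_rv (X : {RV P >-> R}) : {RV P >-> R} :=
  HB.pack (fun w => - X w)
    (isMeasurableFun.Build _ _ _ _ _ (measurable_opp_rv X)).

Lemma opp_rvE X w : opp_rv X w = - X w. Proof. by []. Qed.

Lemma measurable_oppr_preimage (A : set R) : measurable A ->
  measurable ((fun x : R => - x) @^-1` A).
Proof.
move=> mA; rewrite -[_ @^-1` _]setTI.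
by apply: (_ : measurable_fun setT (fun x : R => - x)) => //; exact: oppr_measurable.
Qed.

Lemma preimage_set_system_opp (f : O -> R) :
  preimage_set_system setT (fun w => - f w) measurable =
  preimage_set_system setT f measurable.
Proof.
apply/seteqP; split => E [A mA <-]; exists ((fun x : R => - x) @^-1` A);
  do ?exact: measurable_oppr_preimage; by apply/seteqP; split => w /=; rewrite ?opprK.
Qed.

Lemma bridge_sigma_algebra_opp T (B : R -> {RV P >-> R}) :
  bridge_sigma_algebra T (fun t => opp_rv (B t)) = bridge_sigma_algebra T B.
Proof.
congr (<<s _ >>); apply: eq_bigcupr => t _; exact: preimage_set_system_opp.
Qed.

Lemma within_continuousN (A : set R) (f : R -> R) : {within A, continuous f} ->
  {within A, continuous (fun t => - f t)}.
Proof. by move=> cf x; apply: cvgN; exact: cf. Qed.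

End negation.

Lemma brownian_motion_opp d (O : measurableType d) (R : realType) (P : probability O R)
    (D : R) (W : R -> {RV P >-> R}) : 0 < D -> brownian_motion D W ->
  brownian_motion D (fun t => opp_rv (W t)).
Proof.
move=> D0 [W0 Winc Wind Wcont]; split.
- by apply: filterS W0 => w; rewrite opp_rvE => ->; rewrite oppr0.
- move=> s t s0 st A mA.
  have -> : (fun w => opp_rv (W t) w - opp_rv (W s) w) @^-1` A =
      (fun w => W t w - W s w) @^-1` ((fun x : R => - x) @^-1` A).
    by apply/seteqP; split => w /=; rewrite ?opp_rvE opprB opprK addrC.
  rewrite Winc//; last exact: measurable_oppr_preimage.
  have n10 : -1 != 0 :> R by rewrite oppr_eq0 oner_eq0.
  have v0 : 0 < D * (t - s) by rewrite mulr_gt0// subr_gt0.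
  have := normal_prob_affine 0 0 n10 v0 mA.
  rewrite sqrrN expr1n mul1r mulr0 addr0 => <-; congr normal_prob.
  by apply/seteqP; split => x /=; rewrite addr0 mulN1r.
- move=> t t0 tm n E hE; apply: (Wind t t0 tm) => i /hE.
  rewrite -(preimage_set_system_opp (fun w => W (t i.+1) w - W (t i) w)).
  congr (preimage_set_system _ _ _ _); apply/funext => w.
  by rewrite ?opp_rvE opprB opprK addrC.
- by apply: filterS Wcont => w; exact: within_continuousN.
Qed.

(** The negated Brownian motion is the witness for the law of the negated bridge; the preimages of
    the test sets under negation translate one law into the other. *)
Lemma brownian_bridge_opp d (O : measurableType d) (R : realType) (P : probability O R)
    (D T : R) (B : R -> {RV P >-> R}) : 0 < D -> brownian_bridge D T B ->
  brownian_bridge D T (fun t => opp_rv (B t)).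
Proof.
move=> D0 [cB [d' [U' [Q' [W [bmW law]]]]]]; split.
  by apply: filterS cB => w; exact: within_continuousN.
exists d', U', Q', (fun t => opp_rv (W t)); split; first exact: brownian_motion_opp.
move=> n t A t0 mA.
have := law n t (fun i => (fun x : R => - x) @^-1` A i) t0
  (fun i ni => measurable_oppr_preimage (mA i ni)).
congr (P _ = Q' _); apply: eq_bigcapr => i _; apply/seteqP; split => w /=;
  by rewrite ?opp_rvE ?mulrN opprB opprK [- W _ _ + _]addrC.
Qed.

Lemma independent_bridges_opp d (O : measurableType d) (R : realType)
    (P : probability O R) (D T : R) (B : nat -> R -> {RV P >-> R}) : 0 < D ->
  independent_bridges D T B -> independent_bridges D T (fun n t => opp_rv (B n t)).
Proof.
move=> D0 [bB iB]; split => [n|n E hE]; first exact: brownian_bridge_opp.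
by apply: iB => i /hE; rewrite bridge_sigma_algebra_opp.
Qed.

Lemma mean_hitting_time_opp d (O : measurableType d) (R : realType)
    (P : probability O R) (T a : R) (B : nat -> R -> {RV P >-> R}) :
  mean_hitting_time T (fun n t => opp_rv (B n t)) (- a) = mean_hitting_time T B a.
Proof.
apply: eq_integral => w _; congr (ereal_inf [set _ | _ in _]).
apply/seteqP; split => t /= [t0 h]; split => //.
  exact: oppr_inj.
by rewrite -h.
Qed.

(** For [k > 0], [k * gphi (k * z)] is the centered Gaussian density of standard deviation [k^-1],
    so this is the mean of 1 / (1 + Z^2) for such a variable Z. *)
Definition cauchy_smoothing (R : realType) (k : R) : \bar R :=
  (\int[@lebesgue_measure R]_z (k * gphi (k * z) / (1 + z ^+ 2))%:E)%E.

Lemma cauchy_smoothing_ge0 (R : realType) (k : R) : 0 <= k -> (0 <= cauchy_smoothing k)%E.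
Proof.
move=> k0; apply: integral_ge0 => z _; rewrite lee_fin divr_ge0//.
  by rewrite mulr_ge0// gphi_ge0.
by rewrite addr_ge0// sqr_ge0.
Qed.

Lemma measurable_cauchy_integrand (R : realType) :
  measurable_fun setT (fun u : R * R => u.1 * gphi (u.1 * u.2) / (1 + u.2 ^+ 2)).
Proof.
apply: measurable_funM; first apply: measurable_funM => //.
  by apply: (measurableT_comp (@measurable_gphi R)); exact: measurable_funM.
apply: (measurableT_comp (f := fun x : R => (1 + x ^+ 2)^-1)) => //.
apply: continuous_measurable_fun => x; apply: cvgV.
  by rewrite gt_eqF// ltr_pwDl// sqr_ge0.
by apply: cvgD; [exact: cvg_cst|exact: exprn_continuous].
Qed.

Lemma mean_hitting_timeE d (O : measurableType d) (R : realType)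
    (P : probability O R) (D T a : R) (B : nat -> R -> {RV P >-> R}) :
  0 < D -> 0 < T -> a != 0 -> independent_bridges D T B ->
  let k := level D T `|a| in
  (mean_hitting_time T B a = (T * (expR (k ^+ 2 / 2) - 1))%:E +
    (T / 2)%:E * cauchy_smoothing k)%E.
Proof.
move=> D0 T0; wlog a0 : a B / 0 < a => [wlog_pos|].
  move=> aN indB; move: (aN); rewrite neq_lt => /orP[a0|a0]; last exact: wlog_pos.
  rewrite -mean_hitting_time_opp -normrN; apply: wlog_pos.
  - by rewrite oppr_gt0.
  - by rewrite oppr_eq0.
  - exact: independent_bridges_opp.
move=> _ indB k; rewrite (mean_hitting_time_alive D0 T0 a0 indB).
rewrite /k gtr0_norm// integral_alive//.
set p := expR _; have p0 : 0 < p by exact: expR_gt0.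
have k0 := level_gt0 D0 T0 a0.
have mk : measurable_fun setT (fun z : R =>
    (level D T a * gphi (level D T a * z) / (1 + z ^+ 2))%:E : \bar R).
  by apply/measurable_EFinP; exact: (measurable_fun_pair2 (level D T a) (@measurable_cauchy_integrand R)).
have nk (z : R) : setT z -> (0 <= (level D T a * gphi (level D T a * z) / (1 + z ^+ 2))%:E)%E.
  move=> _; rewrite lee_fin divr_ge0//; last by rewrite addr_ge0// sqr_ge0.
  by apply: mulr_ge0; [exact: ltW|exact: gphi_ge0].
have pT : (0 <= (p * (T / 2))%:E)%E by rewrite lee_fin mulr_ge0 ?divr_ge0 ?ltW.
have -> : (\int[@lebesgue_measure R]_z (density D T a z * tpar T z)%:E =
    (p * (T / 2))%:E * cauchy_smoothing (level D T a))%E.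
  rewrite /cauchy_smoothing -(ge0_integralZl (@lebesgue_measure R) measurableT mk nk pT).
  by apply: eq_integral => z _; rewrite -EFinM density_tpar.
have h1 : (0 <= (T * (1 - p))%:E)%E.
  by rewrite lee_fin mulr_ge0 ?(ltW T0)// subr_ge0 expR_level_le1.
have h2 : (0 <= (p * (T / 2))%:E * cauchy_smoothing (level D T a))%E.
  by apply: mule_ge0 => //; apply: cauchy_smoothing_ge0; exact: ltW.
rewrite (ge0_muleDr _ h1 h2) muleA -!EFinM; congr (_%:E + _%:E * _)%E.
- rewrite -(invrK (expR (_ ^+ 2 / 2))) -expRN -/p; field; exact: lt0r_neq0.
- by field; exact: lt0r_neq0.
Qed.

(** * Gaussian and Cauchy integrals *)

Section gaussian_moments.
Context (R : realType).
Notation mu := (@lebesgue_measure R).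
Implicit Types (s l : R).

Lemma normal_pdf0E s x : 0 < s ->
  normal_pdf 0 s x = (Num.sqrt (2 * pi) * s)^-1 * expR (- (x ^+ 2 / (2 * s ^+ 2))).
Proof.
move=> s0; have := @normal_pdfV R 0 (s ^+ 2) x (exprn_gt0 _ s0).
have q0 : 0 <= 2 * pi :> R by rewrite mulr_ge0 ?pi_ge0.
by rewrite sqrtr_sqr gtr0_norm// (sqrtrM (s ^+ 2) q0) sqrtr_sqr gtr0_norm// subr0.
Qed.

Let measurable_expR_sqr l : measurable_fun setT (fun x : R => (expR (l * x ^+ 2))%:E).
Proof.
apply/measurable_EFinP; apply: measurableT_comp => //.
by apply: measurable_funM => //; exact: exprn_measurable.
Qed.

(** The tilted density is a multiple of the centered Gaussian density of variance
    [s ^+ 2 / (1 - 2 * l * s ^+ 2)]. *)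
Lemma integral_normal_expR_sqr s l : 0 < s -> 2 * l * s ^+ 2 < 1 ->
  (\int[normal_prob 0 s]_x (expR (l * x ^+ 2))%:E =
  ((Num.sqrt (1 - 2 * l * s ^+ 2))^-1)%:E)%E.
Proof.
move=> s0 ls; rewrite ge0_integral_normal_prob//.
set q := 1 - _; have q0 : 0 < q by rewrite subr_gt0.
have sq0 : 0 < Num.sqrt q by rewrite sqrtr_gt0.
have sqN : Num.sqrt q != 0 by rewrite gt_eqF.
have sN : s != 0 by rewrite gt_eqF.
have lE : l = (1 - q) / (2 * s ^+ 2) by rewrite /q; field.
clearbody q.
pose v := s / Num.sqrt q; have v0 : 0 < v by rewrite divr_gt0.
have tilt (x : R) : expR (l * x ^+ 2) * normal_pdf 0 s x = (Num.sqrt q)^-1 * normal_pdf 0 v x.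
  rewrite !normal_pdf0E// mulrCA -expRD.
  have -> : l * x ^+ 2 - x ^+ 2 / (2 * s ^+ 2) = - (x ^+ 2 / (2 * v ^+ 2)).
    rewrite /v expr_div_n (sqr_sqrtr (ltW q0)) lE; field.
    by rewrite sN gt_eqF.
  rewrite mulrA; congr (_ * _); rewrite /v; field.
  by rewrite sqN sN gt_eqF// sqrtr_gt0 mulr_gt0// pi_gt0.
transitivity (\int[mu]_x (((Num.sqrt q)^-1)%:E * (normal_pdf 0 v x)%:E))%E.
  by apply: eq_integral => x _; rewrite -!EFinM; congr _%:E; exact: tilt.
rewrite ge0_integralZl//.
- by rewrite integral_normal_pdf mule1.
- by apply/measurable_EFinP; exact: measurable_normal_pdf.
- by move=> x _; rewrite lee_fin normal_pdf_ge0.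
Qed.

(** The integrand is bounded below by the Gaussian peak on a line of infinite measure; the critical
    value of [l] is included. *)
Lemma integral_normal_expR_sqr_pinfty s l : 0 < s -> 1 <= 2 * l * s ^+ 2 ->
  (\int[normal_prob 0 s]_x (expR (l * x ^+ 2))%:E = +oo)%E.
Proof.
move=> s0 ls; rewrite ge0_integral_normal_prob//.
pose c := (Num.sqrt (2 * pi) * s)^-1.
have c0 : 0 < c by rewrite invr_gt0 mulr_gt0// sqrtr_gt0 mulr_gt0// pi_gt0.
have peak (x : R) : c <= expR (l * x ^+ 2) * normal_pdf 0 s x.
  rewrite normal_pdf0E// mulrCA -expRD.
  rewrite -[leLHS]mulr1 ler_pM2l// -[leLHS]expR0 ler_expR.
  have -> : l * x ^+ 2 - x ^+ 2 / (2 * s ^+ 2) =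
      (2 * l * s ^+ 2 - 1) * (x ^+ 2 / (2 * s ^+ 2)).
    by field; rewrite gt_eqF.
  apply: mulr_ge0; first by rewrite subr_ge0.
  by apply: divr_ge0; [exact: sqr_ge0|rewrite mulr_ge0// sqr_ge0].
apply/eqP; rewrite -leye_eq.
have -> : +oo%E = (\int[mu]_x cst c%:E x)%E.
  by rewrite integral_cst// /= (_ : mu setT = +oo%E) ?gt0_muley ?lte_fin// -set_itvNyy lebesgue_measure_itv.
apply: ge0_le_integral => //.
- by move=> x _; rewrite lee_fin ltW.
- apply: emeasurable_funM; first exact: measurable_expR_sqr.
  by apply/measurable_EFinP; exact: measurable_normal_pdf.
- by move=> x _; rewrite -EFinM lee_fin; exact: peak.
Qed.

Let continuous_expRN_sqr (b : R) : continuous (fun x : R => expR (- (b * x ^+ 2))).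
Proof.
move=> x; have h : {for x, continuous (fun x : R => - (b * x ^+ 2))}.
  by apply: cvgN; apply: cvgM; [exact: cvg_cst|exact: exprn_continuous].
exact: (continuous_comp h (@continuous_expR R _)).
Qed.

Lemma integral_half_gauss_moment (b : R) : 0 < b ->
  (\int[mu]_(x in `[0%R, +oo[) (x * expR (- (b * x ^+ 2)))%:E = ((2 * b)^-1)%:E)%E.
Proof.
move=> b0; pose F x : R := - (2 * b)^-1 * expR (- (b * x ^+ 2)).
have dF (x : R) : is_derive x 1 F (x * expR (- (b * x ^+ 2))).
  have d1 : is_derive x 1 (fun x => - (b * x ^+ 2)) (- (2 * b * x)).
    by apply: is_derive_eq; rewrite /GRing.scale/=; ring.
  have d2 := is_derive1_comp (f := expR) (g := fun x => - (b * x ^+ 2)) (is_derive_expR _) d1.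
  apply: is_derive_eq; rewrite /GRing.scale/=; field; exact: lt0r_neq0.
have contF (x : R) : {for x, continuous F}.
  by apply: differentiable_continuous; apply/derivable1_diffP; have [] := dF x.
have bx : b * x ^+ 2 @[x --> +oo] --> +oo.
  apply: gt0_cvgMry => //; apply: ger_cvgy (@cvg_id _ +oo).
  near=> x; rewrite expr2 ler_peMl//; near: x; exact: nbhs_pinfty_ge.
rewrite (ge0_continuous_FTC2y (F := F) (l := 0)).
- by rewrite -EFinB sub0r /F expr0n/= mulr0 oppr0 expR0 mulr1 opprK.
- by move=> x x0; rewrite mulr_ge0// expR_ge0.
- apply: continuous_subspaceT => x; apply: cvgM; first exact: cvg_id.
  exact: continuous_expRN_sqr.
- rewrite -[X in _ --> X](mulr0 (- (2 * b)^-1)); apply: cvgM; first exact: cvg_cst.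
  apply: (cvg_comp (fun x => b * x ^+ 2) (fun y => expR (- y)) bx); exact: cvgr_expR.
- by move=> x _; have [] := dF x.
- exact: cvg_at_right_filter (contF 0).
- by move=> x _; rewrite derive1E; apply: derive_val; exact: dF.
Unshelve. all: by end_near. Qed.

(** The factor [|x|] makes the Gaussian integral elementary. The result is the Cauchy density of
    scale [r / s], because the coefficient of [x ^+ 2] in the exponent is affine in [z ^+ 2]. *)
Lemma integral_normal_abs_gphi (s r z : R) : 0 < s -> 0 < r ->
  (\int[mu]_x (`|x| / r * gphi (`|x| / r * z) * normal_pdf 0 s x)%:E =
  (pi^-1 * ((r / s) / (z ^+ 2 + (r / s) ^+ 2)))%:E)%E.
Proof.
move=> s0 r0; pose f x : R := `|x| / r * gphi (`|x| / r * z) * normal_pdf 0 s x.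
have sN : s != 0 by rewrite gt_eqF.
have rN : r != 0 by rewrite gt_eqF.
have pi0 : 0 < pi :> R := pi_gt0 R.
pose b := z ^+ 2 / (2 * r ^+ 2) + 1 / (2 * s ^+ 2).
have b0 : 0 < b.
  apply: ltr_wpDl; last by rewrite divr_gt0// mulr_gt0// exprn_gt0.
  by apply: divr_ge0; [exact: sqr_ge0|rewrite mulr_ge0// sqr_ge0].
pose c := (2 * pi * r * s)^-1.
have q2 : Num.sqrt (2 * pi) ^+ 2 = 2 * pi :> R by rewrite sqr_sqrtr// mulr_ge0// ltW.
have qN : Num.sqrt (2 * pi) != 0 :> R by rewrite gt_eqF// sqrtr_gt0 mulr_gt0.
have cE : c = (Num.sqrt (2 * pi) ^+ 2 * r * s)^-1 by rewrite q2.
have fE x : f x = c * (`|x| * expR (- (b * x ^+ 2))).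
  rewrite /f normal_pdf0E// /gphi.
  have -> : - (b * x ^+ 2) = - ((`|x| / r * z) ^+ 2 / 2) - x ^+ 2 / (2 * s ^+ 2).
    rewrite !exprMn real_normK ?num_real// exprVn /b; field.
    by rewrite sN rN.
  rewrite expRD cE; field.
  by rewrite qN rN sN.
have f0 x : 0 <= f x.
  by rewrite fE mulr_ge0 ?invr_ge0 ?mulr_ge0 ?expR_ge0// ltW// .
have cf : continuous f.
  rewrite (_ : f = fun x => c * (`|x| * expR (- (b * x ^+ 2)))); last exact/funext.
  move=> x; apply: cvgM; first exact: cvg_cst.
  apply: cvgM; first exact: norm_continuous.
  exact: continuous_expRN_sqr.
rewrite (ge0_symfun_integralT f0 cf); last by move=> x /=; rewrite !fE normrN sqrrN.
have -> : [set x : R | (0 <= x)%R] = `[0, +oo[%classic.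
  by apply/seteqP; split => x /=; rewrite in_itv/= andbT.
transitivity (2%:E * (c%:E * \int[mu]_(x in `[0%R, +oo[) (x * expR (- (b * x ^+ 2)))%:E))%E.
  congr (_ * _)%E; rewrite -ge0_integralZl//.
  - apply: eq_integral => x; rewrite inE/= in_itv/= andbT => x0.
    by rewrite fE ger0_norm// EFinM.
  - apply/measurable_EFinP/measurable_funTS; apply: measurable_funM => //.
    by apply: measurableT_comp => //; apply: measurable_funN; apply: measurable_funM => //; exact: exprn_measurable.
  - by move=> x; rewrite /= in_itv/= andbT => x0; rewrite lee_fin mulr_ge0// expR_ge0.
  - by rewrite lee_fin invr_ge0 !mulr_ge0// ltW.
rewrite integral_half_gauss_moment// -!EFinM; congr _%:E.
have zN : (z * s) ^+ 2 + r ^+ 2 != 0.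
  by rewrite gt_eqF// ltr_wpDl ?exprn_gt0// sqr_ge0.
rewrite /c /b; move: (pi : R) pi0 => w w0; field.
by rewrite sN zN rN (lt0r_neq0 w0).
Qed.

(** Partial fractions divide by [c ^+ 2 - 1]. For [c = r / s] with [r = Num.sqrt (D * T) / 2], the
    bound [1 < c] says exactly that the averaged mean is finite. *)
Lemma integral_cauchy2 (c : R) : 1 < c ->
  (\int[mu]_z (((1 + z ^+ 2) * (z ^+ 2 + c ^+ 2))^-1)%:E = (pi / (c * (1 + c)))%:E)%E.
Proof.
move=> c1; have c0 : 0 < c by lra.
pose f z : R := ((1 + z ^+ 2) * (z ^+ 2 + c ^+ 2))^-1.
have d0 z : 0 < (1 + z ^+ 2) * (z ^+ 2 + c ^+ 2).
  by rewrite mulr_gt0// ?(ltr_pwDl _ (sqr_ge0 z))// ltr_wpDl ?sqr_ge0// exprn_gt0.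
have f0 z : 0 <= f z by rewrite invr_ge0 ltW.
have cf : continuous f.
  move=> z; apply: cvgV; first by rewrite gt_eqF.
  by apply: cvgM; apply: cvgD; (exact: cvg_cst || exact: exprn_continuous).
rewrite (ge0_symfun_integralT f0 cf); last by move=> x /=; rewrite /f sqrrN.
have -> : [set x : R | (0 <= x)%R] = `[0, +oo[%classic.
  by apply/seteqP; split => x /=; rewrite in_itv/= andbT.
have cN : c != 0 by rewrite gt_eqF.
have c1N : c - 1 != 0 by rewrite subr_eq0 gt_eqF.
have c2N : c + 1 != 0 by rewrite gt_eqF//; lra.
have c3N : c ^+ 2 - 1 != 0.
  by rewrite (_ : _ - _ = (c - 1) * (c + 1)) ?mulf_neq0//; ring.
pose F z : R := (c ^+ 2 - 1)^-1 * (atan z - c^-1 * atan (c^-1 * z)).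
have dF (z : R) : is_derive z 1 F (f z).
  have d1 : is_derive z 1 (fun z => c^-1 * z) c^-1.
    by apply: is_derive_eq; rewrite /GRing.scale/=; ring.
  have d2 := is_derive1_comp (f := atan) (g := fun z => c^-1 * z) (is_derive1_atan _) d1.
  have d3 := is_derive1_atan z.
  apply: is_derive_eq; rewrite /GRing.scale/= /f.
  have h1 : 1 + z ^+ 2 != 0 by rewrite gt_eqF// ltr_pwDl// sqr_ge0.
  have h2 : z ^+ 2 + c ^+ 2 != 0 by rewrite gt_eqF// ltr_wpDl ?sqr_ge0// exprn_gt0.
  have h3 : c ^+ 2 + z ^+ 2 != 0 by rewrite addrC.
  by field; rewrite ?cN ?c3N ?h1 ?h2 ?h3.
have contF (x : R) : {for x, continuous F}.
  by apply: differentiable_continuous; apply/derivable1_diffP; have [] := dF x.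
have la : atan x @[x --> +oo] --> (pi / 2 : R) by exact: cvgy_atan.
have cz : c^-1 * x @[x --> +oo] --> +oo.
  by apply: gt0_cvgMry; [rewrite invr_gt0|exact: cvg_id].
rewrite (ge0_continuous_FTC2y (F := F) (l := (c ^+ 2 - 1)^-1 * (pi / 2 - c^-1 * (pi / 2)))).
- rewrite /F mulr0 !atan0 mulr0 subr0 mulr0 sube0 -EFinM; congr _%:E.
  by field; rewrite ?cN ?c3N (addrC 1) ?c2N.
- by move=> x _; exact: f0.
- exact: continuous_subspaceT.
- apply: cvgM; first exact: cvg_cst.
  apply: cvgB => //; apply: cvgM; first exact: cvg_cst.
  exact: (cvg_comp _ _ cz la).
- by move=> x _; have [] := dF x.
- exact: cvg_at_right_filter (contF 0).
- by move=> x _; rewrite derive1E; apply: derive_val; exact: dF.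
Qed.

End gaussian_moments.

(** * Averaging over the Gaussian target *)

Section gaussian_average.
Context (R : realType).
Variables (D s T : R).
Hypotheses (D0 : 0 < D) (s0 : 0 < s) (T0 : 0 < T).
Notation mu := (@lebesgue_measure R).

Let r := Num.sqrt (D * T) / 2.
Let r0 : 0 < r. Proof. by rewrite divr_gt0// sqrtr_gt0 mulr_gt0. Qed.

Let levelE (a : R) : level D T a = a / r.
Proof.
by rewrite /level /r; field; rewrite gt_eqF// sqrtr_gt0 mulr_gt0.
Qed.

Let level_norm_ge0 (a : R) : 0 <= level D T `|a|.
Proof. by rewrite levelE divr_ge0// ltW. Qed.

Let smoothing_pair (u : R * R) : R :=
  level D T `|u.1| * gphi (level D T `|u.1| * u.2) / (1 + u.2 ^+ 2).

Let smoothing_pair_ge0 u : 0 <= smoothing_pair u.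
Proof.
apply: divr_ge0; last by rewrite addr_ge0// sqr_ge0.
by apply: mulr_ge0; [exact: level_norm_ge0|exact: gphi_ge0].
Qed.

Let measurable_smoothing_pair : measurable_fun setT smoothing_pair.
Proof.
have mg : measurable_fun setT (fun u : R * R => (level D T `|u.1|, u.2)).
  apply: measurable_fun_pair; last exact: measurable_snd.
  rewrite [X in measurable_fun _ X](_ : _ = fun u : R * R => `|u.1| * r^-1); last first.
    by apply/funext => u /=; rewrite levelE.
  by apply: measurable_funM => //; exact: measurableT_comp.
exact: (measurableT_comp (@measurable_cauchy_integrand R) mg).
Qed.

Let measurable_smoothing : measurable_fun setT (fun a : R => cauchy_smoothing (level D T `|a|)).
Proof.
have mE : measurable_fun setT (EFin \o smoothing_pair) by apply/measurable_EFinP.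
exact: (measurable_fun_fubini_tonelli_F (m2 := mu) (EFin \o smoothing_pair) mE
  (fun u => smoothing_pair_ge0 u)).
Qed.

Lemma integral_normal_smoothing : s < r ->
  (\int[normal_prob 0 s]_a cauchy_smoothing (level D T `|a|) = ((1 + r / s)^-1)%:E)%E.
Proof.
move=> sr; set c := r / s.
have c1 : 1 < c by rewrite ltr_pdivlMr// mul1r.
have c0 : 0 < c by lra.
rewrite (ge0_integral_normal_prob 0 s measurable_smoothing); last first.
  by move=> a; exact: cauchy_smoothing_ge0.
pose H (u : R * R) : \bar R := (smoothing_pair u * normal_pdf 0 s u.1)%:E.
have mH : measurable_fun setT H.
  apply/measurable_EFinP; apply: measurable_funM => //.
  by apply: (measurableT_comp (@measurable_normal_pdf R 0 s)).
have H0 u : (0 <= H u)%E by rewrite lee_fin mulr_ge0// normal_pdf_ge0.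
transitivity (\int[mu]_a \int[mu]_z H (a, z))%E.
  apply: eq_integral => a _; rewrite /cauchy_smoothing -ge0_integralZr//.
  - by apply/measurable_EFinP; exact: (measurable_fun_pair2 a measurable_smoothing_pair).
  - by move=> z _; rewrite lee_fin; exact: (smoothing_pair_ge0 (a, z)).
  - by rewrite lee_fin normal_pdf_ge0.
rewrite (fubini_tonelli (m1 := mu) (m2 := mu) H mH H0).
have d0 (z : R) : 0 < 1 + z ^+ 2 by rewrite ltr_pwDl// sqr_ge0.
have e0 (z : R) : 0 < z ^+ 2 + c ^+ 2 by rewrite ltr_wpDl ?sqr_ge0// exprn_gt0.
transitivity (\int[mu]_z ((c / pi)%:E * (((1 + z ^+ 2) * (z ^+ 2 + c ^+ 2))^-1)%:E))%E.
  apply: eq_integral => z _.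
  transitivity (\int[mu]_a (((1 + z ^+ 2)^-1)%:E *
      (`|a| / r * gphi (`|a| / r * z) * normal_pdf 0 s a)%:E))%E.
    apply: eq_integral => a _; rewrite -EFinM; congr _%:E.
    by rewrite /smoothing_pair/= !levelE mulrAC mulrC.
  rewrite ge0_integralZl//; last 3 first.
  - apply/measurable_EFinP; apply: measurable_funM; last exact: measurable_normal_pdf.
    have ma : measurable_fun setT (fun a : R => `|a| / r).
      by apply: measurable_funM => //; exact: measurableT_comp.
    apply: measurable_funM => //; apply: (measurableT_comp (@measurable_gphi R)).
    exact: measurable_funM.
  - move=> a _; rewrite lee_fin mulr_ge0 ?normal_pdf_ge0// mulr_ge0 ?gphi_ge0//.
    by rewrite divr_ge0// ltW.
  - by rewrite lee_fin invr_ge0 ltW.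
  rewrite integral_normal_abs_gphi// -!EFinM -/c; congr _%:E.
  by rewrite invfM; ring.
rewrite ge0_integralZl//; last 3 first.
- apply/measurable_EFinP; apply: continuous_measurable_fun => z.
  apply: cvgV; first by rewrite gt_eqF// mulr_gt0.
  by apply: cvgM; apply: cvgD; (exact: cvg_cst || exact: exprn_continuous).
- by move=> z _; rewrite lee_fin invr_ge0 mulr_ge0 ?ltW.
- by rewrite lee_fin divr_ge0 ?pi_ge0 ?ltW.
rewrite integral_cauchy2// -EFinM; congr _%:E.
have := pi_gt0 R; move: (pi : R) => w w0; field.
by rewrite !gt_eqF// addr_gt0.
Qed.

Let excess (a : R) : R := T * (expR (level D T `|a| ^+ 2 / 2) - 1).

Let excess_ge0 a : 0 <= excess a.
Proof.
apply: mulr_ge0; first exact: ltW.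
by rewrite subr_ge0 -[leLHS]expR0 ler_expR divr_ge0// sqr_ge0.
Qed.

Let excessE a : excess a + T = T * expR (2 / (D * T) * a ^+ 2).
Proof.
rewrite /excess mulrBr mulr1 subrK; congr (_ * expR _).
rewrite /level expr_div_n sqr_sqrtr; last by rewrite mulr_ge0 ?ltW.
rewrite exprMn real_normK ?num_real//; field.
by rewrite !gt_eqF.
Qed.

Let measurable_excess : measurable_fun setT excess.
Proof.
rewrite (_ : excess = fun a => T * expR (2 / (D * T) * a ^+ 2) - T); last first.
  by apply/funext => a; rewrite -excessE addrK.
apply: measurable_funB => //; apply: measurable_funM => //; apply: measurableT_comp => //.
by apply: measurable_funM => //; exact: exprn_measurable.
Qed.

(** Adding [T] turns the excess into a pure exponential and avoids subtracting a possibly infinite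
    integral, so the finite and infinite cases are treated alike. *)
Let integral_excessD : (\int[normal_prob 0 s]_a (excess a)%:E + T%:E =
  T%:E * \int[normal_prob 0 s]_a (expR (2 / (D * T) * a ^+ 2))%:E)%E.
Proof.
have m1 : measurable_fun setT (fun a : measurableTypeR R => (excess a)%:E).
  by apply/measurable_EFinP; exact: measurable_excess.
have m2 : measurable_fun setT (fun a : measurableTypeR R => (expR (2 / (D * T) * a ^+ 2))%:E).
  apply/measurable_EFinP; apply: measurableT_comp => //.
  by apply: measurable_funM => //; exact: exprn_measurable.
have T0' : (0 <= T%:E)%E by rewrite lee_fin ltW.
rewrite -ge0_integralZl//.
transitivity (\int[normal_prob 0 s]_a ((excess a)%:E + cst T%:E a))%E.
  rewrite ge0_integralD//.
    by rewrite integral_cst// [X in (_ * X)%E]probability_setT mule1.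
  by move=> a _; rewrite lee_fin; exact: excess_ge0.
by apply: eq_integral => a _; rewrite -EFinD -EFinM excessE.
Qed.

Let mean (a : R) : \bar R := ((excess a)%:E + (T / 2)%:E * cauchy_smoothing (level D T `|a|))%E.

Let integral_mean : (\int[normal_prob 0 s]_a mean a =
  \int[normal_prob 0 s]_a (excess a)%:E +
  (T / 2)%:E * \int[normal_prob 0 s]_a cauchy_smoothing (level D T `|a|))%E.
Proof.
have m1 : measurable_fun setT (fun a : measurableTypeR R => (excess a)%:E).
  by apply/measurable_EFinP; exact: measurable_excess.
have m2 : measurable_fun setT (fun a : measurableTypeR R => cauchy_smoothing (level D T `|a|)).
  exact: measurable_smoothing.
have T2 : (0 <= (T / 2)%:E)%E by rewrite lee_fin divr_ge0// ltW.
have p2 (a : R) : (0 <= cauchy_smoothing (level D T `|a|))%E by exact: cauchy_smoothing_ge0.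
rewrite -ge0_integralZl//; apply: ge0_integralD => //.
- by move=> a _; rewrite lee_fin; exact: excess_ge0.
- by move=> a _; exact: mule_ge0.
- by apply: emeasurable_funM => //; exact: measurable_cst.
Qed.

Lemma integral_normal_mean : (\int[normal_prob 0 s]_a mean a =
  if (4 * s ^+ 2 / D < T)%R
  then (T * Num.sqrt (D * T / (D * T - 4 * s ^+ 2)) - T
        + T * s / (Num.sqrt (D * T) + 2 * s))%:E
  else +oo)%E.
Proof.
have DT0 : 0 < D * T by exact: mulr_gt0.
have DTN : D * T != 0 by rewrite gt_eqF.
have lE : 2 * (2 / (D * T)) * s ^+ 2 = 4 * s ^+ 2 / (D * T) by field; rewrite !gt_eqF.
rewrite integral_mean ltr_pdivrMr// [T * D]mulrC; case: ltP => [lt4|ge4].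
- have l1 : 2 * (2 / (D * T)) * s ^+ 2 < 1 by rewrite lE ltr_pdivrMr// mul1r.
  have q0 : 0 < D * T - 4 * s ^+ 2 by rewrite subr_gt0.
  have := integral_excessD; rewrite integral_normal_expR_sqr// => h.
  have -> : (\int[normal_prob 0 s]_a (excess a)%:E =
      (T * Num.sqrt (D * T / (D * T - 4 * s ^+ 2)) - T)%:E)%E.
    rewrite -[LHS](@addeK _ T%:E)// h -EFinM -EFinB; congr (_ * _ - _)%:E.
    rewrite -sqrtrV ?subr_ge0 ?ltW// lE; congr Num.sqrt; field.
    by rewrite !gt_eqF.
  rewrite integral_normal_smoothing.
    rewrite -EFinM -EFinD; congr (_ + _)%:E; rewrite /r; field.
    by rewrite !gt_eqF// !addr_gt0// ?mulr_gt0// ?sqrtr_gt0.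
  rewrite /r ltr_pdivlMr// -(@ltr_pXn2r _ 2%N) ?nnegrE ?sqrtr_ge0 ?mulr_ge0 ?ltW//.
  by rewrite sqr_sqrtr ?ltW// exprMn mulrC -natrX.
- have l1 : 1 <= 2 * (2 / (D * T)) * s ^+ 2 by rewrite lE ler_pdivlMr// mul1r.
  have := integral_excessD; rewrite integral_normal_expR_sqr_pinfty// gt0_muley ?lte_fin//.
  have : (0 <= \int[normal_prob 0 s]_a cauchy_smoothing (level D T `|a|))%E.
    by apply: integral_ge0 => a _; exact: cauchy_smoothing_ge0.
  have T2 : (0 <= (T / 2)%:E)%E by rewrite lee_fin divr_ge0// ltW.
  move=> /(mule_ge0 T2); set v := (_ * _)%E => v0.
  have u0 : (0 <= \int[normal_prob 0 s]_a (excess a)%:E)%E.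
    by apply: integral_ge0 => a _; rewrite lee_fin; exact: excess_ge0.
  (* Since [T] is finite, the excess itself is infinite, and the nonnegative smoothing term cannot
     cancel it. *)
  have aux (u : \bar R) : (0 <= u -> u + T%:E = +oo -> u + v = +oo)%E.
    by case: u => [u| |]// _ _; case: v v0.
  exact: aux.
Qed.

End gaussian_average.

(** The closed form of the mean is established for [a != 0], and the origin is a null set of the
    target law. Measurability of the mean in [a] is bypassed by [ge0_integral_ae_eq]. *)
Theorem gauss_mean_search_timeE d (O : measurableType d) (R : realType)
    (P : probability O R) (D s T : R) (B : nat -> R -> {RV P >-> R}) :
  0 < D -> 0 < s -> 0 < T -> independent_bridges D T B ->
  gauss_mean_search_time s T B =
  if 4 * s ^+ 2 / D < T
  then (T * Num.sqrt (D * T / (D * T - 4 * s ^+ 2)) - T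
        + T * s / (Num.sqrt (D * T) + 2 * s))%:E
  else +oo%E.
Proof.
move=> D0 s0 T0 indB; rewrite -(integral_normal_mean D0 s0 T0).
rewrite /gauss_mean_search_time.
have m0 : measurable ([set 0] : set (measurableTypeR R)) by exact: measurable_set1.
have z0 : normal_prob 0 s [set 0] = 0%E by rewrite /normal_prob integral_set1.
apply: (ge0_integral_ae_eq m0 z0).
- by move=> a; apply: integral_ge0 => w _; exact: hitting_time_ge0.
- move=> a; apply: adde_ge0; last first.
    rewrite mule_ge0// ?lee_fin ?divr_ge0 ?(ltW T0)//; apply: cauchy_smoothing_ge0.
    by rewrite /level divr_ge0 ?mulr_ge0.
  rewrite lee_fin mulr_ge0 ?(ltW T0)// subr_ge0 -[leLHS]expR0 ler_expR divr_ge0//.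
  exact: sqr_ge0.
- by move=> a a0; apply: mean_hitting_timeE => //; apply/eqP.
Qed.

(** * Minimization of the rational profile *)

Section minimization.
Context (R : realType).
Implicit Types (w t : R).

(** Numerator and denominator of the mean in units of [sigma ^+ 2 / D]. With [Num.sqrt t = w + w^-1]
    also [Num.sqrt (t - 4) = w - w^-1], so both square roots disappear. *)
Let num w : R := (w ^+ 2 + 1) ^+ 2 * (w ^+ 2 + w + 2).
Let den w : R := w ^+ 2 * (w - 1) * (w + 1) ^+ 2.
(* The minimizer 2.83037 lies between [lo] and [hi]. *)
Let lo : R := 317 / 112.
Let hi : R := 484 / 171.

Let outside_low w : 1 < w -> w <= lo -> num lo * den w <= num w * den lo.
Proof.
rewrite /num /den /lo => w1 wlo.
pose x := w - 1; pose y := 317 / 112 - w.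
have x0 : 0 <= x by rewrite subr_ge0 ltW.
have y0 : 0 <= y by rewrite subr_ge0.
(* Bernstein form: the difference of the two sides is a combination of the
   products x^i * y^j, i + j = 6, with nonnegative coefficients. *)
have h i j : 0 <= x ^+ i * y ^+ j by rewrite mulr_ge0 ?exprn_ge0.
have := h 0%N 6; have := h 1%N 5; have := h 2 4; have := h 3 3; have := h 4 2.
have := h 5 1%N.
rewrite /x /y !expr0 !expr1 mul1r; lra.
Qed.

(** The difference of the two sides, expanded in powers of [w - hi], has nonnegative
    coefficients. *)
Let outside_high w : hi <= w -> num lo * den w <= num w * den lo.
Proof.
rewrite /num /den /lo /hi => whi.
have h i : 0 <= (w - 484 / 171) ^+ i by apply: exprn_ge0; rewrite subr_ge0; exact: whi.
have := h 1%N; have := h 2; have := h 3; have := h 4; have := h 5; have := h 6.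
rewrite !expr1; lra.
Qed.

(** [9693 / 2000] is 4.847 - 1/2000, the lower end of the claimed range. This slack below the
    minimum makes all coefficients in powers of [w - lo] nonnegative, although [lo] lies left of the
    minimizer. *)
Let num_ge w : lo <= w -> 9693 / 2000 * den w <= num w.
Proof.
rewrite /num /den /lo => whi.
have h i : 0 <= (w - 317 / 112) ^+ i by apply: exprn_ge0; rewrite subr_ge0; exact: whi.
have := h 1%N; have := h 2; have := h 3; have := h 4; have := h 5; have := h 6.
rewrite !expr1; lra.
Qed.

Let profile w : R := num w / den w.

Let den_gt0 w : 1 < w -> 0 < den w.
Proof.
move=> w1; have w0 : 0 < w by lra.
by rewrite /den !mulr_gt0 ?exprn_gt0 ?subr_gt0// ?addr_gt0.
Qed.

Let profile_outside w : 1 < w -> w <= lo \/ hi <= w -> profile lo <= profile w.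
Proof.
move=> w1 h; have lo1 : 1 < lo by rewrite /lo; lra.
rewrite /profile ler_pdivrMr ?den_gt0// mulrAC ler_pdivlMr ?den_gt0//.
by case: h => h; [exact: outside_low|exact: outside_high].
Qed.

Definition scaled_mean t : R := t * Num.sqrt (t / (t - 4)) - t + t / (2 + Num.sqrt t).

Let scaled_meanE w : 1 < w -> scaled_mean ((w + w^-1) ^+ 2) = profile w.
Proof.
move=> w1; have w0 : 0 < w by lra.
have wN : w != 0 by rewrite gt_eqF.
have v0 : 0 < w^-1 by rewrite invr_gt0.
have v1 : w^-1 < w by apply: (@lt_trans _ _ 1) => //; rewrite invf_lt1.
have m0 : 0 < w - w^-1 by rewrite subr_gt0.
have e : (w + w^-1) ^+ 2 - 4 = (w - w^-1) ^+ 2 by field.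
have p0 : 0 < w + w^-1 by rewrite addr_gt0.
rewrite /scaled_mean e -expr_div_n !sqrtr_sqr !gtr0_norm ?divr_gt0//.
rewrite /profile /num /den; field.
have h1 : w - 1 != 0 by rewrite gt_eqF// subr_gt0.
have h2 : w + 1 != 0 by rewrite gt_eqF// addr_gt0.
have h3 : w * w - 1 != 0 by rewrite (_ : _ - _ = (w - 1) * (w + 1)) ?mulf_neq0//; ring.
have h5 : 2 * w + (w * w + 1) != 0 by rewrite (_ : _ + _ = (w + 1) ^+ 2) ?expf_neq0//; ring.
by rewrite wN h1 h2 h3 h5.
Qed.

Let scaled_mean_profile t : 4 < t -> exists2 w, 1 < w & t = (w + w^-1) ^+ 2.
Proof.
move=> t4; pose x := Num.sqrt t; pose y := Num.sqrt (t - 4).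
have x2 : x ^+ 2 = t by rewrite sqr_sqrtr//; lra.
have y2 : y ^+ 2 = t - 4 by rewrite sqr_sqrtr//; lra.
have y0 : 0 < y by rewrite sqrtr_gt0 subr_gt0.
have x0 : 2 < x.
  rewrite -(@ltr_pXn2r _ 2%N) ?nnegrE ?sqrtr_ge0// x2; lra.
exists ((x + y) / 2); first by lra.
have -> : ((x + y) / 2)^-1 = (x - y) / 2.
  apply: (mulfI (x := (x + y) / 2)); first by rewrite gt_eqF//; lra.
  rewrite divff; last by rewrite gt_eqF//; lra.
  have : x ^+ 2 - y ^+ 2 = 4 by rewrite x2 y2; ring.
  lra.
by rewrite -x2; congr (_ ^+ 2); lra.
Qed.

(** Compactness gives a minimizer on [[lo, hi]]. It is global because outside this interval the
    profile is at least its value at the endpoint [lo]. *)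
Lemma scaled_mean_min : exists t m : R,
  [/\ 4 < t, scaled_mean t = m, forall u, 4 < u -> m <= scaled_mean u,
    `|m - (4 + 847 / 1000)| <= 1 / 2000 & `|t - (10 + 136 / 1000)| <= 1 / 2000].
Proof.
have lo1 : 1 < lo by rewrite /lo; lra.
have lohi : lo <= hi by rewrite /lo /hi; lra.
have cX (f : R -> R) : continuous f -> continuous (fun w => f w ^+ 2).
  by move=> cf w; exact: (continuous_comp (cf w) (@exprn_continuous R 2 _)).
have c1 : continuous (fun w : R => w ^+ 2 + 1).
  by move=> w; apply: cvgD; [exact: exprn_continuous|exact: cvg_cst].
have c2 : continuous (fun w : R => w + 1).
  by move=> w; apply: cvgD; [exact: cvg_id|exact: cvg_cst].
have cnum : continuous num.
  move=> w; apply: cvgM; first exact: cX c1 w.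
  by apply: cvgD; [apply: cvgD; [exact: exprn_continuous|exact: cvg_id]|exact: cvg_cst].
have cden : continuous den.
  move=> w; apply: cvgM; first apply: cvgM; first exact: exprn_continuous.
    by apply: cvgB; [exact: cvg_id|exact: cvg_cst].
  exact: cX c2 w.
have cprofile : {within `[lo, hi], continuous profile}.
  apply: continuous_in_subspaceT => w; rewrite inE/= in_itv/= => /andP[low _].
  apply: cvgM; first exact: cnum.
  by apply: cvgV; [rewrite gt_eqF// den_gt0// (lt_le_trans lo1)|exact: cden].
have [w + wmin] := EVT_min lohi cprofile; rewrite in_itv/= => /andP[low whi].
have w1 : 1 < w by exact: lt_le_trans low.
have minw v : 1 < v -> profile w <= profile v.
  move=> v1; have [vlo|lov] := leP v lo.
    apply: le_trans (profile_outside v1 (or_introl vlo)).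
    by apply: wmin; rewrite in_itv/= lexx.
  have [hiv|vhi] := leP hi v.
    apply: le_trans (profile_outside v1 (or_intror hiv)).
    by apply: wmin; rewrite in_itv/= lexx.
  by apply: wmin; rewrite in_itv/= !ltW.
have w0 : 0 < w by lra.
exists ((w + w^-1) ^+ 2), (profile w); split.
- have : 0 < (w - w^-1) ^+ 2.
    rewrite exprn_gt0// subr_gt0; apply: (@lt_trans _ _ 1) => //; rewrite invf_lt1//.
  by rewrite (_ : (w - w^-1) ^+ 2 = (w + w^-1) ^+ 2 - 4) ?subr_gt0//; field; rewrite gt_eqF.
- exact: scaled_meanE.
- by move=> u /scaled_mean_profile[v v1 ->]; rewrite scaled_meanE// minw.
- have : 9693 / 2000 <= profile w by rewrite ler_pdivlMr ?den_gt0// num_ge.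
  have : profile w <= 9695 / 2000.
    apply: (le_trans (minw _ lo1)); rewrite ler_pdivrMr ?den_gt0//.
    by rewrite /num /den /lo; lra.
  by move: (profile w) => q h1 h2; rewrite ler_norml; apply/andP; split; lra.
(* The increasing term [w ^+ 2] and the decreasing term [(w ^+ 2)^-1] are bounded separately; the
   interval is short enough for this to meet the tolerance. *)
- have e : (w + w^-1) ^+ 2 = w ^+ 2 + 2 + (w ^+ 2)^-1 by field; rewrite gt_eqF.
  have s0 : 0 < w ^+ 2 by rewrite exprn_gt0.
  have l2 : lo ^+ 2 <= w ^+ 2 by rewrite ler_pXn2r// nnegrE; lra.
  have h2 : w ^+ 2 <= hi ^+ 2 by rewrite ler_pXn2r// nnegrE; lra.
  have i1 : (hi ^+ 2)^-1 <= (w ^+ 2)^-1 by rewrite lef_pV2// posrE// exprn_gt0//; lra.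
  have i2 : (w ^+ 2)^-1 <= (lo ^+ 2)^-1 by rewrite lef_pV2// posrE// exprn_gt0//; lra.
  rewrite e ler_norml; move: l2 h2 i1 i2; rewrite /lo /hi => l2 h2 i1 i2.
  by apply/andP; split; lra.
Qed.

End minimization.

Theorem theorem2 (R : realType) (D sigma : R) (D_gt0 : 0 < D)
    (sigma_gt0 : 0 < sigma)
    (d : R -> measure_display) (Omega : forall T : R, measurableType (d T))
    (P : forall T : R, probability (Omega T) R)
    (B : forall T : R, nat -> R -> {RV (P T) >-> R}) :
  let J (T : R) : \bar R := gauss_mean_search_time sigma T (B T) in
  [/\ forall T : R, 0 < T -> independent_bridges D T (B T) ->
        J T = if 4 * sigma ^+ 2 / D < T
              then (T * Num.sqrt (D * T / (D * T - 4 * sigma ^+ 2)) - T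
                    + T * sigma / (Num.sqrt (D * T) + 2 * sigma))%:E
              else +oo%E,
      forall calT : R, 0 < calT ->
        independent_bridges D (sigma ^+ 2 / D * calT)
          (B (sigma ^+ 2 / D * calT)) ->
        J (sigma ^+ 2 / D * calT)
        = if 4 < calT
          then (sigma ^+ 2 / D
                * (calT * Num.sqrt (calT / (calT - 4)) - calT
                   + calT / (2 + Num.sqrt calT)))%:E
          else +oo%E
    & (forall T : R, 0 < T -> independent_bridges D T (B T)) ->
      exists Tmin m : R,
        [/\ 0 < Tmin,
            J Tmin = m%:E,
            ereal_inf [set J T | T in [set T : R | 0 < T]] = m%:E,
            `|m - (4 + 847 / 1000) * (sigma ^+ 2 / D)|
              <= (1 / 2000) * (sigma ^+ 2 / D)
          & `|Tmin - (10 + 136 / 1000) * (sigma ^+ 2 / D)|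
              <= (1 / 2000) * (sigma ^+ 2 / D)]].
Proof.
move=> J; have DN : D != 0 by rewrite gt_eqF.
have sN : sigma != 0 by rewrite gt_eqF.
set u := sigma ^+ 2 / D; have u0 : 0 < u by rewrite divr_gt0// exprn_gt0.
have part1 (T : R) : 0 < T -> independent_bridges D T (B T) -> J T = _ :=
  fun T0 => gauss_mean_search_timeE D_gt0 sigma_gt0 T0.
have part2 (t : R) : 0 < t -> independent_bridges D (u * t) (B (u * t)) ->
    J (u * t) = if 4 < t then (u * scaled_mean t)%:E else +oo%E.
  move=> t0 indB; rewrite part1//; last exact: mulr_gt0.
  have -> : 4 * sigma ^+ 2 / D = u * 4 by rewrite /u; ring.
  rewrite ltr_pM2l//; case: ifP => // t4.
  have Dut : D * (u * t) = sigma ^+ 2 * t by rewrite /u; field.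
  have st : 0 < sigma ^+ 2 * t by rewrite mulr_gt0// exprn_gt0.
  have t4N : t - 4 != 0 by rewrite gt_eqF// subr_gt0.
  have q0 : 0 < 2 + Num.sqrt t by rewrite ltr_pwDl// sqrtr_ge0.
  rewrite Dut (sqrtrM t (sqr_ge0 sigma)) sqrtr_sqr gtr0_norm//.
  have -> : sigma ^+ 2 * t / (sigma ^+ 2 * t - 4 * sigma ^+ 2) = t / (t - 4).
    rewrite (_ : _ - _ = sigma ^+ 2 * (t - 4)); last by ring.
    by field; rewrite t4N.
  congr _%:E; rewrite /scaled_mean; field.
  by rewrite gt_eqF//= (_ : _ + _ = sigma * (2 + Num.sqrt t)) ?mulf_neq0 ?gt_eqF//; ring.
split => //= indB.
have [t [m [t4 tm mmin mE tE]]] := scaled_mean_min R.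
have t0 : 0 < t by lra.
have ut : J (u * t) = (u * m)%:E.
  by rewrite part2// ?t4 ?tm//; apply: indB; exact: mulr_gt0.
exists (u * t), (u * m); split => //.
- exact: mulr_gt0.
- apply/eqP; rewrite eq_le; apply/andP; split.
    by apply: ereal_inf_lbound; exists (u * t) => //=; exact: mulr_gt0.
  apply: le_ereal_inf_tmp => _ [T /= T0 <-].
  (* In units of [u] every [T] falls under the scaled formula: beyond 4 the minimum bounds it below,
     and up to 4 the value is infinite. *)
  have -> : T = u * (T / u) by field; rewrite gt_eqF.
  have Tu : 0 < T / u by exact: divr_gt0.
  rewrite part2//; last by apply: indB; exact: mulr_gt0.
  by case: ifP => [T4|_]; [rewrite lee_fin ler_pM2l// mmin|rewrite leey].
- by rewrite mulrC -mulrBl normrM (gtr0_norm u0) ler_pM2r.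
- by rewrite mulrC -mulrBl normrM (gtr0_norm u0) ler_pM2r.
Qed.
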